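(* For the leading household $\mathsf{H}_2$, the optimal investment decision $\{\bar I_2(t)\}_{t\in[0,T]}$ and the optimal consumption decision $\{\bar C_2(t)\}_{t\in[0,T]}$ in the problem $$\sup_{\{I_2(t)\},\{C_2(t)\}}\bar J(I_2,C_2)$$ described in the context are given by $$\bar I_2(t)=\frac{v}{\alpha_2\sigma^2}e^{r(t-T)}\quad\text{and}\quad \bar C_2(t)=\frac{1-\rho}{\beta_2}\,rt+\bar k_2,$$ respectively, where $$\bar k_2=\left(\frac{\beta_2}{\alpha_2}+\frac{e^{rT}-1}{r}\right)^{-1}\left[-rT+x_2e^{rT}+\frac{\ln\gamma_2}{\alpha_2}+\frac{v^2T}{2\alpha_2\sigma^2}+\frac{(\rho-1)(e^{rT}-rT-1)}{\beta_2 r}\right].$$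
   Context: The financial market consists of one risk-free asset with interest rate $r$ and one risky asset with excess return rate $v$ and volatility $\sigma$; the time horizon is $[0,T]$. Let $\{B(t)\}_{t\in[0,T]}$ be a standard Brownian motion on a complete filtered probability space. The leading household $\mathsf{H}_2$ chooses an investment decision $\{I_2(t)\}_{t\in[0,T]}$ (the fund allocated to the risky asset, with no restriction on its sign) and a consumption decision $\{C_2(t)\}_{t\in[0,T]}$ (assumed to be always positive). Its fund process $\{X_2(t)\}_{t\in[0,T]}$ satisfies $$dX_2(t)=[rX_2(t)+vI_2(t)-C_2(t)]\,dt+\sigma I_2(t)\,dB(t),\qquad X_2(0)=x_2,$$ where $x_2$ is the initial fund. The objective functional to be maximized is $$\bar J(I_2,C_2)=\mathbb{E}\,\phi_2[X_2(T)]+\gamma_2\int_0^T\psi_2[t,C_2(t)]\,dt,$$ with fund utility $\phi_2[X_2(T)]=-\frac{1}{\alpha_2}e^{-\alpha_2X_2(T)}$ and consumption utility $\psi_2[t,C_2(t)]=-\frac{1}{\beta_2}e^{-\rho rt-\beta_2C_2(t)}$. Here $\alpha_2>0$ is the risk aversion coefficient, $\beta_2>0$ the diminishing marginal coefficient, $\gamma_2>0$ the consumption weight coefficient, and $\rho>0$ the decay coefficient.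
   Formalization: In the bracket of k̄₂ the term −rT is corrected to −rT/α₂ (as printed it is optimal only if α₂=1); C̄₂ is assumed positive on [0,T], as admissibility requires; r≠0, consumption is deterministic and integrable, and investment is adapted and square integrable. *)

(* Defs.v *)
From HB Require Import structures.
From mathcomp Require Import all_boot all_order all_algebra.
From mathcomp Require Import all_classical all_reals all_analysis.

Set Implicit Arguments.
Unset Strict Implicit.
Unset Printing Implicit Defensive.

Import Order.TTheory GRing.Theory Num.Theory.
Import numFieldNormedType.Exports.

Local Open Scope classical_set_scope.
Local Open Scope ring_scope.

(* A process is a map [R -> Omega -> R], time first; only its values at the
   times of [`[0, T]] matter. *)

Section StochasticBasis.
Context {R : realType} {d : measure_display} {Omega : measurableType d}.
Variables (P : probability Omega R) (T : R).
Local Notation mu := (@lebesgue_measure R).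

(* Completeness: [F 0] contains every subset of a [P]-null event, hence so does
   each [F t], and [P] itself is complete.  Right-continuity is not required. *)
Definition complete_filtration (F : R -> set (set Omega)) : Prop :=
  [/\ forall t : R, t \in `[0, T] -> sigma_algebra setT (F t),
      forall t : R, t \in `[0, T] -> F t `<=` measurable,
      forall s t : R, 0 <= s -> s <= t -> t <= T -> F s `<=` F t &
      forall N, P.-negligible N -> F 0 N].

Definition measurable_wrt (G : set (set Omega)) (xi : Omega -> R) : Prop :=
  forall U : set R, measurable U -> G (xi @^-1` U).

Definition adapted (F : R -> set (set Omega)) (X : R -> Omega -> R) : Prop :=
  forall t : R, t \in `[0, T] -> measurable_wrt (F t) (X t).

Definition continuous_paths (X : R -> Omega -> R) : Prop :=
  {ae P, forall w, {within `[0, T], continuous (fun t => X t w)}}.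

Definition increment (B : R -> Omega -> R) (s t : R) (w : Omega) : R :=
  B t w - B s w.

(* The second argument of [normal_prob] is the standard deviation. *)
Definition brownian_motion (F : R -> set (set Omega)) (B : R -> Omega -> R) :
    Prop :=
  [/\ {ae P, forall w, B 0 w = 0},
      continuous_paths B,
      adapted F B,
      (forall (s t : R) (A : set Omega) (U : set R),
        0 <= s -> s < t -> t <= T -> F s A -> measurable U ->
        P (A `&` increment B s t @^-1` U) = (P A * P (increment B s t @^-1` U))%E) &
      (forall (s t : R) (U : set R),
        0 <= s -> s < t -> t <= T -> measurable U ->
        P (increment B s t @^-1` U) = normal_prob 0 (Num.sqrt (t - s)) U)].

(* The simple process
   [sum_(i < size) coef i * 1_(]knot i, knot i.+1])]. *)
Record simple_process := SimpleProcess {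
  sp_size : nat;
  sp_knot : nat -> R;
  sp_coef : nat -> Omega -> R }.

Definition sp_admissible (F : R -> set (set Omega)) (H : simple_process) :
    Prop :=
  [/\ forall i, (i <= sp_size H)%N -> sp_knot H i \in `[0, T],
      forall i, (i < sp_size H)%N -> sp_knot H i <= sp_knot H i.+1,
      forall i, (i < sp_size H)%N ->
        measurable_wrt (F (sp_knot H i)) (sp_coef H i) &
      exists K : R, forall i w, (i < sp_size H)%N -> `|sp_coef H i w| <= K].

Definition sp_fun (H : simple_process) (t : R) (w : Omega) : R :=
  \sum_(i < sp_size H)
    sp_coef H i w * \1_(`]sp_knot H i, sp_knot H i.+1]%classic) t.

Definition sp_integral (B : R -> Omega -> R) (H : simple_process)
    (t : R) (w : Omega) : R :=
  \sum_(i < sp_size H)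
    sp_coef H i w *
      increment B (Num.min (sp_knot H i) t) (Num.min (sp_knot H i.+1) t) w.

(* Adapted, jointly measurable processes with [E \int_0^T I(t)^2 dt < oo]. *)
Definition square_integrable_process (F : R -> set (set Omega))
    (I : R -> Omega -> R) : Prop :=
  [/\ adapted F I,
      measurable_fun ((`[0, T] : set R) `*` [set: Omega])
        (fun p : R * Omega => I p.1 p.2) &
      (\int[P]_w \int[mu]_(t in `[0%R, T]) ((I t w) ^+ 2)%:E < +oo)%E].

(* [M t] is (a version of) the Ito integral of [I] over [0, t], for every
   [t] in [0, T]: the L^2(P)-limit of the integrals of simple processes that
   approximate [I] in L^2(dt x dP). *)
Definition is_ito_integral (F : R -> set (set Omega)) (B I M : R -> Omega -> R) :
    Prop :=
  adapted F M /\
  exists H : nat -> simple_process,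
    [/\ forall n, sp_admissible F (H n),
        (fun n => \int[P]_w \int[mu]_(t in `[0%R, T])
                    ((sp_fun (H n) t w - I t w) ^+ 2)%:E)%E
          @ \oo --> 0%E &
        forall t : R, t \in `[0, T] ->
        (fun n => \int[P]_w ((sp_integral B (H n) t w - M t w) ^+ 2)%:E)%E
          @ \oo --> 0%E].

End StochasticBasis.

Section LeadingHousehold.
Context {R : realType} {d : measure_display} {Omega : measurableType d}.
Variables (P : probability Omega R) (T : R).
Variables (F : R -> set (set Omega)) (B : R -> Omega -> R).
Variables (r v sigma x2 alpha2 beta2 gamma2 rho : R).
Local Notation mu := (@lebesgue_measure R).

(* The equation at [t = 0] contains the initial condition, since the Ito
   integral vanishes almost surely there. *)
Definition fund_process (I : R -> Omega -> R) (C : R -> R)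
    (X : R -> Omega -> R) : Prop :=
  [/\ adapted T F X,
      continuous_paths P T X &
      exists2 M : R -> Omega -> R,
        is_ito_integral P T F B (fun t w => sigma * I t w) M &
        forall t : R, t \in `[0, T] ->
          {ae P, forall w, X t w =
             x2 + \int[mu]_(s in `[0, t]) (r * X s w + v * I s w - C s)
             + M t w}].

(* The consumption is a function of time only: the consumption term of the
   objective carries no expectation.  Square integrability of the investment
   rules out doubling strategies. *)
Definition admissible (I : R -> Omega -> R) (C : R -> R) : Prop :=
  [/\ square_integrable_process P T F I,
      mu.-integrable `[0, T] (EFin \o C) &
      forall t : R, t \in `[0, T] -> 0 < C t].

Definition fund_utility (x : R) : R := - alpha2^-1 * expR (- alpha2 * x).

Definition consumption_utility (t c : R) : R :=
  - beta2^-1 * expR (- rho * r * t - beta2 * c).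

(* Extended-real valued: the expected utility of a nonintegrable fund is -oo. *)
Definition objective (C : R -> R) (X : R -> Omega -> R) : \bar R :=
  ('E_P[fun w => fund_utility (X T w)]
   + (gamma2 * \int[mu]_(t in `[0%R, T]) consumption_utility t (C t))%:E)%E.

Definition optimal_value : \bar R :=
  ereal_sup [set j | exists I C X,
    [/\ admissible I C, fund_process I C X & j = objective C X]].

Definition optimal (I : R -> Omega -> R) (C : R -> R) : Prop :=
  [/\ admissible I C,
      exists X, fund_process I C X &
      forall X, fund_process I C X -> objective C X = optimal_value].

Definition optimal_investment (t : R) : R :=
  v / (alpha2 * sigma ^+ 2) * expR (r * (t - T)).

(* The first-order condition in [C2] reads
   [beta2 * C2 t = ln gamma2 + alpha2 * m - r * T + (1 - rho) * r * t], with [m]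
   the certainty equivalent of [X2 T]; dividing by [alpha2] before solving for
   the constant gives the term [- r * T / alpha2]. *)
Definition k2 : R :=
  (beta2 / alpha2 + (expR (r * T) - 1) / r)^-1 *
  (- (r * T) / alpha2 + x2 * expR (r * T) + ln gamma2 / alpha2
   + v ^+ 2 * T / (2 * alpha2 * sigma ^+ 2)
   + (rho - 1) * (expR (r * T) - r * T - 1) / (beta2 * r)).

Definition optimal_consumption (t : R) : R :=
  (1 - rho) / beta2 * (r * t) + k2.

End LeadingHousehold.

(* Main.v *)
(* The proof is convex duality with the state price density. Put
   [theta = v / sigma] and [Z = exp (- theta * B T - theta ^ 2 * T / 2)].

   For every admissible strategy the budget identity
     [E (Z * exp (- r * T) * X T) = x2 - \int_0^T exp (- r * s) * C s ds]
   holds. Indeed [exp (- r * T) * X T - x2] is the almost sure limit of the sums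
   of [exp (- r * t_i)] times the increment over [t_i, t_i+1] of the process
   [X t - r * \int_0^t X s ds]. These sums are bounded in L^2, and their means
   against [Z] are known, since [E (Z * \int_0^t I dB) = - theta * E (Z *
   \int_0^t I ds)]; this follows from the case of simple processes.

   The candidate fund is explicit, [Xbar t = q t + kappa * sigma * exp (r * t) *
   B t] with [q] deterministic, and [U' (Xbar T) = y * Z] for a constant [y].
   Since the fund utility [U] is concave,
     [U (X T) <= U (Xbar T) + y * Z * (X T - Xbar T)],
   and the expectation of the last term is expressed by the two consumptions. The
   constant [k2] is the one for which the first-order condition
     [gamma2 * exp (- rho * r * s - beta2 * Cbar s) = y * exp (r * T) * exp (- r * s)]
   holds, so the loss of consumption utility, which is concave too, dominates
   that term. *)

Require Import Defs.
From HB Require Import structures.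
From mathcomp Require Import all_boot all_order all_algebra.
From mathcomp Require Import all_classical all_reals all_analysis.
From mathcomp Require Import measurable_realfun normal_distribution.
From mathcomp Require Import ring lra.

Import Order.TTheory GRing.Theory Num.Theory.
Import numFieldNormedType.Exports.

Local Open Scope classical_set_scope.
Local Open Scope ring_scope.

Set Implicit Arguments.
Unset Strict Implicit.
Unset Printing Implicit Defensive.

(** The Ito integral is available only as an L^2 limit of integrals of simple processes, so the
    isometry, the Girsanov identity and uniqueness are proved for step functions and passed to the
    limit. A fund process is constrained very little: it is adapted, has continuous paths and
    satisfies its equation almost surely at each fixed time, with no moment bound. Ito's formula for
    [exp (- r * t) * X t] is therefore replaced by sums over countably many knots, whose limit is
    taken path by path; square integrability of [X T] is a conclusion, not an assumption. As these
    sums see only the stochastic integral at the knots, the same limit shows that the strategy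
    determines [X T] almost surely.

    The value [theta = v / sigma] is the one for which the excess return [v * I] cancels under [Z],
    so the budget does not depend on the investment. The candidate integrand is deterministic and
    smooth in time, so its stochastic integral can be integrated by parts and becomes an expression
    in the path of [B]. The constant [k2] occurs in [q T] as well, so the first-order condition is a
    linear equation for it; the inverted factor in [k2] is the coefficient of that equation, divided
    by [alpha2]. *)

Lemma integrable_scale {R : realType} {d : measure_display}
    {W : measurableType d} (m : {measure set W -> \bar R}) (D : set W)
    (k : R) (f : W -> R) : measurable D ->
  m.-integrable D (EFin \o f) -> m.-integrable D (EFin \o (fun x => k * f x)).
Proof. by move=> mD fi; apply: eq_integrable (integrableZl mD k fi). Qed.

(** * Integrable and square-integrable random variables *)

Section Moments.
Context {R : realType} {d : measure_display} {W : measurableType d}.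
Variable P : probability W R.
Implicit Types (X Y Z : W -> R).

Definition L1 X := P.-integrable setT (EFin \o X).

Definition L2 X := measurable_fun setT X /\ L1 (fun w => X w ^+ 2).

Definition mean X : R := \int[P]_w X w.

Lemma L1_measurable X : L1 X -> measurable_fun setT X.
Proof. by move=> /integrableP[/measurable_EFinP]. Qed.

Lemma L1_dom Y X : measurable_fun setT X -> L1 Y ->
  (forall w, `|X w| <= Y w) -> L1 X.
Proof.
move=> mX iY XY; apply: le_integrable iY => //; first exact/measurable_EFinP.
by move=> w _ /=; rewrite lee_fin (le_trans (XY w))// ler_norm.
Qed.

Lemma L1_cst (c : R) : L1 (fun=> c).
Proof. exact: finite_measure_integrable_cst. Qed.

Lemma L1D X Y : L1 X -> L1 Y -> L1 (fun w => X w + Y w).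
Proof. by move=> iX iY; apply: eq_integrable (integrableD _ iX iY). Qed.

Lemma L1Z (c : R) X : L1 X -> L1 (fun w => c * X w).
Proof. by move=> iX; apply: eq_integrable (integrableZl _ c iX). Qed.

Lemma L1N X : L1 X -> L1 (fun w => - X w).
Proof.
by move=> /(L1Z (-1)); under eq_fun do rewrite mulN1r.
Qed.

Lemma L1B X Y : L1 X -> L1 Y -> L1 (fun w => X w - Y w).
Proof. by move=> iX /L1N; exact: L1D. Qed.

Lemma L1_sum (I : Type) (s : seq I) (X : I -> W -> R) :
  (forall i, L1 (X i)) -> L1 (fun w => \sum_(i <- s) X i w).
Proof.
move=> iX; elim: s => [|i s ih].
  by under eq_fun do rewrite big_nil; exact: L1_cst.
by under eq_fun do rewrite big_cons; exact: L1D.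
Qed.

Lemma eq_mean X Y : X =1 Y -> mean X = mean Y.
Proof. by move=> /funext ->. Qed.

Lemma meanZ c X : L1 X -> mean (fun w => c * X w) = c * mean X.
Proof. by move=> iX; rewrite /mean RintegralZl. Qed.

Lemma meanD X Y : L1 X -> L1 Y ->
  mean (fun w => X w + Y w) = mean X + mean Y.
Proof. by move=> iX iY; rewrite /mean RintegralD. Qed.

Lemma meanB X Y : L1 X -> L1 Y ->
  mean (fun w => X w - Y w) = mean X - mean Y.
Proof. by move=> iX iY; rewrite /mean RintegralB. Qed.

Lemma mean_cst c : mean (fun=> c) = c.
Proof.
rewrite /mean Rintegral_cst//.
by rewrite (_ : fine _ = 1) ?mulr1// [X in fine X](@probability_setT _ _ _ P).
Qed.

Lemma mean_sum (I : Type) (s : seq I) (X : I -> W -> R) :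
  (forall i, L1 (X i)) ->
  mean (fun w => \sum_(i <- s) X i w) = \sum_(i <- s) mean (X i).
Proof.
move=> iX; elim: s => [|i s ih].
  by under [X in mean X]eq_fun do rewrite big_nil; rewrite mean_cst big_nil.
under [X in mean X]eq_fun do rewrite big_cons.
by rewrite meanD//; [rewrite ih big_cons|exact: L1_sum].
Qed.

Lemma mean_ge0 X : (forall w, 0 <= X w) -> 0 <= mean X.
Proof. by move=> X0; apply: Rintegral_ge0. Qed.

Lemma mean_le X Y : L1 X -> L1 Y -> (forall w, X w <= Y w) -> mean X <= mean Y.
Proof. by move=> iX iY XY; apply: le_Rintegral. Qed.

Lemma mean_norm_le X : L1 X -> `|mean X| <= mean (fun w => `|X w|).
Proof. by move=> iX; apply: le_normr_Rintegral. Qed.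

Lemma L1_norm X : L1 X -> L1 (fun w => `|X w|).
Proof. exact: integrable_norm. Qed.

Lemma L1_EFin X : L1 X -> (\int[P]_w (X w)%:E)%E = (mean X)%:E.
Proof. by move=> iX; rewrite /mean /Rintegral fineK// integrable_fin_num. Qed.

Lemma ae_eq_mean X Y : measurable_fun setT X -> measurable_fun setT Y ->
  {ae P, forall w, X w = Y w} -> mean X = mean Y.
Proof.
move=> mX mY XY; rewrite /mean /Rintegral; congr fine.
apply: ae_eq_integral => //; [exact/measurable_EFinP|exact/measurable_EFinP|].
by apply: filterS XY => w -> _.
Qed.

Lemma ae_eq_L1 X Y : measurable_fun setT Y ->
  {ae P, forall w, X w = Y w} -> L1 X -> L1 Y.
Proof.
move=> mY XY iX; apply/integrableP; split; first exact/measurable_EFinP.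
have /integrableP[mX] := iX; apply: le_lt_trans.
rewrite le_eqVlt; apply/orP; left; apply/eqP.
apply: ae_eq_integral => //; first exact/measurableT_comp/measurable_EFinP.
  exact: measurableT_comp.
by apply: filterS XY => w /= -> _.
Qed.

Lemma L2M X Y : L2 X -> L2 Y -> L1 (fun w => X w * Y w).
Proof.
move=> [mX iX] [mY iY].
apply: (@L1_dom _ _ _ (L1D iX iY)) => [|w]; first exact: measurable_funM.
rewrite normrM -[X w ^+ 2]real_normK ?num_real// -[Y w ^+ 2]real_normK ?num_real//.
by have := sqr_ge0 (`|X w| - `|Y w|); have := normr_ge0 (X w);
  have := normr_ge0 (Y w); nra.
Qed.

Lemma L2_cst c : L2 (fun=> c).
Proof. by split => //; exact: L1_cst. Qed.

Lemma L2_L1 X : L2 X -> L1 X.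
Proof.
move=> /(L2M (L2_cst 1)); apply: eq_integrable => // w _ /=.
by rewrite mul1r.
Qed.

Lemma L2D X Y : L2 X -> L2 Y -> L2 (fun w => X w + Y w).
Proof.
move=> X2 Y2; have [mX iX] := X2; have [mY iY] := Y2.
split; first exact: measurable_funD.
have := L1D (L1D iX (L1Z 2 (L2M X2 Y2))) iY.
by apply: eq_integrable => // w _ /=; congr EFin; ring.
Qed.

Lemma L2Z c X : L2 X -> L2 (fun w => c * X w).
Proof.
move=> [mX iX]; split; first exact: measurable_funM.
by have := L1Z (c ^+ 2) iX; apply: eq_integrable => // w _ /=; congr EFin; ring.
Qed.

Lemma L2N X : L2 X -> L2 (fun w => - X w).
Proof. by move=> /(L2Z (-1)); under eq_fun do rewrite mulN1r. Qed.

Lemma L2B X Y : L2 X -> L2 Y -> L2 (fun w => X w - Y w).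
Proof. by move=> X2 /L2N; exact: L2D. Qed.

Lemma L2_sum (I : Type) (s : seq I) (X : I -> W -> R) :
  (forall i, L2 (X i)) -> L2 (fun w => \sum_(i <- s) X i w).
Proof.
move=> X2; elim: s => [|i s ih].
  by under eq_fun do rewrite big_nil; exact: L2_cst.
by under eq_fun do rewrite big_cons; exact: L2D.
Qed.

Lemma L2_dom Y X : measurable_fun setT X -> L2 Y ->
  (forall w, `|X w| <= `|Y w|) -> L2 X.
Proof.
move=> mX [_ iY] XY; split => //.
apply: (@L1_dom _ _ _ iY) => [|w]; first exact: measurable_funX.
by rewrite normrX -[Y w ^+ 2]real_normK ?num_real// ler_sqr ?nnegrE.
Qed.

Lemma mean_sqrB X Y : L2 X -> L2 Y ->
  mean (fun w => (X w - Y w) ^+ 2) =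
  mean (fun w => X w ^+ 2) - 2 * mean (fun w => X w * Y w)
  + mean (fun w => Y w ^+ 2).
Proof.
move=> X2 Y2; have [mX iX] := X2; have [mY iY] := Y2.
rewrite -meanZ; last exact: L2M.
rewrite -meanB//; last exact/L1Z/L2M.
rewrite -meanD//; last exact/L1B/L1Z/L2M.
by congr mean; apply/funext => w; ring.
Qed.

Lemma mean_sqrD_le X Y : L2 X -> L2 Y ->
  mean (fun w => (X w + Y w) ^+ 2) <=
  2 * (mean (fun w => X w ^+ 2) + mean (fun w => Y w ^+ 2)).
Proof.
move=> X2 Y2; have [mX iX] := X2; have [mY iY] := Y2.
rewrite -meanD// -meanZ; last exact: L1D.
apply: mean_le => [||w]; [exact: (L2D X2 Y2).2|exact/L1Z/L1D|].
by have := sqr_ge0 (X w - Y w); nra.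
Qed.

(** Cauchy-Schwarz: the quadratic polynomial [E (t * X - Y) ^ 2] in [t] is nonnegative, and
    [t = b / a] minimises it. If [a = 0] it is affine, which forces [b = 0]. *)
Lemma meanM_sqr_le X Y : L2 X -> L2 Y ->
  mean (fun w => X w * Y w) ^+ 2 <=
  mean (fun w => X w ^+ 2) * mean (fun w => Y w ^+ 2).
Proof.
move=> X2 Y2; set a := mean (fun w => X w ^+ 2).
set b := mean (fun w => X w * Y w); set c := mean (fun w => Y w ^+ 2).
have a0 : 0 <= a by apply: mean_ge0 => w; exact: sqr_ge0.
have H (t : R) : 0 <= t ^+ 2 * a - 2 * t * b + c.
  have : 0 <= mean (fun w => (t * X w - Y w) ^+ 2).
    by apply: mean_ge0 => w; exact: sqr_ge0.
  rewrite mean_sqrB//; last exact: L2Z.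
  under [X in mean X - _]eq_fun do rewrite exprMn.
  rewrite meanZ; last exact: X2.2.
  under [X in _ - _ * mean X]eq_fun do rewrite -mulrA.
  by rewrite meanZ ?mulrA//; exact: L2M.
have [a_eq0|a_neq0] := eqVneq a 0.
  have c0 : 0 <= c by apply: mean_ge0 => w; exact: sqr_ge0.
  rewrite a_eq0 mul0r; have [->|b0] := eqVneq b 0; first by rewrite expr0n.
  (* With [a = 0] and [b != 0] the polynomial is [c - 2 * t * b]; this [t] gives it the value -1. *)
  have := H ((c + 1) / (2 * b)).
  rewrite a_eq0 mulr0 add0r; have -> : 2 * ((c + 1) / (2 * b)) * b = c + 1.
    by field.
  by lra.
have a_gt0 : 0 < a by rewrite lt_neqAle eq_sym a_neq0.
have := H (b / a); have -> : (b / a) ^+ 2 * a - 2 * (b / a) * b + c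
  = (a * c - b ^+ 2) / a by field.
by rewrite pmulr_lge0 ?invr_gt0// subr_ge0.
Qed.

Lemma cvg_meanM Z (D : nat -> W -> R) : L2 Z -> (forall n, L2 (D n)) ->
  mean (fun w => D n w ^+ 2) @[n --> \oo] --> (0 : R) ->
  mean (fun w => Z w * D n w) @[n --> \oo] --> (0 : R).
Proof.
move=> Z2 D2 D0; apply/norm_cvg0P.
have -> : (fun n => `|mean (fun w => Z w * D n w)|) =
    (fun n => Num.sqrt (mean (fun w => Z w * D n w) ^+ 2)).
  by apply/funext => n; rewrite sqrtr_sqr.
have H : Num.sqrt (mean (fun w => Z w ^+ 2) * mean (fun w => D n w ^+ 2))
    @[n --> \oo] --> (0 : R).
  rewrite -[X in _ --> X]sqrtr0; apply: continuous_cvg.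
    exact: sqrt_continuous.
  rewrite -[X in _ --> X](mulr0 (mean (fun w => Z w ^+ 2))).
  by apply: cvgM => //; exact: cvg_cst.
apply: (squeeze_cvgr _ (cvg_cst 0) H); apply: nearW => n.
by rewrite sqrtr_ge0/= ler_wsqrtr// meanM_sqr_le.
Qed.

End Moments.

(** * Limits of means: domination, Fatou, and weak convergence of L^2-bounded sequences *)

Section Convergence.
Context {R : realType} {d : measure_display} {W : measurableType d}.
Variable P : probability W R.
Implicit Types (X Y Z : W -> R).

Lemma mean_dominated_cvg (X : nat -> W -> R) Y G :
  (forall n, measurable_fun setT (X n)) -> measurable_fun setT Y ->
  L1 P G -> (forall n w, `|X n w| <= G w) ->
  {ae P, forall w, X n w @[n --> \oo] --> Y w} ->
  mean P (X n) @[n --> \oo] --> mean P Y.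
Proof.
move=> mX mY iG XG XY.
have XYE : {ae P, forall w, setT w -> (X n w)%:E @[n --> \oo] --> (Y w)%:E}.
  apply: filterS XY => w h _; apply: cvg_EFin => //; exact: nearW.
have mXE n : measurable_fun setT (EFin \o X n) by exact/measurable_EFinP.
have XGE : {ae P, forall w n, setT w -> (`|(X n w)%:E| <= (G w)%:E)%E}.
  by apply: aeW => w n _; rewrite lee_fin.
have [iY _ H] := dominated_convergence measurableT mXE
  ((measurable_EFinP _ _).2 mY) XYE iG XGE.
apply: fine_cvg; rewrite fineK ?integrable_fin_num//.
Qed.

(** Fatou's lemma for the squares. This is the device by which almost sure limits, about which no
    integrability is known, are shown to lie in L^2. *)
Lemma fatou_sqr (X : nat -> W -> R) Y (K : R) :
  (forall n, L2 P (X n)) -> measurable_fun setT Y ->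
  (forall n, mean P (fun w => X n w ^+ 2) <= K) ->
  {ae P, forall w, X n w @[n --> \oo] --> Y w} ->
  L2 P Y /\ mean P (fun w => Y w ^+ 2) <= K.
Proof.
move=> X2 mY XK XY.
pose f n w := ((X n w) ^+ 2)%:E.
have mf n : measurable_fun setT (f n).
  by apply/measurable_EFinP; apply: measurable_funX; case: (X2 n).
have f0 n w : setT w -> (0 <= f n w)%E by rewrite lee_fin sqr_ge0.
have mY2 : measurable_fun setT (fun w => ((Y w) ^+ 2)%:E).
  by apply/measurable_EFinP; exact: measurable_funX.
have H : (\int[P]_w ((Y w) ^+ 2)%:E <= K%:E)%E.
  rewrite (_ : (\int[P]_w ((Y w) ^+ 2)%:E)%E =
    (\int[P]_w limn_einf (f ^~ w))%E); last first.
    apply: ae_eq_integral => //.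
      apply: measurableT_comp => //.
      apply: measurable_fun_limn_esup => n.
      exact: measurableT_comp.
    apply: filterS XY => w h _.
    have /cvg_limn_einf_sup[-> _] // : f n w @[n --> \oo] --> ((Y w) ^+ 2)%:E.
    apply: cvg_EFin; first exact: nearW.
    by apply: (cvgM h h).
  apply: le_trans (fatou _ measurableT mf f0) _.
  rewrite limn_einf_lim; apply: lime_le; first exact: is_cvg_einfs.
  apply: nearW => n; apply: (@le_trans _ _ (\int[P]_w f n w)%E).
    by apply: ereal_inf_lbound; exists n => /=.
  by rewrite L1_EFin ?lee_fin//; exact: (X2 n).2.
have iY : L1 P (fun w => Y w ^+ 2).
  apply/integrableP; split => //; apply: le_lt_trans (ltry K).
  apply: le_trans H; rewrite le_eqVlt; apply/orP; left; apply/eqP.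
  by apply: eq_integral => w _; rewrite /= ger0_norm ?sqr_ge0.
by split => //; move: H; rewrite L1_EFin// lee_fin.
Qed.

(* With [D n = X n - Y] and [L > 0], [|Z * D n|] is at most
   [min(|Z * D n|, L * Z ^ 2) + D n ^ 2 / L]: the first term tends to 0 in mean
   by domination, the second is at most [4 * K / L]. *)
Lemma cvg_meanM_ae (X : nat -> W -> R) Y Z (K : R) :
  (forall n, L2 P (X n)) -> measurable_fun setT Y -> L2 P Z ->
  (forall n, mean P (fun w => X n w ^+ 2) <= K) ->
  {ae P, forall w, X n w @[n --> \oo] --> Y w} ->
  mean P (fun w => Z w * X n w) @[n --> \oo] --> mean P (fun w => Z w * Y w).
Proof.
move=> X2 mY Z2 XK XY.
have [Y2 YK] := fatou_sqr X2 mY XK XY.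
have mZ : measurable_fun setT Z by case: Z2.
pose D n w := X n w - Y w.
have D2 n : L2 P (D n) by exact: L2B.
have DK n : mean P (fun w => D n w ^+ 2) <= 4 * K.
  have := mean_sqrD_le (X2 n) (L2N Y2).
  under [X in _ <= 2 * (_ + mean P X)]eq_fun do rewrite sqrrN.
  by have := XK n; move: YK; rewrite /D; lra.
have K0 : 0 <= 4 * K.
  by apply: le_trans (DK 0); apply: mean_ge0 => w; exact: sqr_ge0.
suff H : mean P (fun w => Z w * D n w) @[n --> \oo] --> (0 : R).
  have -> : (fun n => mean P (fun w => Z w * X n w)) =
    (fun n => mean P (fun w => Z w * D n w) + mean P (fun w => Z w * Y w)).
    apply/funext => n; rewrite -meanD; [|exact: L2M|exact: L2M].
    by congr mean; apply/funext => w; rewrite /D; ring.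
  by rewrite -[X in _ --> X]add0r; apply: cvgD => //; exact: cvg_cst.
apply/cvgrPdist_lt => e e0.
(* Chosen so that [L * (e / 2) = 4 * K + 1 > 4 * K]; the summand 1 also keeps [L] positive when
   [K = 0]. *)
pose L := 2 * (4 * K + 1) / e.
have L0 : 0 < L by rewrite divr_gt0// mulr_gt0// ltr_wpDl.
pose G n w := Num.min `|Z w * D n w| (L * Z w ^+ 2).
have mZD n : measurable_fun setT (fun w => Z w * D n w).
  by apply: measurable_funM => //; case: (D2 n).
have mG n : measurable_fun setT (G n).
  apply: measurable_minr; first exact: measurableT_comp.
  by apply: measurable_funM => //; exact: measurable_funX.
have G0 : mean P (G n) @[n --> \oo] --> (0 : R).
  rewrite -[X in _ --> X](mean_cst P 0).
  apply: (@mean_dominated_cvg G _ (fun w => L * Z w ^+ 2)) => //.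
  - by apply: L1Z; case: Z2.
  - move=> n w; rewrite /G ger0_norm ?ge_min ?lexx ?orbT// le_min normr_ge0/=.
    by rewrite mulr_ge0 ?sqr_ge0 ?ltW.
  - apply: filterS XY => w h.
    have hD : `|Z w * D n w| @[n --> \oo] --> (0 : R).
      apply/norm_cvg0P; rewrite -[X in _ --> X](mulr0 (Z w)).
      apply: cvgM; first exact: cvg_cst.
      by rewrite -[X in _ --> X](subrr (Y w)); apply: cvgB => //; exact: cvg_cst.
    apply: (squeeze_cvgr _ (cvg_cst 0) hD); apply: nearW => n.
    rewrite /G ge_min lexx andbT le_min normr_ge0/=.
    by rewrite mulr_ge0 ?sqr_ge0 ?ltW.
have iG n : L1 P (G n).
  apply: (@L1_dom _ _ _ P (fun w => L * Z w ^+ 2)) => //.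
    by apply: L1Z; case: Z2.
  move=> w; rewrite /G ger0_norm ?ge_min ?lexx ?orbT// le_min normr_ge0/=.
  by rewrite mulr_ge0 ?sqr_ge0 ?ltW.
have /cvgrPdist_lt/(_ (e / 2)) := G0.
rewrite divr_gt0// => /(_ isT); apply: filterS => n.
rewrite !sub0r !normrN => Gn.
have -> : e = e / 2 + e / 2 by field.
apply: le_lt_trans (mean_norm_le (L2M Z2 (D2 n))) _.
apply: (@le_lt_trans _ _ (mean P (fun w => G n w + L^-1 * D n w ^+ 2))).
  apply: mean_le => [||w].
  - exact/L1_norm/L2M.
  - by apply: L1D => //; apply: L1Z; exact: (D2 n).2.
  (* If [|D| <= L * |Z|], then [|Z * D| <= L * Z ^ 2] and the minimum is [|Z * D|] itself; otherwise
     [|Z| < |D| / L], so the second term alone suffices. *)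
  have [h|h] := leP `|D n w| (L * `|Z w|).
    have -> : G n w = `|Z w * D n w|.
      rewrite /G; apply/min_idPl; rewrite normrM.
      rewrite -[Z w ^+ 2]real_normK ?num_real//.
      by have := normr_ge0 (Z w); nra.
    by rewrite lerDl mulr_ge0 ?sqr_ge0 ?invr_ge0 ?ltW.
  have G0' : 0 <= G n w.
    by rewrite /G le_min normr_ge0/= mulr_ge0 ?sqr_ge0 ?ltW.
  apply: (@le_trans _ _ (L^-1 * D n w ^+ 2)); last by rewrite lerDr.
  rewrite ler_pdivlMl// normrM -[D n w ^+ 2]real_normK ?num_real//.
  by rewrite mulrA expr2 ler_wpM2r// ltW.
rewrite meanD ?meanZ//; [|exact: (D2 n).2|by apply: L1Z; exact: (D2 n).2].
apply: ltrD; first exact: le_lt_trans (ler_norm _) Gn.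
rewrite ltr_pdivrMl//.
apply: le_lt_trans (DK n) _.
have -> : L * (e / 2) = 4 * K + 1 by rewrite /L; field; rewrite gt_eqF.
by rewrite ltrDl.
Qed.

(** Convergence to 0 in the extended reals makes the integral finite for some [n], so that
    [Y = X n - (X n - Y)] is a difference of two L^2 variables. This translates the limits in the
    definition of the Ito integral into limits of real means. *)
Lemma L2_cvg_sqr (X : nat -> W -> R) Y :
  (forall n, L2 P (X n)) -> measurable_fun setT Y ->
  (fun n => \int[P]_w ((X n w - Y w) ^+ 2)%:E)%E @ \oo --> 0%E ->
  L2 P Y /\ mean P (fun w => (X n w - Y w) ^+ 2) @[n --> \oo] --> (0 : R).
Proof.
move=> X2 mY XY; have XY1 : \forall n \near \oo,
    (\int[P]_w ((X n w - Y w) ^+ 2)%:E)%E \is a fin_num.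
  by have /fine_cvgP[] := XY.
have Y2 : L2 P Y.
  have [n _ /(_ n (leqnn _)) Hn] := XY1.
  have mXY : measurable_fun setT (fun w => X n w - Y w).
    by apply: measurable_funB => //; case: (X2 n).
  have D2 : L2 P (fun w => X n w - Y w).
    split => //; apply/integrableP; split.
      by apply/measurable_EFinP; exact: measurable_funX.
    move: Hn; rewrite fin_numElt => /andP[_]; apply: le_lt_trans.
    rewrite le_eqVlt; apply/orP; left; apply/eqP.
    by apply: eq_integral => w _; rewrite /= ger0_norm ?sqr_ge0.
  have := L2B (X2 n) D2.
  by under eq_fun do rewrite subKr.
split => //; apply: fine_cvg.
exact: XY.
Qed.

End Convergence.

(** * Exponential and polynomial moments of the centred normal law *)

Section NormalMoments.
Context {R : realType}.
Variable s : R.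
Hypothesis s0 : s != 0.
Local Notation mu := (@lebesgue_measure R).
Local Notation N := (@normal_prob R 0 s).
Local Notation RR := (measurableTypeR R).

(** Change of measure holds with the Radon-Nikodym derivative, which agrees almost everywhere with
    the density because both have the same integral over every measurable set. *)
Lemma ge0_integral_normal_prob (f : R -> \bar R) :
  measurable_fun setT f -> (forall x, 0 <= f x)%E ->
  (\int[N]_x f x = \int[mu]_x (f x * (normal_pdf 0 s x)%:E))%E.
Proof.
move=> mf f0.
have dom : N `<< mu by exact: normal_prob_dominates.
rewrite -(Radon_Nikodym_SigmaFinite.change_of_variables dom)//.
have mRN : measurable_fun setT (Radon_Nikodym_SigmaFinite.f N mu).
  exact: measurable_int (Radon_Nikodym_SigmaFinite.f_integrable dom).
have mpdf : measurable_fun setT (fun x : R => (normal_pdf 0 s x)%:E).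
  by apply/measurable_EFinP; exact: measurable_normal_pdf.
apply: ae_eq_integral => //; [exact: emeasurable_funM|exact: emeasurable_funM|].
apply: ae_eqe_mul2l; apply: integral_ae_eq => //.
  exact: Radon_Nikodym_SigmaFinite.f_integrable.
by move=> E _ mE; rewrite -Radon_Nikodym_SigmaFinite.f_integral.
Qed.

Lemma measurable_expRM (c : R) : measurable_fun setT (fun x => expR (c * x)).
Proof.
by apply: measurableT_comp.
Qed.

(** Completing the square: [exp (c * x)] times the density with mean 0 is [exp (c ^ 2 * s ^ 2 / 2)]
    times the density with mean [c * s ^ 2]. *)
Lemma normal_mgf (c : R) :
  (\int[N]_x (expR (c * x))%:E = (expR (c ^+ 2 * s ^+ 2 / 2))%:E)%E.
Proof.
rewrite ge0_integral_normal_prob; last first.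
- by move=> x; rewrite lee_fin expR_ge0.
- by apply/measurable_EFinP; exact: measurable_expRM.
rewrite -[RHS]mule1 -(integral_normal_pdf (c * s ^+ 2) s).
rewrite -(integralZl measurableT (integrable_normal_pdf (c * s ^+ 2) s)).
apply: eq_integral => x _; rewrite !normal_pdfE// -!EFinM; congr EFin.
rewrite mulrCA [RHS]mulrCA; congr (_ * _).
rewrite /normal_fun -!expRD; congr expR.
by field.
Qed.

Lemma L1_normal_expR (c : R) : L1 N (fun x => expR (c * x)).
Proof.
apply/integrableP; split.
  by apply/measurable_EFinP; exact: measurable_expRM.
under eq_integral do rewrite /= ger0_norm ?expR_ge0//.
by rewrite normal_mgf ltry.
Qed.

Lemma mean_normal_expR (c : R) :
  mean N (fun x => expR (c * x)) = expR (c ^+ 2 * s ^+ 2 / 2).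
Proof. by rewrite /mean /Rintegral normal_mgf. Qed.

Lemma expR_norm_le (a x : R) : expR (a * `|x|) <= expR (a * x) + expR (- a * x).
Proof.
have [x0|x0] := leP 0 x; first by rewrite ger0_norm// lerDl expR_ge0.
by rewrite ltr0_norm// mulrN mulNr lerDr expR_ge0.
Qed.

Lemma L1_normal_bound (g : RR -> R) (a : R) : measurable_fun setT g ->
  (forall x, `|g x| <= expR (a * `|x|)) -> L1 N g.
Proof.
move=> mg ga.
have L : L1 N (fun x : RR => expR (a * x) + expR (- a * x)).
  by apply: L1D; exact: L1_normal_expR.
by apply: (L1_dom mg L) => x; exact: le_trans (ga x) (expR_norm_le _ _).
Qed.

(** Differentiation under the integral sign brings down a factor [x]. Starting from the moment
    generating function, [g = 1] gives the first moment and [g = id] the second. *)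
Lemma mean_normal_derive (g : RR -> R) (a c l : R) :
  measurable_fun setT g -> (forall x, `|g x| <= expR (a * `|x|)) ->
  is_derive c 1 (fun t => mean N (fun x => g x * expR (t * x))) l ->
  mean N (fun x => g x * x * expR (c * x)) = l.
Proof.
move=> mg ga dl.
pose b := `|c| + 1.
have b0 : 0 <= b by rewrite addr_ge0.
have Ib (t x : R) : t \in `]c - 1, c + 1[ -> expR (t * x) <= expR (b * `|x|).
  rewrite in_itv/= => /andP[t1 t2]; rewrite ler_expR.
  rewrite (le_trans (ler_norm _))// normrM ler_wpM2r//.
  rewrite /b -lerBlDr; have := ler_normB c (c - t); rewrite subKr.
  have /ltW : `|c - t| < 1 by rewrite ltr_norml; lra.
  by lra.
pose f (t : R) (x : RR) := g x * expR (t * x).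
have df (t x : R) : is_derive t 1 (f ^~ x) (g x * x * expR (t * x)).
  rewrite /f; apply: is_derive_eq.
  by rewrite /= /GRing.scale/=; ring.
have mf t : measurable_fun setT (f t).
  by apply: measurable_funM => //; exact: measurable_expRM.
have derf t x : partial1of2 f t x = g x * x * expR (t * x).
  by rewrite partial1of2E (@derive_val _ _ _ _ _ _ _ (df t x)).
have ge (x : R) : `|g x * x| <= expR ((a + 1) * `|x|).
  rewrite normrM mulrDl mul1r expRD ler_pM//.
  by apply: le_trans (expR_ge1Dx _); rewrite lerDr.
(* The exponent collects [a] from [g], 1 from [|x| <= exp |x|], and [b = |c| + 1], which bounds
   [|t|] on the interval of radius 1 around [c]. *)
pose G (x : RR) := expR ((a + b + 1) * `|x|).
have H : derive1 (fun t => mean N (f t)) c = mean N (fun x => partial1of2 f c x).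
  apply: (@differentiation_under_integral _ _ _ _ f setT measurableT c
    (c - 1) (c + 1) _ _ _ G).
  - by rewrite /= in_itv/= ltrBlDr ltrDl ltr01.
  - move=> t tI; apply: (@L1_normal_bound _ (a + b)) => // x.
    rewrite normrM [`|expR _|]ger0_norm ?expR_ge0// mulrDl expRD ler_pM ?expR_ge0//.
    exact: Ib.
  - by move=> t x _ _; case: (df t x).
  - by move=> x; exact: expR_ge0.
  - apply: (@L1_normal_bound _ (a + b + 1)) => [|x].
      exact: (measurableT_comp (measurable_expRM _)).
    by rewrite ger0_norm ?expR_ge0.
  - move=> t x tI _; rewrite derf normrM [`|expR _|]ger0_norm ?expR_ge0//.
    rewrite /G addrAC mulrDl expRD ler_pM ?expR_ge0//.
    exact: Ib.
under eq_fun do rewrite -derf.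
by rewrite -H derive1E (@derive_val _ _ _ _ _ _ _ dl).
Qed.

Lemma mean_normal_id_expR (c : R) :
  mean N (fun x => x * expR (c * x)) = c * s ^+ 2 * expR (c ^+ 2 * s ^+ 2 / 2).
Proof.
have -> : (fun x : R => x * expR (c * x)) = (fun x => 1 * x * expR (c * x)).
  by apply/funext => x; rewrite mul1r.
apply: (@mean_normal_derive (fun=> 1) 0) => // [x|].
  by rewrite normr1 mul0r expR0.
have -> : (fun t => mean N (fun x => 1 * expR (t * x))) =
    (fun t => expR (t ^+ 2 * s ^+ 2 / 2)).
  apply/funext => t; under [X in mean _ X]eq_fun do rewrite mul1r.
  exact: mean_normal_expR.
by apply: is_derive_eq; rewrite /GRing.scale/=; field.
Qed.

Lemma expR_norm_ge (x : R) : `|x| <= expR (1 * `|x|).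
Proof. by rewrite mul1r (le_trans _ (expR_ge1Dx _))// lerDr. Qed.

Lemma L1_normal_id_expR (c : R) : L1 N (fun x => x * expR (c * x)).
Proof.
apply: (@L1_normal_bound _ (1 + `|c|)) => [|x].
  by apply: measurable_funM => //; exact: measurable_expRM.
rewrite normrM [`|expR _|]ger0_norm ?expR_ge0// mulrDl expRD ler_pM ?expR_ge0//.
  exact: expR_norm_ge.
by rewrite ler_expR -normrM ler_norm.
Qed.

Lemma L1_normal_id : L1 N (fun x => x).
Proof. by apply: (L1_normal_bound _ expR_norm_ge). Qed.

Lemma mean_normal_id : mean N (fun x => x) = 0.
Proof.
have := mean_normal_id_expR 0; rewrite !mul0r; apply: etrans.
by apply: eq_mean => x; rewrite mul0r expR0 mulr1.
Qed.

Lemma L1_normal_sqr : L1 N (fun x => x ^+ 2).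
Proof.
have m2 : measurable_fun setT (fun x : RR => x ^+ 2) by exact: measurable_funX.
apply: (@L1_normal_bound _ 2 m2) => x.
rewrite normrX mulr_natl mulr2n expRD expr2 ler_pM//;
  by have := expR_norm_ge x; rewrite mul1r.
Qed.

Lemma mean_normal_sqr : mean N (fun x => x ^+ 2) = s ^+ 2.
Proof.
have -> : (fun x : R => x ^+ 2) = (fun x => x * x * expR (0 * x)).
  by apply/funext => x; rewrite mul0r expR0 mulr1.
apply: (@mean_normal_derive idfun 1) => [|x|].
- exact: measurable_id.
- exact: expR_norm_ge.
have -> : (fun t => mean N (fun x => idfun x * expR (t * x))) =
    (fun t => t * s ^+ 2 * expR (t ^+ 2 * s ^+ 2 / 2)).
  by apply/funext => t; rewrite /= mean_normal_id_expR.
by apply: is_derive_eq; rewrite /GRing.scale/= expr0n/= !mul0r expR0; field.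
Qed.

End NormalMoments.

(** * Measurability with respect to a sub-sigma-algebra *)

Section MeasurableWrt.
Context {R : realType} {d : measure_display} {Omega : measurableType d}.
Implicit Types (G : set (set Omega)) (xi eta : Omega -> R).

(** Reading [G] as the measurable structure of a type makes the usual closure properties of
    measurable functions available for [measurable_wrt]. *)
Lemma measurable_wrtP G xi : sigma_algebra setT G ->
  measurable_wrt G xi <-> measurable_fun [set: g_sigma_algebraType G] xi.
Proof.
move=> sG; rewrite /measurable_wrt /measurable_fun.
have GE : @measurable _ (g_sigma_algebraType G) = G.
  by rewrite /measurable/= sigma_algebra_id.
split => [H _ U mU|H U mU]; first by rewrite setTI GE; exact: H.
by have := H measurableT U mU; rewrite setTI GE.
Qed.

Lemma measurable_wrtS G G' xi : G `<=` G' ->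
  measurable_wrt G xi -> measurable_wrt G' xi.
Proof. by move=> GG' H U mU; apply: GG'; exact: H. Qed.

Lemma measurable_wrt_measurable G xi : G `<=` measurable ->
  measurable_wrt G xi -> measurable_fun setT xi.
Proof. by move=> GG' H _ U mU; rewrite setTI; apply: GG'; exact: H. Qed.

Context {G : set (set Omega)} (sG : sigma_algebra setT G).

Lemma measurable_wrt_cst (c : R) : measurable_wrt G (fun=> c).
Proof. by apply/(measurable_wrtP _ sG); exact: measurable_cst. Qed.

Lemma measurable_wrtD xi eta : measurable_wrt G xi -> measurable_wrt G eta ->
  measurable_wrt G (fun w => xi w + eta w).
Proof.
move=> /(measurable_wrtP _ sG) mxi /(measurable_wrtP _ sG) meta.
by apply/(measurable_wrtP _ sG); exact: measurable_funD.
Qed.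

Lemma measurable_wrtM xi eta : measurable_wrt G xi -> measurable_wrt G eta ->
  measurable_wrt G (fun w => xi w * eta w).
Proof.
move=> /(measurable_wrtP _ sG) mxi /(measurable_wrtP _ sG) meta.
by apply/(measurable_wrtP _ sG); exact: measurable_funM.
Qed.

Lemma measurable_wrtB xi eta : measurable_wrt G xi -> measurable_wrt G eta ->
  measurable_wrt G (fun w => xi w - eta w).
Proof.
move=> /(measurable_wrtP _ sG) mxi /(measurable_wrtP _ sG) meta.
by apply/(measurable_wrtP _ sG); exact: measurable_funB.
Qed.

Lemma measurable_wrt_comp (f : R -> R) xi : measurable_fun setT f ->
  measurable_wrt G xi -> measurable_wrt G (fun w => f (xi w)).
Proof.
move=> mf mxi U mU; have := mxi _ (mf measurableT _ mU).
by rewrite setTI.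
Qed.

Lemma measurable_wrt_sum (I : Type) (s : seq I) (xi : I -> Omega -> R) :
  (forall i, measurable_wrt G (xi i)) ->
  measurable_wrt G (fun w => \sum_(i <- s) xi i w).
Proof.
move=> mxi; elim: s => [|i s ih].
  by under eq_fun do rewrite big_nil; exact: measurable_wrt_cst.
by under eq_fun do rewrite big_cons; exact: measurable_wrtD.
Qed.

End MeasurableWrt.

(** * Independence of Brownian increments from the past *)

Section Increments.
Context {R : realType} {d : measure_display} {Omega : measurableType d}.
Variables (P : probability Omega R) (T : R).
Variables (F : R -> set (set Omega)) (B : R -> Omega -> R).
Hypothesis hF : complete_filtration P T F.
Hypothesis hB : brownian_motion P T F B.

Lemma filtration_sigma (t : R) : 0 <= t -> t <= T -> sigma_algebra setT (F t).
Proof. by case: hF => h _ _ _ t0 tT; apply: h; rewrite in_itv/= t0. Qed.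

Lemma filtration_measurable (t : R) (xi : Omega -> R) : 0 <= t -> t <= T ->
  measurable_wrt (F t) xi -> measurable_fun setT xi.
Proof.
case: hF => _ h _ _ t0 tT; apply: measurable_wrt_measurable.
by apply: h; rewrite in_itv/= t0.
Qed.

Lemma filtration_le (s t : R) (xi : Omega -> R) : 0 <= s -> s <= t -> t <= T ->
  measurable_wrt (F s) xi -> measurable_wrt (F t) xi.
Proof. by case: hF => _ _ h _ s0 st tT; apply: measurable_wrtS; exact: h. Qed.

Lemma measurable_wrt_increment (s t u : R) : 0 <= s -> s <= t -> t <= u -> u <= T ->
  measurable_wrt (F u) (increment B s t).
Proof.
move=> s0 st tu uT; have [_ _ ad _ _] := hB.
apply: measurable_wrtB; first exact/filtration_sigma/uT/le_trans/tu/le_trans/st.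
- apply: (@filtration_le t) => //; first exact: le_trans st.
  by apply: ad; rewrite in_itv/= (le_trans s0 st) (le_trans tu).
- apply: (@filtration_le s) => //; first exact: le_trans tu.
  by apply: ad; rewrite in_itv/= s0 (le_trans st)// (le_trans tu).
Qed.

(* Independence makes the joint law of [xi] and the increment a product measure,
   so that the expectation factors by Fubini. *)
Lemma mean_mul_increment (s t : R) (xi : Omega -> R) (g : measurableTypeR R -> R) :
  0 <= s -> s < t -> t <= T ->
  measurable_wrt (F s) xi -> L1 P xi ->
  L1 (normal_prob 0 (Num.sqrt (t - s))) g ->
  L1 P (fun w => xi w * g (increment B s t w)) /\
  mean P (fun w => xi w * g (increment B s t w)) =
    mean P xi * mean (normal_prob 0 (Num.sqrt (t - s))) g.
Proof.
move=> s0 st tT mxi ixi ig; have [_ _ _ hind hlaw] := hB.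
set N := normal_prob 0 (Num.sqrt (t - s)) in ig *.
pose D : Omega -> measurableTypeR R := increment B s t.
have mD : measurable_fun setT D.
  by apply: (@filtration_measurable t) => //; [lra|apply: measurable_wrt_increment => //; lra].
have mx : measurable_fun setT xi by exact: L1_measurable ixi.
have mxD : measurable_fun setT (fun w => (xi w, D w)) by exact: measurable_fun_pair.
pose X : {mfun Omega >-> R} := mfun_Sub (mem_set mx).
pose Y : {mfun Omega >-> (R * measurableTypeR R)%type} := mfun_Sub (mem_set mxD).
have law A : measurable A -> (distribution P X \x N)%E A = distribution P Y A.
  move=> mA; apply: product_measure_unique => // A1 A2 mA1 mA2.
  rewrite /distribution /pushforward /=.
  rewrite -hlaw// -hind//; last exact: mxi.
pose f (z : R * measurableTypeR R) := (z.1 * g z.2)%:E.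
have mg : measurable_fun setT g := L1_measurable ig.
have mf : measurable_fun setT f.
  apply/measurable_EFinP; apply: measurable_funM => //.
  exact: measurableT_comp mg measurable_snd.
have mabs : measurable_fun setT (fun x : R => `|x|%:E).
  by apply/measurable_EFinP; exact: normr_measurable.
have intf : (distribution P X \x N)%E.-integrable setT f.
  apply/integrable12ltyP => //.
  under eq_integral.
    move=> x _; under eq_integral do rewrite /f/= normrM EFinM.
    rewrite ge0_integralZl//; last exact/measurable_EFinP/measurableT_comp.
    rewrite L1_EFin; last exact: L1_norm.
    over.
  rewrite ge0_integralZr//; last by rewrite lee_fin; apply: mean_ge0.
  rewrite ge0_integral_distribution//.
  by rewrite (L1_EFin (L1_norm ixi)) -EFinM ltry.
have iY : (distribution P Y).-integrable setT f.
  have /integrableP[_ h] := intf; apply/integrableP; split => //.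
  apply: le_lt_trans h; rewrite le_eqVlt; apply/orP; left; apply/eqP.
  by apply: eq_measure_integral => A mA _; exact/esym/law.
have iP : L1 P (fun w => xi w * g (increment B s t w)).
  have /integrableP[_ h] := iY; apply/integrableP; split.
    by apply/measurable_EFinP; apply: measurable_funM => //; exact: measurableT_comp mg mD.
  move: h; rewrite ge0_integral_distribution//.
  exact: measurableT_comp.
split => //; apply: EFin_inj; rewrite -L1_EFin//.
transitivity (\int[distribution P Y]_z f z)%E.
  by rewrite integral_distribution.
transitivity (\int[distribution P X \x N]_z f z)%E.
  by apply: eq_measure_integral => A mA _; exact/esym/law.
rewrite -integral12_prod_meas1// /fubini_F.
under eq_integral.
  move=> x _; under eq_integral do rewrite /f/= EFinM.
  rewrite integralZl// L1_EFin//.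
  over.
rewrite integralZr//.
  rewrite integral_distribution// EFinM; congr (_ * _)%E.
  exact: L1_EFin.
exact: integrable_pushforward.
Qed.

End Increments.

(** * Step integrals against Brownian motion and their isometry *)

Section StepIntegrals.
Context {R : realType} {d : measure_display} {Omega : measurableType d}.
Variables (P : probability Omega R) (T : R).
Variables (F : R -> set (set Omega)) (B : R -> Omega -> R).
Hypothesis hF : complete_filtration P T F.
Hypothesis hB : brownian_motion P T F B.
Local Notation mu := (@lebesgue_measure R).

Definition bounded_wrt (s : R) (xi : Omega -> R) :=
  measurable_wrt (F s) xi /\ exists K : R, forall w, `|xi w| <= K.

Lemma incrementD (a b c : R) w :
  increment B a c w = increment B a b w + increment B b c w.
Proof. by rewrite /increment; ring. Qed.

Lemma increment_id (a : R) w : increment B a a w = 0.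
Proof. by rewrite /increment subrr. Qed.

Lemma bounded_wrt_L2 (s : R) xi : 0 <= s -> s <= T -> bounded_wrt s xi -> L2 P xi.
Proof.
move=> s0 sT [mxi [K xiK]].
have mx : measurable_fun setT xi by exact: (filtration_measurable hF s0 sT).
apply: (L2_dom mx (L2_cst P K)) => w.
by rewrite (le_trans (xiK w))// ler_norm.
Qed.

Lemma bounded_wrtM (s : R) xi eta : 0 <= s -> s <= T ->
  bounded_wrt s xi -> bounded_wrt s eta -> bounded_wrt s (fun w => xi w * eta w).
Proof.
move=> s0 sT [mxi [K xiK]] [meta [K' etaK]]; split.
  by apply: measurable_wrtM => //; exact: filtration_sigma hF _ s0 sT.
by exists (K * K') => w; rewrite normrM ler_pM.
Qed.

Lemma bounded_wrt_le (s t : R) xi : 0 <= s -> s <= t -> t <= T ->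
  bounded_wrt s xi -> bounded_wrt t xi.
Proof.
by move=> s0 st tT [mxi bxi]; split => //; exact: (filtration_le hF s0 st tT).
Qed.

Lemma mean_mul_increment_id (s t : R) xi : 0 <= s -> s <= t -> t <= T ->
  measurable_wrt (F s) xi -> L1 P xi ->
  L1 P (fun w => xi w * increment B s t w) /\
  mean P (fun w => xi w * increment B s t w) = 0.
Proof.
(* The law of an increment is prescribed only for [s < t], where the standard deviation is nonzero;
   for [s = t] the increment is identically 0. *)
move=> s0; rewrite le_eqVlt => /predU1P[<- _ _ _|st tT mxi ixi].
  under eq_fun do rewrite increment_id mulr0.
  by split; [exact: L1_cst|exact: mean_cst].
have ts0 : Num.sqrt (t - s) != 0 by rewrite gt_eqF// sqrtr_gt0 subr_gt0.
have [iL ->] := mean_mul_increment hF hB s0 st tT mxi ixi (L1_normal_id ts0).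
by split => //; rewrite mean_normal_id// mulr0.
Qed.

Lemma mean_mul_increment_sqr (s t : R) xi : 0 <= s -> s <= t -> t <= T ->
  measurable_wrt (F s) xi -> L1 P xi ->
  L1 P (fun w => xi w * increment B s t w ^+ 2) /\
  mean P (fun w => xi w * increment B s t w ^+ 2) = mean P xi * (t - s).
Proof.
move=> s0; rewrite le_eqVlt => /predU1P[<- _ _ _|st tT mxi ixi].
  under eq_fun do rewrite increment_id expr0n/= mulr0.
  by rewrite subrr mulr0; split; [exact: L1_cst|exact: mean_cst].
have ts0 : Num.sqrt (t - s) != 0 by rewrite gt_eqF// sqrtr_gt0 subr_gt0.
have [iL ->] := mean_mul_increment hF hB s0 st tT mxi ixi (L1_normal_sqr ts0).
by split => //; rewrite mean_normal_sqr// sqr_sqrtr// subr_ge0 ltW.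
Qed.

Lemma increment_L2 (a b : R) xi : 0 <= a -> a <= b -> b <= T ->
  bounded_wrt a xi -> L2 P (fun w => xi w * increment B a b w).
Proof.
move=> a0 ab bT bxi; have aT := le_trans ab bT.
have b0 := le_trans a0 ab.
have [mxi _] := bxi.
split.
  apply: measurable_funM; first exact: (filtration_measurable hF a0 aT).
  apply: (filtration_measurable hF b0 bT).
  exact: (measurable_wrt_increment hF hB).
have bxi2 := bounded_wrtM a0 aT bxi bxi.
have [+ _] := mean_mul_increment_sqr a0 ab bT bxi2.1
  (L2_L1 (bounded_wrt_L2 a0 aT bxi2)).
by apply: eq_integrable => // w _ /=; congr EFin; ring.
Qed.

(** Everything except the last increment is known at time [c], and that increment is centred and
    independent of [F c]. *)
Lemma mean_disjoint_increments (a b c e : R) xi eta :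
  0 <= a -> a <= b -> b <= c -> c <= e -> e <= T ->
  bounded_wrt a xi -> bounded_wrt c eta ->
  mean P (fun w => xi w * increment B a b w * (eta w * increment B c e w)) = 0.
Proof.
move=> a0 ab bc ce eT bxi beta.
have bT : b <= T by lra.
have c0 : 0 <= c by lra.
have cT : c <= T by lra.
have m1 : measurable_wrt (F c) (fun w => xi w * increment B a b w).
  apply: measurable_wrtM; first exact: (filtration_sigma hF c0 cT).
    by apply: (filtration_le hF a0 _ cT bxi.1); lra.
  exact: (measurable_wrt_increment hF hB).
have := mean_mul_increment_id c0 ce eT
  (measurable_wrtM (filtration_sigma hF c0 cT) m1 beta.1)
  (L2M (increment_L2 a0 ab bT bxi) (bounded_wrt_L2 c0 cT beta)).
case=> _; apply: etrans; apply: eq_mean => w; ring.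
Qed.

(** Splitting the longer increment at [b] leaves the square of the shorter one and a product over
    disjoint intervals, whose mean is 0. *)
Lemma mean_nested_increments (a b e : R) xi eta :
  0 <= a -> a <= b -> b <= e -> e <= T -> bounded_wrt a xi -> bounded_wrt a eta ->
  mean P (fun w => xi w * increment B a b w * (eta w * increment B a e w)) =
  mean P (fun w => xi w * eta w) * (b - a).
Proof.
move=> a0 ab be eT bxi beta.
have bT : b <= T by lra.
have aT : a <= T by lra.
have b0 : 0 <= b by lra.
have beta' := bounded_wrt_le a0 ab bT beta.
have X2 := increment_L2 a0 ab bT bxi.
have bM := bounded_wrtM a0 aT bxi beta.
have [_ <-] := mean_mul_increment_sqr a0 ab bT bM.1
  (L2_L1 (bounded_wrt_L2 a0 aT bM)).
rewrite -[RHS]addr0 -(mean_disjoint_increments a0 ab (lexx b) be eT bxi beta').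
rewrite -meanD.
- by apply: eq_mean => w; rewrite (incrementD a b e); ring.
- have := L2M X2 (increment_L2 a0 ab bT beta).
  by apply: eq_integrable => // w _ /=; congr EFin; ring.
- exact: (L2M X2 (increment_L2 b0 be eT beta')).
Qed.

(** For [a <= b] and [c <= e], the length of the intersection of []a, b]] and []c, e]]. *)
Definition overlap (a b c e : R) : R :=
  Num.max 0 (Num.min b e - Num.max a c).

Lemma overlapC (a b c e : R) : overlap a b c e = overlap c e a b.
Proof. by rewrite /overlap (minC b) (maxC a). Qed.

(** By symmetry [a <= c]. If [b <= c], the intervals are disjoint. Otherwise the part of []a, b]]
    before [c] is orthogonal to the other increment, and what remains is a pair with common left end
    [c], one nested in the other. *)
Lemma mean_increments (a b c e : R) xi eta :
  0 <= a -> a <= b -> b <= T -> 0 <= c -> c <= e -> e <= T ->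
  bounded_wrt a xi -> bounded_wrt c eta ->
  mean P (fun w => xi w * increment B a b w * (eta w * increment B c e w)) =
  mean P (fun w => xi w * eta w) * overlap a b c e.
Proof.
wlog ac : a b c e xi eta / a <= c.
  move=> H a0 ab bT c0 ce eT bxi beta.
  have [ac|/ltW ca] := leP a c; first exact: H.
  rewrite overlapC.
  under [X in mean _ X * _]eq_fun do rewrite mulrC.
  under [X in mean _ X = _]eq_fun do rewrite mulrC.
  by apply: H.
move=> a0 ab bT c0 ce eT bxi beta.
have cT : c <= T by lra.
have [bc|cb] := leP b c.
  rewrite mean_disjoint_increments// /overlap.
  have -> : Num.max 0 (Num.min b e - Num.max a c) = 0.
    by apply/max_idPl; rewrite subr_le0 ge_min le_max bc orbT.
  by rewrite mulr0.
have bxi' := bounded_wrt_le a0 ac cT bxi.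
have cb' := ltW cb.
have -> : overlap a b c e = Num.min b e - c.
  rewrite /overlap (max_idPr ac); apply/max_idPr.
  by rewrite subr_ge0 le_min cb' ce.
transitivity (mean P (fun w => xi w * increment B c b w * (eta w * increment B c e w))).
  rewrite -[RHS]add0r -(mean_disjoint_increments a0 ac (lexx c) ce eT bxi beta).
  rewrite -meanD.
  - by apply: eq_mean => w; rewrite (incrementD a c b); ring.
  - exact: (L2M (increment_L2 a0 ac cT bxi) (increment_L2 c0 ce eT beta)).
  - exact: (L2M (increment_L2 c0 cb' bT bxi') (increment_L2 c0 ce eT beta)).
have [be|/ltW eb] := leP b e.
  exact: mean_nested_increments.
under [X in mean _ X * _]eq_fun do rewrite mulrC.
by under [X in mean _ X = _]eq_fun do rewrite mulrC; exact: mean_nested_increments.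
Qed.

Lemma integral_overlap (a b c e : R) :
  0 <= a -> a <= b -> b <= T -> 0 <= c -> c <= e -> e <= T ->
  \int[mu]_(s in `[0, T]) (\1_`]a, b] s * \1_`]c, e] s) = overlap a b c e.
Proof.
move=> a0 ab bT c0 ce eT.
have -> : (fun s : R => \1_`]a, b] s * \1_`]c, e] s : R) =
    \1_`]Num.max a c, Num.min b e].
  apply/funext => s; rewrite !indicE -natrM mulnb; congr (_%:R); congr nat_of_bool.
  apply/idP/idP.
    move=> /andP[/set_mem + /set_mem]; rewrite /= !in_itv/= => h1 h2.
    by apply: mem_set; rewrite /= in_itv/= gt_max le_min; lra.
  move=> /set_mem; rewrite /= in_itv/= gt_max le_min => h.
  by apply/andP; split; apply: mem_set; rewrite /= in_itv/=; lra.
rewrite /Rintegral integral_indic//=.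
rewrite (_ : _ `&` _ = `]Num.max a c, Num.min b e]%classic); last first.
  apply/setIidPl => s /=; rewrite !in_itv/= gt_max le_min.
  by move=> /andP[/andP[h1 h2] /andP[h3 h4]]; apply/andP; split; lra.
rewrite lebesgue_measure_itv/= lte_fin /overlap.
case: ltP => h.
  by rewrite -EFinB/=; apply/esym/max_idPr; rewrite subr_ge0 ltW.
by apply/esym/max_idPl; rewrite subr_le0.
Qed.

Section Family.
Context {I : finType} (a b : I -> R) (xi : I -> Omega -> R).

(** The index type is an arbitrary finite type and the intervals may overlap. The difference of two
    simple processes is then again such a family, over the disjoint sum of the index types, and no
    common refinement of the knots is required. *)
Definition step_fun (s : R) w : R := \sum_i xi i w * \1_`]a i, b i] s.

Definition step_integral w : R := \sum_i xi i w * increment B (a i) (b i) w.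

Definition step_admissible := forall i,
  [/\ 0 <= a i, a i <= b i, b i <= T & bounded_wrt (a i) (xi i)].

Hypothesis ok : step_admissible.

Lemma step_integral_L2 : L2 P step_integral.
Proof.
by apply: L2_sum => i; have [a0 ab bT bx] := ok i; exact: increment_L2.
Qed.

Lemma step_coef_L2 i : L2 P (xi i).
Proof. by have [? ? ? ?] := ok i; apply: (@bounded_wrt_L2 (a i)) => //; lra. Qed.

Lemma measurable_step_fun w : measurable_fun setT (step_fun ^~ w).
Proof.
by apply: measurable_sum => i; exact: measurable_funM.
Qed.

Lemma integrable_itv_indic (D : set R) (c e : R) : measurable D ->
  mu.-integrable D (EFin \o \1_`]c, e]).
Proof.
move=> mD; apply: (integrableS measurableT) => //.
exact: integrable_indic_itv.
Qed.

Lemma Rintegral_sum (D : set R) (J : Type) (s : seq J) (f : J -> R -> R) :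
  measurable D -> (forall j, mu.-integrable D (EFin \o f j)) ->
  mu.-integrable D (EFin \o (fun x => \sum_(j <- s) f j x)) /\
  \int[mu]_(x in D) (\sum_(j <- s) f j x) = \sum_(j <- s) \int[mu]_(x in D) f j x.
Proof.
move=> mD fi; elim: s => [|j s [ih1 ih2]].
  split; first by under eq_fun do rewrite big_nil; exact: integrable0.
  by under eq_Rintegral do rewrite big_nil; rewrite big_nil /Rintegral integral0.
split.
  under eq_fun do rewrite big_cons.
  by have := integrableD _ (fi j) ih1; apply; exact: mD.
under eq_Rintegral do rewrite big_cons.
by rewrite RintegralD// ih2 big_cons.
Qed.

Lemma integral_step_fun w :
  \int[mu]_(s in `[0, T]) step_fun s w = \sum_i xi i w * (b i - a i).
Proof.
rewrite (Rintegral_sum _ _ _).2//; last first.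
  move=> i.
  by apply: integrable_scale => //; exact: integrable_itv_indic.
apply: eq_bigr => i _; have [a0 ab bT _] := ok i.
rewrite RintegralZl//; last exact: integrable_itv_indic.
congr (_ * _).
have := integral_overlap a0 ab bT a0 ab bT.
rewrite /overlap minxx maxxx (max_idPr _) ?subr_ge0// => <-.
apply: eq_Rintegral => s _; rewrite !indicE.
by case: (_ \in _); rewrite ?mulr1 ?mulr0.
Qed.

Lemma step_fun_sqr s w : step_fun s w ^+ 2 =
  \sum_(p : I * I) xi p.1 w * xi p.2 w *
    (\1_`]a p.1, b p.1] s * \1_`]a p.2, b p.2] s).
Proof.
rewrite expr2 /step_fun mulr_suml -(pair_bigA _ (fun i j => xi i w * xi j w *
  (\1_`]a i, b i] s * \1_`]a j, b j] s))).
by apply: eq_bigr => i _; rewrite mulr_sumr; apply: eq_bigr => j _; ring.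
Qed.

Lemma integral_step_fun_sqr w :
  (\int[mu]_(s in `[0%R, T]) (step_fun s w ^+ 2)%:E)%E =
  (\sum_(p : I * I) xi p.1 w * xi p.2 w *
    overlap (a p.1) (b p.1) (a p.2) (b p.2))%:E.
Proof.
have H (p : I * I) : mu.-integrable `[0, T]
    (EFin \o (fun s => \1_`]a p.1, b p.1] s * \1_`]a p.2, b p.2] s)).
  have := integrable_itv_indic (a p.1) (b p.1) (measurable_itv `[0, T]).
  apply: le_integrable => //.
    apply/measurable_EFinP; apply: measurable_funM; exact: measurable_indic.
  move=> s _ /=; rewrite lee_fin normrM ler_piMr// !indicE.
  by case: (_ \in _); rewrite ?normr1 ?normr0.
have H' (p : I * I) : mu.-integrable `[0, T] (EFin \o (fun s =>
    xi p.1 w * xi p.2 w * (\1_`]a p.1, b p.1] s * \1_`]a p.2, b p.2] s))).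
  exact: integrable_scale.
have [i1 e1] := Rintegral_sum (index_enum (I * I)%type) (measurable_itv `[0, T]) H'.
under eq_integral do rewrite step_fun_sqr.
rewrite -[LHS]fineK; last exact: integrable_fin_num i1.
congr EFin; apply: etrans e1 _; apply: eq_bigr => p _.
rewrite RintegralZl//; congr (_ * _).
by have [? ? ? _] := ok p.1; have [? ? ? _] := ok p.2; exact: integral_overlap.
Qed.

(** Both squares expand into double sums over pairs of indices. The term of a pair is, on either
    side, the mean of the product of the two coefficients times the overlap of their intervals. *)
Lemma step_isometry :
  (\int[P]_w \int[mu]_(s in `[0%R, T]) (step_fun s w ^+ 2)%:E =
   (mean P (fun w => step_integral w ^+ 2))%:E)%E.
Proof.
under eq_integral do rewrite integral_step_fun_sqr.
have iL (p : I * I) : L1 P (fun w => xi p.1 w * xi p.2 w *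
    overlap (a p.1) (b p.1) (a p.2) (b p.2)).
  have := L1Z (overlap (a p.1) (b p.1) (a p.2) (b p.2))
    (L2M (step_coef_L2 p.1) (step_coef_L2 p.2)).
  by apply: eq_integrable => // w _ /=; rewrite mulrC.
rewrite L1_EFin; last exact: L1_sum.
congr EFin; rewrite mean_sum//.
have iM (p : I * I) : L1 P (fun w => xi p.1 w * increment B (a p.1) (b p.1) w *
    (xi p.2 w * increment B (a p.2) (b p.2) w)).
  have [? ? ? ?] := ok p.1; have [? ? ? ?] := ok p.2.
  by apply: L2M; exact: increment_L2.
transitivity (mean P (fun w => \sum_(p : I * I)
    xi p.1 w * increment B (a p.1) (b p.1) w *
    (xi p.2 w * increment B (a p.2) (b p.2) w))).
  rewrite mean_sum//; apply: eq_bigr => p _.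
  have [? ? ? ?] := ok p.1; have [? ? ? ?] := ok p.2.
  rewrite mean_increments// mulrC -meanZ; last exact: L2M (step_coef_L2 _) (step_coef_L2 _).
  by apply: eq_mean => w; rewrite mulrC.
apply: eq_mean => w; rewrite expr2 /step_integral mulr_suml.
rewrite -(pair_bigA _ (fun i j => xi i w * increment B (a i) (b i) w *
    (xi j w * increment B (a j) (b j) w))).
by apply: eq_bigr => i _; rewrite mulr_sumr.
Qed.

End Family.
End StepIntegrals.

(** * Jointly measurable processes and their norm in L^2(dt x dP) *)

Lemma integrable_sqr_itv {R : realType} (f : R -> R) (t : R) :
  measurable_fun `[0, t] f ->
  (@lebesgue_measure R).-integrable `[0, t] (EFin \o (fun s => f s ^+ 2)) ->
  (@lebesgue_measure R).-integrable `[0, t] (EFin \o f).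
Proof.
move=> mf i2; pose mu := @lebesgue_measure R.
have i1 : mu.-integrable `[0, t] (EFin \o (fun=> 1 : R)).
  apply: continuous_compact_integrable; first exact: segment_compact.
  exact/continuous_subspaceT/cst_continuous.
have iD : mu.-integrable `[0, t] (EFin \o (fun s => 1 + f s ^+ 2)).
  by have := integrableD _ i1 i2; apply.
apply: le_integrable iD => //; first exact/measurable_EFinP.
move=> s _ /=; rewrite lee_fin [leRHS]ger0_norm ?addr_ge0 ?sqr_ge0//.
rewrite -[f s ^+ 2]real_normK ?num_real//.
by have := sqr_ge0 (`|f s| - 1); have := normr_ge0 (f s); nra.
Qed.

Section Processes.
Context {R : realType} {d : measure_display} {Omega : measurableType d}.
Variables (P : probability Omega R) (T : R).
Hypothesis T0 : 0 < T.
Local Notation mu := (@lebesgue_measure R).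
Implicit Types (Phi Psi : R -> Omega -> R).

Definition jointly_measurable Phi := measurable_fun
  ((`[0, T] : set R) `*` [set: Omega]) (fun p : R * Omega => Phi p.1 p.2).

Lemma measurable_dom : measurable ((`[0, T] : set R) `*` [set: Omega]).
Proof. exact: measurableX. Qed.

Lemma jointly_measurable_path Phi w : jointly_measurable Phi ->
  measurable_fun `[0, T] (Phi ^~ w).
Proof.
move=> mPhi _ U mU.
have := mPhi measurable_dom U mU => /(measurable_ysection w).
congr measurable; apply/seteqP; split => s /=; rewrite /ysection/= inE/=.
  by move=> [[? _] ?].
by move=> [? ?].
Qed.

Lemma measurable_path_integral (f : R * Omega -> \bar R) (t : R) : t <= T ->
  measurable_fun ((`[0, T] : set R) `*` [set: Omega]) f ->
  (forall p, 0 <= f p)%E ->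
  measurable_fun setT (fun w => \int[mu]_(s in `[0%R, t]) f (s, w))%E.
Proof.
move=> tT mf f0.
pose g : measurableTypeR R * Omega -> \bar R := f \_ ((`[0, t] : set R) `*` [set: Omega]).
have mg : measurable_fun setT g.
  have mD : measurable ((`[0, t] : set R) `*` [set: Omega]) by exact: measurableX.
  apply/(measurable_restrictT _ mD).
  apply: measurable_funS mf => //; first exact: measurable_dom.
  move=> [s w] /= [st _]; split => //; move: st; rewrite /= !in_itv/= => /andP[-> h].
  exact: le_trans h tT.
have g0 p : (0 <= g p)%E by rewrite /g patchE; case: ifP.
have := @measurable_fun_fubini_tonelli_G _ _ _ _ R mu g mg g0.
apply: eq_measurable_fun => w _; rewrite /fubini_G.
rewrite [RHS]integral_mkcond; apply: eq_integral => s _.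
rewrite /g !patchE; congr (if _ then _ else _).
apply/idP/idP => /set_mem h; apply: mem_set; first by case: h.
by split.
Qed.

Lemma measurable_path_Rintegral Phi (t : R) : t <= T -> jointly_measurable Phi ->
  measurable_fun setT (fun w => \int[mu]_(s in `[0, t]) Phi s w).
Proof.
move=> tT mPhi.
have mE : measurable_fun ((`[0, T] : set R) `*` [set: Omega])
    (fun p : R * Omega => (Phi p.1 p.2)%:E) by exact/measurable_EFinP.
have mp := measurable_path_integral tT (measurable_funepos mE) (fun=> funepos_ge0 _ _).
have mn := measurable_path_integral tT (measurable_funeneg mE) (fun=> funeneg_ge0 _ _).
rewrite /Rintegral; apply: measurableT_comp => //.
have := emeasurable_funB mp mn; apply: eq_measurable_fun => w _.
rewrite [RHS]integralE /=; congr (_ - _)%E; apply: eq_integral => s _.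
  by rewrite !funeposE.
by rewrite !funenegE.
Qed.

Definition energy Phi : \bar R :=
  (\int[P]_w \int[mu]_(s in `[0%R, T]) ((Phi s w) ^+ 2)%:E)%E.

Lemma jointly_measurable_sqr Phi : jointly_measurable Phi ->
  measurable_fun ((`[0, T] : set R) `*` [set: Omega])
    (fun p : R * Omega => ((Phi p.1 p.2) ^+ 2)%:E).
Proof. by move=> mPhi; apply/measurable_EFinP; exact: measurable_funX. Qed.

Lemma measurable_path_energy Phi (t : R) : t <= T -> jointly_measurable Phi ->
  measurable_fun setT (fun w => \int[mu]_(s in `[0%R, t]) ((Phi s w) ^+ 2)%:E)%E.
Proof.
move=> tT mPhi.
apply: (measurable_path_integral tT (jointly_measurable_sqr mPhi)) => p.
by rewrite lee_fin sqr_ge0.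
Qed.

Lemma energy_ge0 Phi : (0 <= energy Phi)%E.
Proof.
apply: integral_ge0 => w _; apply: integral_ge0 => s _.
by rewrite lee_fin sqr_ge0.
Qed.

Lemma jointly_measurableB Phi Psi :
  jointly_measurable Phi -> jointly_measurable Psi ->
  jointly_measurable (fun s w => Phi s w - Psi s w).
Proof. by move=> mPhi mPsi; exact: measurable_funB. Qed.

Lemma jointly_measurableZ (c : R) Phi :
  jointly_measurable Phi -> jointly_measurable (fun s w => c * Phi s w).
Proof. by move=> mPhi; apply: measurable_funM => //; exact: measurable_cst. Qed.

Lemma path_measurable_sqr Phi w : jointly_measurable Phi ->
  measurable_fun `[0, T] (fun s => ((Phi s w) ^+ 2)%:E).
Proof.
move=> mPhi; apply/measurable_EFinP; apply: measurable_funX.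
exact: jointly_measurable_path.
Qed.

Lemma energyB_le Phi Psi : jointly_measurable Phi -> jointly_measurable Psi ->
  (energy (fun s w => (Phi s w - Psi s w)%R) <=
   2%:E * energy Phi + 2%:E * energy Psi)%E.
Proof.
move=> mPhi mPsi.
have mP' := measurable_path_energy (lexx T) mPhi.
have mQ' := measurable_path_energy (lexx T) mPsi.
have i0 (f : R -> R) : (0 <= \int[mu]_(s in `[0%R, T]) ((f s) ^+ 2)%:E)%E.
  by apply: integral_ge0 => s _; rewrite lee_fin sqr_ge0.
have sq0 (x : R) : (0 <= (x ^+ 2)%:E)%E by rewrite lee_fin sqr_ge0.
rewrite /energy -!ge0_integralZl//.
rewrite -ge0_integralD//; last 4 first.
- by move=> w _; apply: mule_ge0.
- exact: measurable_funeM.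
- by move=> w _; apply: mule_ge0.
- exact: measurable_funeM.
apply: ge0_le_integral => //.
- exact: (measurable_path_energy (lexx T) (jointly_measurableB mPhi mPsi)).
- by apply: emeasurable_funD; exact: measurable_funeM.
move=> w _.
have mp := path_measurable_sqr w mPhi.
have mq := path_measurable_sqr w mPsi.
rewrite -!ge0_integralZl//.
rewrite -ge0_integralD//; last 4 first.
- by move=> s _; apply: mule_ge0.
- exact: measurable_funeM.
- by move=> s _; apply: mule_ge0.
- exact: measurable_funeM.
apply: ge0_le_integral => //.
- exact: (path_measurable_sqr w (jointly_measurableB mPhi mPsi)).
- by apply: emeasurable_funD; exact: measurable_funeM.
move=> s _; rewrite -!EFinM -EFinD lee_fin.
by have := sqr_ge0 (Phi s w + Psi s w); nra.
Qed.

(** Cauchy-Schwarz in time, from the nonnegative integral of [(f - c) ^ 2] at the average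
    [c = a / t]. The right-hand side may be [+oo]; that case is separated first, since integrability
    of [f] is deduced from the finiteness of its square. *)
Lemma Rintegral_sqr_le (f : R -> R) (t : R) : 0 <= t -> t <= T ->
  measurable_fun `[0, T] f ->
  (((\int[mu]_(s in `[0, t]) f s) ^+ 2)%:E <=
   T%:E * \int[mu]_(s in `[0%R, T]) ((f s) ^+ 2)%:E)%E.
Proof.
move=> t0 tT mf.
have sub : `[0, t] `<=` (`[0, T] : set R).
  by move=> s /=; rewrite !in_itv/= => /andP[-> h]; exact: le_trans h tT.
have mf2 : measurable_fun `[0, T] (fun s => ((f s) ^+ 2)%:E).
  by apply/measurable_EFinP; exact: measurable_funX.
have i0 : (0 <= \int[mu]_(s in `[0%R, T]) ((f s) ^+ 2)%:E)%E.
  by apply: integral_ge0 => s _; rewrite lee_fin sqr_ge0.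
have [->|] := eqVneq (\int[mu]_(s in `[0%R, T]) ((f s) ^+ 2)%:E)%E +oo%E.
  by rewrite gt0_muley ?leey// lte_fin.
rewrite -ltey => fin.
have i2T : mu.-integrable `[0, T] (EFin \o (fun s => f s ^+ 2)).
  apply/integrableP; split => //.
  by under eq_integral do rewrite /= ger0_norm ?sqr_ge0//.
have i2 : mu.-integrable `[0, t] (EFin \o (fun s => f s ^+ 2)).
  by apply: integrableS i2T => //; exact: measurable_itv.
have icst (e : R) : mu.-integrable `[0, t] (EFin \o (fun=> e)).
  apply: continuous_compact_integrable; first exact: segment_compact.
  exact/continuous_subspaceT/cst_continuous.
have if1 : mu.-integrable `[0, t] (EFin \o f).
  by apply: integrable_sqr_itv i2; apply: measurable_funS mf.
set a := \int[mu]_(s in `[0, t]) f s.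
set b := \int[mu]_(s in `[0, t]) (f s ^+ 2).
have bT : (b%:E <= \int[mu]_(s in `[0%R, T]) ((f s) ^+ 2)%:E)%E.
  rewrite /b /Rintegral fineK; last exact: integrable_fin_num.
  apply: ge0_subset_integral => //.
  by move=> s _; rewrite lee_fin sqr_ge0.
have b0 : 0 <= b by apply: Rintegral_ge0 => s _; exact: sqr_ge0.
suff ab : a ^+ 2 <= t * b.
  apply: le_trans (_ : (t%:E * b%:E <= _)%E).
    by rewrite -EFinM lee_fin.
  by apply: lee_pmul; rewrite ?lee_fin.
have H (c : R) : 0 <= b - 2 * c * a + c ^+ 2 * t.
  have : 0 <= \int[mu]_(s in `[0, t]) ((f s - c) ^+ 2).
    by apply: Rintegral_ge0 => s _; exact: sqr_ge0.
  under eq_Rintegral do rewrite sqrrB -mulr_natr -mulrA.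
  have ifc : mu.-integrable `[0, t] (EFin \o (fun s => f s * (c * 2))).
    rewrite (_ : (fun s => _) = (fun s => (c * 2) * f s)).
      exact: integrable_scale.
    by apply/funext => s; rewrite mulrC.
  rewrite RintegralD//; last by have := integrableB _ i2 ifc; apply.
  rewrite RintegralB// RintegralZr// Rintegral_cst//.
  have -> : fine (mu `[0, t]) = t.
    rewrite lebesgue_measure_itv/= lte_fin; case: ltP => [_|t0'].
      by rewrite -EFinB subr0.
    by apply/eqP; rewrite eq_le t0 t0'.
  by rewrite -/a -/b; lra.
have [t_eq0|t_neq0] := eqVneq t 0.
  rewrite /a t_eq0 set_itv1 Rintegral_set1 expr0n/= mul0r//.
have t_gt0 : 0 < t by rewrite lt_neqAle eq_sym t_neq0.
have := H (a / t); have -> : b - 2 * (a / t) * a + (a / t) ^+ 2 * t =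
  (t * b - a ^+ 2) / t by field.
by rewrite pmulr_lge0 ?invr_gt0// subr_ge0.
Qed.

End Processes.

(** * Simple processes as families of steps stopped at a time *)

Section SimpleProcesses.
Context {R : realType} {d : measure_display} {Omega : measurableType d}.
Variables (P : probability Omega R) (T : R).
Hypothesis T0 : 0 < T.
Variables (F : R -> set (set Omega)) (B : R -> Omega -> R).
Hypothesis hF : complete_filtration P T F.
Hypothesis hB : brownian_motion P T F B.
Local Notation mu := (@lebesgue_measure R).
Implicit Types (H : @simple_process R _ Omega).

(** Cutting every interval at [t] turns the integral over [[0, t]] into the full step integral of
    another family, so the isometry for families serves at every time. *)
Definition sp_lo H (t : R) (i : 'I_(sp_size H)) := Num.min (sp_knot H i) t.
Definition sp_hi H (t : R) (i : 'I_(sp_size H)) := Num.min (sp_knot H i.+1) t.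
(* For [t < sp_knot H i] the coefficient need not be measurable at the time
   [sp_lo H t i = t]; it may be replaced by 0, as both end points are then [t]. *)
Definition sp_cut H (t : R) (i : 'I_(sp_size H)) w :=
  if sp_knot H i <= t then sp_coef H i w else 0.

Lemma sp_step_admissible H (t : R) : 0 <= t -> t <= T -> sp_admissible T F H ->
  step_admissible T F (@sp_lo H t) (@sp_hi H t) (@sp_cut H t).
Proof.
move=> t0 tT [hk hle hm [K hK]] i.
have /andP[k0 kT] : 0 <= sp_knot H i <= T.
  by have := hk i (ltnW (ltn_ord i)); rewrite in_itv.
have /andP[k0' kT'] : 0 <= sp_knot H i.+1 <= T.
  by have := hk i.+1 (ltn_ord i); rewrite in_itv.
split.
- by rewrite /sp_lo le_min k0.
- by rewrite /sp_lo /sp_hi le_min !ge_min lexx orbT hle.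
- by rewrite /sp_hi ge_min tT orbT.
rewrite /sp_cut /sp_lo; case: (leP (sp_knot H i) t) => h.
  by split; [exact: hm|exists K => w; exact: hK].
split; last by exists 0 => w; rewrite normr0.
by apply: measurable_wrt_cst; exact: (filtration_sigma hF t0 tT).
Qed.

Lemma sp_step_integral H (t : R) w :
  (forall i, (i < sp_size H)%N -> sp_knot H i <= sp_knot H i.+1) ->
  step_integral B (@sp_lo H t) (@sp_hi H t) (@sp_cut H t) w = sp_integral B H t w.
Proof.
move=> hle; apply: eq_bigr => i _; rewrite /sp_cut /sp_lo /sp_hi.
case: (leP (sp_knot H i) t) => // h.
rewrite (min_idPr _); last by rewrite (le_trans (ltW h))// hle.
by rewrite increment_id !mulr0.
Qed.

Lemma sp_step_fun H (t s : R) w :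
  step_fun (@sp_lo H t) (@sp_hi H t) (@sp_cut H t) s w =
  if s <= t then sp_fun H s w else 0.
Proof.
rewrite /step_fun /sp_fun /sp_cut /sp_lo /sp_hi.
case: (leP s t) => st; last first.
  apply: big1 => i _; rewrite indicE memNset ?mulr0//= in_itv/=.
  by rewrite le_min => /andP[_ /andP[_]]; rewrite leNgt st.
apply: eq_bigr => i _; case: (leP (sp_knot H i) t) => h.
  congr (_ * _); rewrite !indicE; congr (_%:R); congr nat_of_bool.
  by apply/idP/idP => /set_mem; rewrite /= in_itv/= => g; apply: mem_set;
    rewrite /= in_itv/=; move: g; rewrite le_min st andbT.
rewrite mul0r indicE memNset ?mulr0//= in_itv/= => /andP[+ _].
by rewrite ltNge (le_trans st (ltW h)).
Qed.

Lemma sp_integral_L2 H (t : R) : 0 <= t -> t <= T -> sp_admissible T F H ->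
  L2 P (sp_integral B H t).
Proof.
move=> t0 tT hH; have [_ hle _ _] := hH.
have := step_integral_L2 hF hB (sp_step_admissible t0 tT hH).
rewrite (_ : step_integral _ _ _ _ = sp_integral B H t)//.
by apply/funext => w; exact: sp_step_integral.
Qed.

Lemma sp_fun_jointly_measurable H : sp_admissible T F H ->
  jointly_measurable T (sp_fun H).
Proof.
move=> [hk _ hm _].
apply: measurable_sum => i; apply: measurable_funM.
  have /andP[k0 kT] : 0 <= sp_knot H i <= T.
    by have := hk i (ltnW (ltn_ord i)); rewrite in_itv.
  have mc : measurable_fun setT (sp_coef H i).
    by apply: (filtration_measurable hF k0 kT); exact: hm.
  apply: measurable_funTS.
  exact: (measurableT_comp mc measurable_snd).
have mi : measurable_fun setT
    (\1_`]sp_knot H i, sp_knot H i.+1] : R -> R) by exact: measurable_indic.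
by apply: measurable_funTS; exact: (measurableT_comp mi measurable_fst).
Qed.

Lemma sp_energy_fin H : sp_admissible T F H -> (energy P T (sp_fun H) < +oo)%E.
Proof.
move=> hH.
have := step_isometry hF hB (sp_step_admissible (ltW T0) (lexx T) hH).
set m := mean _ _ => h; have := ltry m; rewrite -h; apply: le_lt_trans.
rewrite le_eqVlt; apply/orP; left; apply/eqP.
apply: eq_integral => w _; apply: eq_integral => s /set_mem.
by rewrite /= in_itv/= => /andP[_ sT]; rewrite sp_step_fun sT.
Qed.

Section Difference.
Variables H H' : @simple_process R _ Omega.
Hypotheses (hH : sp_admissible T F H) (hH' : sp_admissible T F H').

Definition sum_fun {I J : Type} {S : Type} (f : I -> S) (g : J -> S) (i : I + J) :=
  match i with inl x => f x | inr y => g y end.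

Let lo t := sum_fun (@sp_lo H t) (@sp_lo H' t).
Let hi t := sum_fun (@sp_hi H t) (@sp_hi H' t).
Let cut t := sum_fun (@sp_cut H t) (fun i w => - @sp_cut H' t i w).

Let diff_admissible (t : R) : 0 <= t -> t <= T ->
  step_admissible T F (lo t) (hi t) (cut t).
Proof.
move=> t0 tT [] i.
  exact: (sp_step_admissible t0 tT hH i).
have [h1 h2 h3 [h4 [K h5]]] := sp_step_admissible t0 tT hH' i.
split => //; split; last by exists K => w; rewrite /= normrN.
have lT : sp_lo t i <= T by lra.
have := measurable_wrtB (filtration_sigma hF h1 lT)
  (measurable_wrt_cst (filtration_sigma hF h1 lT) 0) h4.
by rewrite (_ : (fun w => _) = (fun w => - @sp_cut H' t i w))//;
  apply/funext => w; rewrite sub0r.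
Qed.

Let diff_integral (t : R) w :
  step_integral B (lo t) (hi t) (cut t) w =
  sp_integral B H t w - sp_integral B H' t w.
Proof.
have [_ h1 _ _] := hH; have [_ h2 _ _] := hH'.
rewrite -!sp_step_integral// /step_integral big_sumType/=; congr (_ + _).
by rewrite -sumrN; apply: eq_bigr => i _; rewrite mulNr.
Qed.

Let diff_fun (t s : R) w : step_fun (lo t) (hi t) (cut t) s w =
  if s <= t then sp_fun H s w - sp_fun H' s w else 0.
Proof.
transitivity (step_fun (@sp_lo H t) (@sp_hi H t) (@sp_cut H t) s w -
  step_fun (@sp_lo H' t) (@sp_hi H' t) (@sp_cut H' t) s w).
  rewrite /step_fun big_sumType/=; congr (_ + _).
  by rewrite -sumrN; apply: eq_bigr => i _; rewrite mulNr.
by rewrite !sp_step_fun; case: ifP => // _; rewrite subr0.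
Qed.

(** The isometry for the family of the difference is an equality over [[0, t]]; the bound by the
    energy over [[0, T]] is uniform in [t]. *)
Lemma sp_integral_dist (t : R) : 0 <= t -> t <= T ->
  ((mean P (fun w => (sp_integral B H t w - sp_integral B H' t w) ^+ 2))%:E <=
   energy P T (fun s w => (sp_fun H s w - sp_fun H' s w)%R))%E.
Proof.
move=> t0 tT.
have mD := jointly_measurableB (sp_fun_jointly_measurable hH)
  (sp_fun_jointly_measurable hH').
have := step_isometry hF hB (diff_admissible t0 tT).
under [X in mean P X]eq_fun do rewrite diff_integral.
move=> <-; apply: ge0_le_integral => //.
- by move=> w _; apply: integral_ge0 => s _; rewrite lee_fin sqr_ge0.
- under eq_fun do rewrite (integral_step_fun_sqr (diff_admissible t0 tT)).
  apply/measurable_EFinP; apply: measurable_sum => p.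
  have ok1 := step_coef_L2 hF (diff_admissible t0 tT) p.1.
  have ok2 := step_coef_L2 hF (diff_admissible t0 tT) p.2.
  by apply: measurable_funM => //; apply: measurable_funM; [case: ok1|case: ok2].
- exact: (measurable_path_energy (lexx T) mD).
move=> w _; apply: ge0_le_integral => //.
- by move=> s _; rewrite lee_fin sqr_ge0.
- apply/measurable_EFinP; apply: measurable_funX; apply: measurable_funTS.
  exact: measurable_step_fun.
- exact: (path_measurable_sqr w mD).
move=> s _; rewrite lee_fin diff_fun; case: ifP => // _.
by rewrite expr0n/= sqr_ge0.
Qed.

End Difference.
End SimpleProcesses.

(** * The Girsanov density and its effect on step integrals *)

Section GirsanovWeight.
Context {R : realType} {d : measure_display} {Omega : measurableType d}.
Variables (P : probability Omega R) (T : R).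
Hypothesis T0 : 0 < T.
Variables (F : R -> set (set Omega)) (B : R -> Omega -> R).
Hypothesis hF : complete_filtration P T F.
Hypothesis hB : brownian_motion P T F B.
Local Notation mu := (@lebesgue_measure R).
Implicit Types (theta : R) (xi zeta : Omega -> R).

Lemma L1_mul_bounded xi zeta (K : R) : measurable_fun setT xi ->
  (forall w, `|xi w| <= K) -> L1 P zeta -> L1 P (fun w => xi w * zeta w).
Proof.
move=> mxi xiK iz.
have mz := L1_measurable iz.
apply: (@L1_dom _ _ _ P (fun w => K * `|zeta w|)).
- exact: measurable_funM.
- exact/L1Z/L1_norm.
- by move=> w; rewrite normrM ler_wpM2r.
Qed.

Definition exp_increment theta (s t : R) w := expR (- theta * increment B s t w).

Lemma exp_incrementD theta (a b c : R) w :
  exp_increment theta a c w = exp_increment theta a b w * exp_increment theta b c w.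
Proof. by rewrite /exp_increment -expRD -mulrDr -incrementD. Qed.

Lemma measurable_wrt_exp_increment theta (s t u : R) :
  0 <= s -> s <= t -> t <= u -> u <= T ->
  measurable_wrt (F u) (exp_increment theta s t).
Proof.
move=> s0 st tu uT.
apply: (@measurable_wrt_comp _ _ _ _ (fun x => expR (- theta * x))).
  exact: measurable_expRM.
exact: (measurable_wrt_increment hF hB).
Qed.

Lemma mean_mul_exp_increment theta (s t : R) zeta :
  0 <= s -> s <= t -> t <= T -> measurable_wrt (F s) zeta -> L1 P zeta ->
  L1 P (fun w => zeta w * exp_increment theta s t w) /\
  mean P (fun w => zeta w * exp_increment theta s t w) =
    mean P zeta * expR (theta ^+ 2 * (t - s) / 2).
Proof.
move=> s0; rewrite le_eqVlt => /predU1P[<- _ _ iz|st tT mz iz].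
  rewrite subrr mulr0 mul0r expR0 mulr1 /exp_increment.
  by under eq_fun do rewrite increment_id mulr0 expR0 mulr1.
have ts0 : Num.sqrt (t - s) != 0 by rewrite gt_eqF// sqrtr_gt0 subr_gt0.
have [iL ->] := mean_mul_increment hF hB s0 st tT mz iz (L1_normal_expR ts0 (- theta)).
split => //.
by rewrite mean_normal_expR// sqrrN sqr_sqrtr// subr_ge0 ltW.
Qed.

Lemma mean_mul_id_exp_increment theta (s t : R) zeta :
  0 <= s -> s <= t -> t <= T -> measurable_wrt (F s) zeta -> L1 P zeta ->
  L1 P (fun w => zeta w * (increment B s t w * exp_increment theta s t w)) /\
  mean P (fun w => zeta w * (increment B s t w * exp_increment theta s t w)) =
    mean P zeta * (- theta * (t - s) * expR (theta ^+ 2 * (t - s) / 2)).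
Proof.
move=> s0; rewrite le_eqVlt => /predU1P[<- _ _ iz|st tT mz iz].
  rewrite subrr !(mulr0, mul0r).
  under eq_fun do rewrite increment_id mul0r mulr0.
  by split; [exact: L1_cst|exact: mean_cst].
have ts0 : Num.sqrt (t - s) != 0 by rewrite gt_eqF// sqrtr_gt0 subr_gt0.
have [iL ->] := mean_mul_increment hF hB s0 st tT mz iz (L1_normal_id_expR ts0 (- theta)).
split => //.
by rewrite mean_normal_id_expR// sqrrN sqr_sqrtr// subr_ge0 ltW.
Qed.

(* The Girsanov density, under which [B t + theta * t] is a Brownian motion. *)
Definition weight theta w := expR (- (theta ^+ 2 * T / 2)) * exp_increment theta 0 T w.

Lemma measurable_weight theta : measurable_fun setT (weight theta).
Proof.
apply: measurable_funM => //.
apply: (filtration_measurable hF (ltW T0) (lexx T)).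
by apply: measurable_wrt_exp_increment => //; exact: ltW.
Qed.

Lemma exp_increment_L1 theta (t : R) : 0 <= t -> t <= T ->
  L1 P (exp_increment theta 0 t) /\
  mean P (exp_increment theta 0 t) = expR (theta ^+ 2 * t / 2).
Proof.
move=> t0 tT.
have [] := mean_mul_exp_increment theta (lexx 0) t0 tT
  (measurable_wrt_cst (filtration_sigma hF (lexx 0) (ltW T0)) 1) (L1_cst P 1).
rewrite mean_cst mul1r subr0.
by under eq_fun do rewrite mul1r.
Qed.

(** The square of the weight is a constant multiple of the exponential of the same increment with
    parameter [2 * theta]. *)
Lemma weight_L2 theta : L2 P (weight theta).
Proof.
split; first exact: measurable_weight.
have [h _] := exp_increment_L1 (2 * theta) (ltW T0) (lexx T).
have := L1Z (expR (- (theta ^+ 2 * T / 2)) ^+ 2) h.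
apply: eq_integrable => // w _ /=; congr EFin.
rewrite /weight exprMn; congr (_ * _).
by rewrite /exp_increment -expRM_natl; congr expR; ring.
Qed.

Lemma mean_weight theta : mean P (weight theta) = 1.
Proof.
have [h e] := exp_increment_L1 theta (ltW T0) (lexx T).
by rewrite /weight meanZ// e -expRD addNr expR0.
Qed.

(** The weight factors over [[0, a]], [[a, b]] and [[b, T]]. The first factor and [xi] are known at
    time [a], and the last factor contributes the same constant to both sides. For the middle one,
    [E (D * exp (- theta * D)) = - theta * (b - a) * E (exp (- theta * D))], with [D] the increment
    over [[a, b]]. *)
Lemma mean_weight_increment theta (a b : R) xi :
  0 <= a -> a <= b -> b <= T -> bounded_wrt F a xi ->
  mean P (fun w => weight theta w * (xi w * increment B a b w)) =
  - theta * (b - a) * mean P (fun w => weight theta w * xi w).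
Proof.
move=> a0 ab bT [mxi [K xiK]].
have aT : a <= T by lra.
have b0 : 0 <= b by lra.
pose z w := xi w * exp_increment theta 0 a w.
have mz : measurable_wrt (F a) z.
  apply: measurable_wrtM => //; first exact: (filtration_sigma hF a0 aT).
  by apply: measurable_wrt_exp_increment.
have iz : L1 P z.
  apply: (@L1_mul_bounded _ _ K) => //.
    exact: (filtration_measurable hF a0 aT).
  by have [] := exp_increment_L1 theta a0 aT.
have [i1 e1] := mean_mul_exp_increment theta a0 ab bT mz iz.
have [i2 e2] := mean_mul_id_exp_increment theta a0 ab bT mz iz.
have mz' : measurable_wrt (F b) z by exact: (filtration_le hF a0 ab bT).
have sb := filtration_sigma hF b0 bT.
have me : measurable_wrt (F b) (exp_increment theta a b).
  exact: measurable_wrt_exp_increment.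
have mi : measurable_wrt (F b) (increment B a b).
  exact: (measurable_wrt_increment hF hB).
have [i3 e3] := mean_mul_exp_increment theta b0 bT (lexx T)
  (measurable_wrtM sb mz' me) i1.
have [i4 e4] := mean_mul_exp_increment theta b0 bT (lexx T)
  (measurable_wrtM sb mz' (measurable_wrtM sb mi me)) i2.
have E w : exp_increment theta 0 T w = exp_increment theta 0 a w *
    exp_increment theta a b w * exp_increment theta b T w.
  by rewrite (exp_incrementD theta 0 b T) (exp_incrementD theta 0 a b).
set k := expR (- (theta ^+ 2 * T / 2)).
transitivity (k * mean P (fun w => z w * (increment B a b w *
    exp_increment theta a b w) * exp_increment theta b T w)).
  rewrite -meanZ//; apply: eq_mean => w; rewrite /weight -/k E /z; ring.
transitivity (- theta * (b - a) * (k * mean P (fun w => z w *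
    exp_increment theta a b w * exp_increment theta b T w))).
  by rewrite e4 e2 e3 e1; ring.
congr (_ * _); rewrite -meanZ//; apply: eq_mean => w; rewrite /weight -/k E /z; ring.
Qed.

Section Family.
Context {I : finType} (a b : I -> R) (xi : I -> Omega -> R).
Hypothesis ok : step_admissible T F a b xi.

Lemma mean_weight_step_integral theta :
  L2 P (fun w => \int[mu]_(s in `[0, T]) step_fun a b xi s w) /\
  mean P (fun w => weight theta w * step_integral B a b xi w) =
  - theta * mean P (fun w => weight theta w *
    \int[mu]_(s in `[0, T]) step_fun a b xi s w).
Proof.
have IE : (fun w => \int[mu]_(s in `[0, T]) step_fun a b xi s w) =
    (fun w => \sum_i xi i w * (b i - a i)).
  by apply/funext => w; rewrite (integral_step_fun ok).
have x2 i : L2 P (xi i) by exact: (step_coef_L2 hF ok).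
have x2' i : L2 P (fun w => xi i w * (b i - a i)).
  by under eq_fun do rewrite mulrC; exact: L2Z.
have W2 := weight_L2 theta.
split; first by rewrite IE; exact: L2_sum.
transitivity (\sum_i (- theta * (b i - a i) * mean P (fun w => weight theta w * xi i w))).
  transitivity (mean P (fun w => \sum_i weight theta w * (xi i w * increment B (a i) (b i) w))).
    by apply: eq_mean => w; rewrite mulr_sumr.
  rewrite mean_sum.
    apply: eq_bigr => i _; have [? ? ? ?] := ok i; exact: mean_weight_increment.
  by move=> i; have [? ? ? ?] := ok i; apply: L2M => //; exact: (increment_L2 hF hB).
transitivity (- theta * mean P (fun w => \sum_i weight theta w * (xi i w * (b i - a i)))).
  rewrite mean_sum; last by move=> i; exact: L2M.
  rewrite mulr_sumr; apply: eq_bigr => i _.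
  rewrite -mulrA -meanZ; last exact: L2M.
  by congr (_ * _); apply: eq_mean => w; ring.
congr (_ * _); apply: eq_mean => w; rewrite -mulr_sumr; congr (_ * _).
by have := congr1 (fun f => f w) IE.
Qed.

End Family.
End GirsanovWeight.

(** * Boundedness and uniqueness of the Ito integral *)

Section ItoIntegral.
Context {R : realType} {d : measure_display} {Omega : measurableType d}.
Variables (P : probability Omega R) (T : R).
Hypothesis T0 : 0 < T.
Variables (F : R -> set (set Omega)) (B : R -> Omega -> R).
Hypothesis hF : complete_filtration P T F.
Hypothesis hB : brownian_motion P T F B.
Local Notation mu := (@lebesgue_measure R).
Variable J : R -> Omega -> R.
Hypothesis mJ : jointly_measurable T J.
Hypothesis J2 : (energy P T J < +oo)%E.
Implicit Types M : R -> Omega -> R.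

Lemma mean_sqr_eq0 (X : Omega -> R) : L2 P X ->
  mean P (fun w => X w ^+ 2) = 0 -> {ae P, forall w, X w = 0}.
Proof.
move=> [mX iX] X0.
have mX2 : measurable_fun setT (fun w => (X w ^+ 2)%:E).
  by apply/measurable_EFinP; exact: measurable_funX.
have h : (\int[P]_w `|(X w ^+ 2)%:E|)%E = 0%E.
  under eq_integral do rewrite gee0_abs ?lee_fin ?sqr_ge0//.
  by rewrite L1_EFin// X0.
have := (ae_eq_integral_abs P measurableT mX2).1 h.
apply: filterS => w /(_ I) /= /eqP; rewrite eqe sqrf_eq0 => /eqP //.
Qed.

Lemma energyC (Phi Psi : R -> Omega -> R) :
  energy P T (fun s w => Phi s w - Psi s w) = energy P T (fun s w => Psi s w - Phi s w).
Proof.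
apply: eq_integral => w _; apply: eq_integral => s _.
by rewrite -sqrrN opprB.
Qed.

Lemma ito_approx M : is_ito_integral P T F B J M ->
  exists H : nat -> simple_process,
    [/\ forall n, sp_admissible T F (H n),
        energy P T (fun s w => sp_fun (H n) s w - J s w) @[n --> \oo] --> 0%E,
        forall t : R, 0 <= t -> t <= T -> L2 P (M t) &
        forall t : R, 0 <= t -> t <= T ->
        mean P (fun w => (sp_integral B (H n) t w - M t w) ^+ 2) @[n --> \oo]
          --> (0 : R)].
Proof.
move=> [adM [H [hH hE hM]]]; exists H.
have L (t : R) : 0 <= t -> t <= T -> L2 P (M t) /\
    mean P (fun w => (sp_integral B (H n) t w - M t w) ^+ 2) @[n --> \oo] --> (0 : R).
  move=> t0 tT; have tI : t \in `[0, T] by rewrite in_itv/= t0.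
  apply: L2_cvg_sqr => //.
  - by move=> n; exact: (sp_integral_L2 hF hB).
  - by apply: (filtration_measurable hF t0 tT); exact: adM.
  - exact: hM.
by split => // t t0 tT; have [] := L t t0 tT.
Qed.

Lemma sp_integral_sqr_le (H : simple_process) (t : R) : 0 <= t -> t <= T ->
  sp_admissible T F H ->
  ((mean P (fun w => sp_integral B H t w ^+ 2))%:E <= energy P T (sp_fun H))%E.
Proof.
move=> t0 tT hH.
(* The simple process without intervals vanishes together with its integral, so the distance to it
   is the norm. *)
pose H0 : @simple_process R _ Omega := SimpleProcess 0 (fun=> 0) (fun=> fun=> 0).
have hH0 : sp_admissible T F H0.
  split => //; last by exists 0.
  by move=> i _; rewrite in_itv/= lexx ltW.
have := sp_integral_dist hF hB hH hH0 t0 tT.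
rewrite (_ : (fun w => _) = (fun w => sp_integral B H t w ^+ 2)); last first.
  by apply/funext => w; rewrite [sp_integral B H0 t w]big_ord0 subr0.
rewrite (_ : (fun s w => sp_fun H s w - sp_fun H0 s w) = sp_fun H)//.
by apply/funext => s; apply/funext => w; rewrite [sp_fun H0 s w]big_ord0 subr0.
Qed.

Lemma energy_fin_num (Phi : R -> Omega -> R) : (energy P T Phi < +oo)%E ->
  energy P T Phi \is a fin_num.
Proof. by move=> h; rewrite ge0_fin_numE// energy_ge0. Qed.

(** The approximation index depends on [t], but the bound does not: [M t] is within mean square 1 of
    a simple integral, whose own mean square is at most the energy of a simple process that differs
    from [J] by energy at most 1. The factors 2 come from [(a + b) ^ 2 <= 2 * (a ^ 2 + b ^ 2)]. *)
Lemma ito_bounded M : is_ito_integral P T F B J M ->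
  exists K : R, forall t : R, 0 <= t -> t <= T -> mean P (fun w => M t w ^+ 2) <= K.
Proof.
move=> /ito_approx[H [hH hE hL hM]].
exists (2 * (1 + (2 * fine (energy P T J) + 2))) => t t0 tT.
have /fine_cvgP[efin /cvgrPdist_lt/(_ 1 ltr01)e1] := hE.
have /cvgrPdist_lt/(_ 1 ltr01)m1 := hM t t0 tT.
have [n _ /(_ n (leqnn _)) [[nfin n1] n2]] :=
  filterI (filterI efin e1) m1.
have S2 : L2 P (sp_integral B (H n) t) by exact: (sp_integral_L2 hF hB).
have mS := sp_fun_jointly_measurable hF (hH n).
have M2 := hL t t0 tT.
have e2 : mean P (fun w => sp_integral B (H n) t w ^+ 2) <=
    2 * fine (energy P T J) + 2.
  rewrite -lee_fin; apply: le_trans (sp_integral_sqr_le t0 tT (hH n)) _.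
  have -> : energy P T (sp_fun (H n)) =
      energy P T (fun s w => J s w - (J s w - sp_fun (H n) s w)).
    by apply: eq_integral => w _; apply: eq_integral => s _; rewrite subKr.
  apply: le_trans (energyB_le P mJ (jointly_measurableB mJ mS)) _.
  rewrite [leRHS]EFinD EFinM fineK ?energy_fin_num//; apply: leeD => //.
  rewrite energyC -[leRHS]mule1 -(fineK nfin); apply: lee_pmul => //.
    by rewrite fineK// energy_ge0.
  rewrite lee_fin ltW//; apply: le_lt_trans n1.
  by rewrite sub0r normrN ler_norm.
have := mean_sqrD_le (L2B M2 S2) S2.
under [X in mean P X <= _]eq_fun do rewrite subrK.
have -> : mean P (fun w => (M t w - sp_integral B (H n) t w) ^+ 2) =
    mean P (fun w => (sp_integral B (H n) t w - M t w) ^+ 2).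
  by apply: eq_mean => w; rewrite -sqrrN opprB.
move: n2; rewrite sub0r normrN ltr_norml => /andP[_ n2].
by move=> h; apply: le_trans h _; rewrite ler_pM2l//; apply: lerD => //; exact: ltW.
Qed.

(** The two integrals may come from different approximating sequences; these are compared through
    the common integrand [J]. *)
Lemma ito_unique M M' :
  is_ito_integral P T F B J M -> is_ito_integral P T F B J M' ->
  forall t : R, 0 <= t -> t <= T -> {ae P, forall w, M t w = M' t w}.
Proof.
move=> /ito_approx[H [hH hE hL hM]] /ito_approx[H' [hH' hE' hL' hM']] t t0 tT.
suff : {ae P, forall w, M t w - M' t w = 0}.
  by apply: filterS => w /eqP; rewrite subr_eq0 => /eqP.
have M2 := hL t t0 tT; have M2' := hL' t t0 tT.
apply: mean_sqr_eq0; first exact: L2B.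
apply/eqP; rewrite eq_le mean_ge0 ?andbT; last by move=> w; exact: sqr_ge0.
apply/ler_addgt0Pr => e e0; rewrite add0r.
(* The number is [22 = 2 * (1 + 2 * (4 + 1))]: two splittings at cost 2 each, with errors 1 for [M],
   4 between the simple integrals and 1 for [M']. *)
have e22 : 0 < e / 22 by rewrite divr_gt0.
have /fine_cvgP[efin /cvgrPdist_lt/(_ _ e22)e1] := hE.
have /fine_cvgP[efin' /cvgrPdist_lt/(_ _ e22)e1'] := hE'.
have /cvgrPdist_lt/(_ _ e22)m1 := hM t t0 tT.
have /cvgrPdist_lt/(_ _ e22)m1' := hM' t t0 tT.
have [n _ /(_ n (leqnn _)) [[[nfin n1] n2] [[nfin' n1'] n2']]] :=
  filterI (filterI (filterI efin e1) m1) (filterI (filterI efin' e1') m1').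
have S2 : L2 P (sp_integral B (H n) t) by exact: (sp_integral_L2 hF hB).
have S2' : L2 P (sp_integral B (H' n) t) by exact: (sp_integral_L2 hF hB).
have mS := sp_fun_jointly_measurable hF (hH n).
have mS' := sp_fun_jointly_measurable hF (hH' n).
have SS : mean P (fun w => (sp_integral B (H n) t w - sp_integral B (H' n) t w) ^+ 2)
   <= 2 * (e / 22) + 2 * (e / 22).
  rewrite -lee_fin; apply: le_trans (sp_integral_dist hF hB (hH n) (hH' n) t0 tT) _.
  have -> : energy P T (fun s w => sp_fun (H n) s w - sp_fun (H' n) s w) =
      energy P T (fun s w => sp_fun (H n) s w - J s w - (sp_fun (H' n) s w - J s w)).
    by apply: eq_integral => w _; apply: eq_integral => s _; rewrite opprB addrA subrK.
  apply: le_trans (energyB_le P (jointly_measurableB mS mJ) (jointly_measurableB mS' mJ)) _.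
  have le_e (x : \bar R) : x \is a fin_num -> `|0 - fine x| < e / 22 ->
      (x <= (e / 22)%:E)%E.
    by case: x => // x _; rewrite sub0r normrN lee_fin => /ltW/(le_trans (ler_norm _)).
  rewrite [leRHS]EFinD EFinM; apply: leeD; apply: lee_pmul => //.
  - exact: energy_ge0.
  - exact: le_e nfin n1.
  - exact: energy_ge0.
  - exact: le_e nfin' n1'.
move: n2 n2'; rewrite !sub0r !normrN !ltr_norml => /andP[_ n2] /andP[_ n2'].
have h1 := mean_sqrD_le (L2B M2 S2) (L2B S2 M2').
have h2 := mean_sqrD_le (L2B S2 S2') (L2B S2' M2').
have E1 : mean P (fun w => (M t w - sp_integral B (H n) t w +
    (sp_integral B (H n) t w - M' t w)) ^+ 2) = mean P (fun w => (M t w - M' t w) ^+ 2).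
  by apply: eq_mean => w; congr (_ ^+ 2); ring.
have E2 : mean P (fun w => (sp_integral B (H n) t w - sp_integral B (H' n) t w +
    (sp_integral B (H' n) t w - M' t w)) ^+ 2) =
    mean P (fun w => (sp_integral B (H n) t w - M' t w) ^+ 2).
  by apply: eq_mean => w; congr (_ ^+ 2); ring.
have E3 : mean P (fun w => (M t w - sp_integral B (H n) t w) ^+ 2) =
    mean P (fun w => (sp_integral B (H n) t w - M t w) ^+ 2).
  by apply: eq_mean => w; rewrite -sqrrN opprB.
rewrite E1 E3 in h1; rewrite E2 in h2.
move: h1 h2 SS n2 n2'; move: (mean _ _) (mean _ _) (mean _ _) (mean _ _) (mean _ _).
by move=> x1 x2 x3 x4 x5 /= {hM hM' m1 m1' hE hE'} h1 h2 SS n2 n2'; lra.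
Qed.

Lemma L2_path_integral (Phi : R -> Omega -> R) (t : R) : 0 <= t -> t <= T ->
  jointly_measurable T Phi -> (energy P T Phi < +oo)%E ->
  L2 P (fun w => \int[mu]_(s in `[0, t]) Phi s w) /\
  mean P (fun w => (\int[mu]_(s in `[0, t]) Phi s w) ^+ 2) <=
    T * fine (energy P T Phi).
Proof.
move=> t0 tT mPhi Phi2.
have mI := measurable_path_Rintegral tT mPhi.
have H : (\int[P]_w ((\int[mu]_(s in `[0, t]) Phi s w) ^+ 2)%:E <=
    T%:E * energy P T Phi)%E.
  rewrite -ge0_integralZl//; last 3 first.
  - exact: (measurable_path_energy (lexx T) mPhi).
  - by move=> w _; apply: integral_ge0 => s _; rewrite lee_fin sqr_ge0.
  - by rewrite lee_fin ltW.
  apply: ge0_le_integral => //.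
  - by move=> w _; rewrite lee_fin sqr_ge0.
  - by apply/measurable_EFinP; exact: measurable_funX.
  - by apply: measurable_funeM; exact: (measurable_path_energy (lexx T) mPhi).
  move=> w _; apply: Rintegral_sqr_le => //.
  exact: jointly_measurable_path.
have L : L2 P (fun w => \int[mu]_(s in `[0, t]) Phi s w).
  split => //; apply/integrableP; split.
    by apply/measurable_EFinP; exact: measurable_funX.
  under eq_integral do rewrite /= ger0_norm ?sqr_ge0//.
  apply: le_lt_trans H _.
  by rewrite lte_mul_pinfty// ?lee_fin ?ltW.
split => //; move: H; rewrite L1_EFin; last exact: L.2.
by rewrite -(fineK (energy_fin_num Phi2)) -EFinM lee_fin.
Qed.

Lemma path_integrable_ae (Phi : R -> Omega -> R) :
  jointly_measurable T Phi -> (energy P T Phi < +oo)%E ->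
  {ae P, forall w, mu.-integrable `[0, T] (EFin \o (Phi ^~ w))}.
Proof.
move=> mPhi Phi2.
have iE : P.-integrable setT
    (fun w => \int[mu]_(s in `[0%R, T]) ((Phi s w) ^+ 2)%:E)%E.
  apply/integrableP; split; first exact: (measurable_path_energy (lexx T) mPhi).
  apply: le_lt_trans Phi2; rewrite le_eqVlt; apply/orP; left; apply/eqP.
  apply: eq_integral => w _; rewrite gee0_abs//.
  by apply: integral_ge0 => s _; rewrite lee_fin sqr_ge0.
have := integrable_ae measurableT iE.
apply: filterS => w /(_ I); rewrite fin_numElt => /andP[_ fin].
have mp := jointly_measurable_path w mPhi.
have i2 : mu.-integrable `[0, T] (EFin \o (fun s => Phi s w ^+ 2)).
  apply/integrableP; split; first by apply/measurable_EFinP; exact: measurable_funX.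
  by under eq_integral do rewrite /= ger0_norm ?sqr_ge0//.
exact: integrable_sqr_itv i2.
Qed.

Lemma Rintegral_cutoff (f : R -> R) (t : R) : 0 <= t -> t <= T ->
  \int[mu]_(s in `[0, T]) (if s <= t then f s else 0) =
  \int[mu]_(s in `[0, t]) f s.
Proof.
move=> t0 tT.
rewrite (_ : `[0, t]%classic = `[0, T] `&` [set s | s <= t]).
  rewrite Rintegral_mkcondr; apply: eq_Rintegral => s _; rewrite patchE.
  congr (if _ then _ else _); apply/idP/idP => [h|/set_mem//].
  exact: mem_set.
apply/seteqP; split => s /=; rewrite !in_itv/=.
  by move=> /andP[-> h]; rewrite h (le_trans h tT).
by move=> [/andP[-> _] ->].
Qed.

End ItoIntegral.

(** * The Girsanov identity for the Ito integral *)

Section WeightedIto.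
Context {R : realType} {d : measure_display} {Omega : measurableType d}.
Variables (P : probability Omega R) (T : R).
Hypothesis T0 : 0 < T.
Variables (F : R -> set (set Omega)) (B : R -> Omega -> R).
Hypothesis hF : complete_filtration P T F.
Hypothesis hB : brownian_motion P T F B.
Local Notation mu := (@lebesgue_measure R).
Variable J : R -> Omega -> R.
Hypothesis mJ : jointly_measurable T J.
Hypothesis J2 : (energy P T J < +oo)%E.
Implicit Types M : R -> Omega -> R.

(** The identity for simple processes passes to the limit since the weight is in L^2: on the left by
    L^2 convergence of the integrals at [t], on the right because the time integral is continuous
    for the energy norm. *)
Lemma mean_weight_ito theta M : is_ito_integral P T F B J M ->
  forall t : R, 0 <= t -> t <= T ->
  mean P (fun w => weight T B theta w * M t w) =
  - theta * mean P (fun w => weight T B theta w * \int[mu]_(s in `[0, t]) J s w).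
Proof.
move=> /(ito_approx hF hB)[H [hH hE hL hM]] t t0 tT.
have W2 := weight_L2 T0 hF hB theta.
have S2 n : L2 P (sp_integral B (H n) t) by exact: (sp_integral_L2 hF hB).
have mS n := sp_fun_jointly_measurable hF (hH n).
have M2 := hL t t0 tT.
have [I2 _] := L2_path_integral T0 t0 tT mJ J2.
pose IH n w := \int[mu]_(s in `[0, t]) sp_fun (H n) s w.
have IH2 n : L2 P (IH n).
  by have [] := L2_path_integral T0 t0 tT (mS n) (sp_energy_fin T0 hF hB (hH n)).
have eq_n n : mean P (fun w => weight T B theta w * sp_integral B (H n) t w) =
    - theta * mean P (fun w => weight T B theta w * IH n w).
  have [_] := mean_weight_step_integral T0 hF hB (sp_step_admissible hF t0 tT (hH n)) theta.
  have [_ hle _ _] := hH n.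
  under [X in mean P X = _]eq_fun do rewrite (sp_step_integral _ _ _ hle).
  have IE w : \int[mu]_(s in `[0, T]) step_fun (@sp_lo _ _ _ (H n) t)
      (@sp_hi _ _ _ (H n) t) (@sp_cut _ _ _ (H n) t) s w = IH n w.
    rewrite /IH -(Rintegral_cutoff _ t0 tT).
    by apply: eq_Rintegral => s _; rewrite sp_step_fun.
  by under [X in _ -> _ = _ * mean P X]eq_fun do rewrite -IE.
have c1 : mean P (fun w => weight T B theta w * sp_integral B (H n) t w)
    @[n --> \oo] --> mean P (fun w => weight T B theta w * M t w).
  apply/subr_cvg0.
  have := cvg_meanM W2 (fun n => L2B (S2 n) M2) (hM t t0 tT).
  apply: cvg_trans; apply: near_eq_cvg; apply: nearW => n /=.
  rewrite -meanB; [|exact: L2M|exact: L2M].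
  by apply: eq_mean => w; rewrite mulrBr.
have c2 : mean P (fun w => weight T B theta w * IH n w)
    @[n --> \oo] --> mean P (fun w => weight T B theta w * \int[mu]_(s in `[0, t]) J s w).
  apply/subr_cvg0.
  pose Dn n w := \int[mu]_(s in `[0, t]) (sp_fun (H n) s w - J s w).
  have en n : (energy P T (fun s w => (sp_fun (H n) s w - J s w)%R) < +oo)%E.
    apply: le_lt_trans (energyB_le P (mS n) mJ) _.
    have two0 : (0 <= 2%:E :> \bar R)%E by rewrite lee_fin.
    apply: lte_add_pinfty.
      exact: (lte_mul_pinfty two0 isT (sp_energy_fin T0 hF hB (hH n))).
    exact: (lte_mul_pinfty two0 isT J2).
  have D2 n := L2_path_integral T0 t0 tT (jointly_measurableB (mS n) mJ) (en n).
  have D0 : mean P (fun w => Dn n w ^+ 2) @[n --> \oo] --> (0 : R).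
    have h : T * fine (energy P T (fun s w => sp_fun (H n) s w - J s w))
        @[n --> \oo] --> (0 : R).
      rewrite -[X in _ --> X](mulr0 T).
      by apply: cvgM; [exact: cvg_cst|exact: fine_cvg].
    apply: (squeeze_cvgr _ (cvg_cst 0) h); apply: nearW => n.
    rewrite (D2 n).2 andbT; apply: mean_ge0 => w; exact: sqr_ge0.
  have := cvg_meanM W2 (fun n => (D2 n).1) D0.
  apply: cvg_trans; apply: near_eq_cvg; apply: nearW => n /=.
  rewrite -meanB; [|exact: L2M|exact: L2M].
  have mW : measurable_fun setT (weight T B theta) by case: W2.
  have mDn : measurable_fun setT (Dn n) by case: (D2 n).1.
  have mIH : measurable_fun setT (IH n) by case: (IH2 n).
  have mI : measurable_fun setT (fun w => \int[mu]_(s in `[0, t]) J s w) by case: I2.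
  (* Additivity of the time integral requires integrable paths, and those of [J] are integrable only
     almost surely. *)
  apply: ae_eq_mean.
  - exact: measurable_funM.
  - by apply: measurable_funB; exact: measurable_funM.
  apply: filterS2 (path_integrable_ae mJ J2)
    (path_integrable_ae (mS n) (sp_energy_fin T0 hF hB (hH n))) => w iJ iS.
  have sub : `[0, t] `<=` (`[0, T] : set R).
    by move=> s /=; rewrite !in_itv/= => /andP[-> h]; exact: le_trans h tT.
  rewrite -mulrBr /IH -RintegralB//.
  - by apply: integrableS iS => //; exact: measurable_itv.
  - by apply: integrableS iJ => //; exact: measurable_itv.
have E : (fun n => mean P (fun w => weight T B theta w * sp_integral B (H n) t w)) =
    (fun n => - theta * mean P (fun w => weight T B theta w * IH n w)).
  exact/funext/eq_n.
rewrite E in c1; apply: (cvg_unique _ c1); first exact: Rhausdorff.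
by apply: cvgM => //; exact: cvg_cst.
Qed.

End WeightedIto.

(** * Deterministic limits of exponentially weighted sums *)

Section PathwiseSums.
Context {R : realType}.
Local Notation mu := (@lebesgue_measure R).
Implicit Types (f g b h : R -> R).

Lemma uniform_continuity_itv b (T e : R) : 0 < e ->
  {within `[0, T], continuous b} ->
  exists2 delta : R, 0 < delta & forall x y, x \in `[0, T] -> y \in `[0, T] ->
    `|x - y| < delta -> `|b x - b y| < e.
Proof.
move=> e0 /subspace_continuousP cb.
have : compact `[0, T]%classic by exact: (@segment_compact R).
move=> /compact_near_coveringP/near_covering_withinP.
move=> /(_ R (0 : R)^'+ (fun delta x => forall y, y \in `[0, T] ->
    `|x - y| < delta -> `|b x - b y| < e) _).
case.
  move=> x Kx.
  have /cvgrPdist_lt/(_ (e / 2)) := cb x Kx.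
  rewrite divr_gt0// => /(_ isT)[r /= r0 Hr].
  exists (ball x (r / 2), [set delta : R | 0 < delta < r / 2]).
    split => /=; first by apply: nbhsx_ballx; rewrite divr_gt0.
    exists (r / 2); first by rewrite /= divr_gt0.
    by move=> z /= + z0; rewrite sub0r normrN gtr0_norm// z0 => ->.
  move=> [x' delta] [/= xx' /andP[d0 dr]] Kx' y Ky xy.
  have h1 : `|b x - b x'| < e / 2.
    apply: Hr => //; rewrite /ball/= in xx'; apply: lt_trans xx' _.
    by rewrite ltr_pdivrMr// ltr_pMr// ltr1n.
  have h2 : `|b x - b y| < e / 2.
    apply: Hr => //; rewrite /ball/= in xx'.
    suff : `|x - y| < r by [].
    rewrite (_ : x - y = (x - x') + (x' - y)); last by ring.
    apply: le_lt_trans (ler_normD _ _) _.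
    rewrite [r]splitr; apply: ltrD => //; exact: lt_trans dr.
  rewrite (_ : b x' - b y = - (b x - b x') + (b x - b y)); last by ring.
  apply: le_lt_trans (ler_normD _ _) _; rewrite normrN [e]splitr.
  exact: ltrD.
move=> r /= r0 Hr; exists (r / 2); first by rewrite divr_gt0.
move=> x y Kx Ky xy; apply: (Hr (r / 2)) => //=.
- rewrite sub0r normrN gtr0_norm ?divr_gt0//.
  by rewrite ltr_pdivrMr// ltr_pMr// ltr1n.
- by rewrite divr_gt0.
Qed.

Lemma Rintegral_derive (G g : R -> R) (p q : R) : p <= q ->
  (forall x : R, is_derive x 1 G (g x)) -> continuous g ->
  \int[mu]_(s in `[p, q]) g s = G q - G p.
Proof.
rewrite le_eqVlt => /predU1P[<- _ _|pq dG cg].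
  by rewrite subrr set_itv1 Rintegral_set1.
have cG : continuous G.
  by move=> x; apply/differentiable_continuous/derivable1_diffP; case: (dG x).
rewrite /Rintegral (@continuous_FTC2 _ g G)//.
- exact: continuous_subspaceT.
- split; first by move=> x _; case: (dG x).
    exact/cvg_at_right_filter/cG.
  exact/cvg_at_left_filter/cG.
- by move=> x _; rewrite derive1E; case: (dG x).
Qed.

Lemma Rintegral_le_bound g (p q K : R) : p <= q ->
  mu.-integrable `[p, q] (EFin \o g) ->
  (forall s, s \in `[p, q] -> `|g s| <= K) ->
  `|\int[mu]_(s in `[p, q]) g s| <= K * (q - p).
Proof.
move=> pq ig gK; apply: le_trans (le_normr_Rintegral _ ig) _ => //.
have -> : K * (q - p) = \int[mu]_(s in `[p, q]) (fun=> K) s.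
  rewrite Rintegral_cst//=; congr (_ * _).
  rewrite lebesgue_measure_itv/= lte_fin; case: ltP => //= qp.
  by apply/eqP; rewrite subr_eq0 eq_le pq qp.
apply: le_Rintegral => //.
- exact: integrable_norm.
- apply: continuous_compact_integrable; first exact: segment_compact.
  exact/continuous_subspaceT/cst_continuous.
Qed.

Lemma continuous_expRM (k : R) : continuous (fun x => expR (k * x) : R).
Proof.
move=> x; apply: continuous_comp; last exact: continuous_expR.
by apply: cvgM; [exact: cvg_cst|exact: cvg_id].
Qed.

Lemma is_derive_expRM (k x : R) :
  is_derive x 1 (fun x => expR (k * x)) (k * expR (k * x)).
Proof. by apply: is_derive_eq; rewrite /GRing.scale/=; ring. Qed.

Lemma continuous_integrable (g : R -> R) (p q : R) : {within `[p, q], continuous g} ->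
  mu.-integrable `[p, q] (EFin \o g).
Proof.
move=> cg; apply: continuous_compact_integrable => //.
exact: segment_compact.
Qed.

Lemma expRM_bound (k T s : R) : 0 <= s -> s <= T ->
  `|k * expR (k * s)| <= `|k| * expR (`|k| * T).
Proof.
move=> s0 sT; rewrite normrM ler_wpM2l// ger0_norm ?expR_ge0// ler_expR.
apply: le_trans (ler_norm _) _; rewrite normrM ler_wpM2l//.
by rewrite ger0_norm.
Qed.

Lemma expRM_lipschitz (k T p q : R) : 0 <= p -> p <= q -> q <= T ->
  `|expR (k * q) - expR (k * p)| <= `|k| * expR (`|k| * T) * (q - p).
Proof.
move=> p0 pq qT.
have cg : continuous (fun s => k * expR (k * s)).
  by move=> x; apply: cvgM; [exact: cvg_cst|exact: continuous_expRM].
rewrite -(Rintegral_derive pq (is_derive_expRM k) cg).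
apply: Rintegral_le_bound => //.
  exact/continuous_integrable/continuous_subspaceT.
move=> s; rewrite in_itv/= => /andP[ps sq]; apply: expRM_bound.
  exact: le_trans ps.
exact: le_trans qT.
Qed.

(** The shared principle of the two limits below: errors on the subintervals, each small compared
    with the increment of [V], add up to an error small compared with the total increment. [V] is
    time for the first limit and the integral of [|h|] for the second. *)
Lemma telescope_le (n : nat) (p : nat -> R) (Phi V : R -> R) (g : nat -> R) (e : R) :
  (forall i, (i < n)%N ->
    `|Phi (p i.+1) - Phi (p i) - g i| <= e * (V (p i.+1) - V (p i))) ->
  `|Phi (p n) - Phi (p 0%N) - \sum_(i < n) g i| <= e * (V (p n) - V (p 0%N)).
Proof.
elim: n => [|n ih] H; first by rewrite big_ord0 !subrr normr0 mulr0.
rewrite big_ord_recr/=.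
have -> : Phi (p n.+1) - Phi (p 0%N) - (\sum_(i < n) g i + g n) =
   (Phi (p n.+1) - Phi (p n) - g n) + (Phi (p n) - Phi (p 0%N) - \sum_(i < n) g i).
  by ring.
apply: le_trans (ler_normD _ _) _.
have := H n (ltnSn n); have := ih (fun i lt_in => H i (ltnW lt_in)).
by rewrite !mulrBr; lra.
Qed.

Lemma Rintegral_split h (x y : R) : 0 <= x -> x <= y ->
  mu.-integrable `[0, y] (EFin \o h) ->
  \int[mu]_(s in `[0, y]) h s - \int[mu]_(s in `[0, x]) h s =
  \int[mu]_(s in `[x, y]) h s.
Proof.
move=> x0 xy ih; rewrite Rintegral_itvB ?bnd_simp//.
rewrite Rintegral_itv_obnd_cbnd//.
apply: integrableS ih => //.
by move=> s /=; rewrite !in_itv/= => /andP[xs ->]; rewrite andbT (le_trans x0)// ltW.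
Qed.

Lemma integrable_subitv h (x y T : R) : 0 <= x -> y <= T ->
  mu.-integrable `[0, T] (EFin \o h) -> mu.-integrable `[x, y] (EFin \o h).
Proof.
move=> x0 yT; apply: integrableS; [exact: measurable_itv|exact: measurable_itv|].
move=> s /=; rewrite !in_itv/= => /andP[xs sy].
by rewrite (le_trans x0 xs) (le_trans sy yT).
Qed.

Lemma integrable_expRM_mul (k T : R) h : mu.-integrable `[0, T] (EFin \o h) ->
  mu.-integrable `[0, T] (EFin \o (fun s => expR (k * s) * h s)).
Proof.
move=> ih.
have mh : measurable_fun `[0, T] h by have /integrableP[/measurable_EFinP] := ih.
have := integrable_scale (expR (`|k| * T)) _ (integrable_norm ih).
move=> /(_ (measurable_itv _)); apply: le_integrable => //.
  apply/measurable_EFinP; apply: measurable_funM => //.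
  by apply: measurable_funTS; exact: measurable_expRM.
move=> s; rewrite /= in_itv/= => /andP[s0 sT]; rewrite lee_fin !normrM normr_id.
rewrite ler_wpM2r// (ger0_norm (expR_ge0 _)) (ger0_norm (expR_ge0 _)) ler_expR.
by apply: le_trans (ler_norm _) _; rewrite normrM ler_wpM2l// ger0_norm.
Qed.

Variable T : R.
Hypothesis T0 : 0 < T.

(** The [n]-th partition has [n + 1] equal intervals, so it is proper also for [n = 0]. *)
Definition knot (n i : nat) : R := i%:R * T / n.+1%:R.

Lemma knot0 n : knot n 0 = 0.
Proof. by rewrite /knot !mul0r. Qed.

Lemma knot_last n : knot n n.+1 = T.
Proof. by rewrite /knot mulrAC divff ?mul1r// pnatr_eq0. Qed.

Lemma knotS n i : knot n i.+1 - knot n i = T / n.+1%:R.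
Proof. by rewrite /knot -!mulrBl -natrB// subSnn mul1r. Qed.

Lemma knot_ge0 n i : 0 <= knot n i.
Proof. by rewrite /knot divr_ge0// mulr_ge0// ltW. Qed.

Lemma knot_leS n i : knot n i <= knot n i.+1.
Proof. by rewrite -subr_ge0 knotS divr_ge0// ltW. Qed.

Lemma knot_le_last n i : (i <= n.+1)%N -> knot n i <= T.
Proof.
move=> iN; rewrite /knot ler_pdivrMr ?ltr0n// mulrC ler_pM2l//.
by rewrite ler_nat.
Qed.

Lemma mesh_cvg : T / n.+1%:R @[n --> \oo] --> (0 : R).
Proof.
rewrite -[X in _ --> X](mulr0 T); apply: cvgM; first exact: cvg_cst.
exact: cvg_harmonic.
Qed.

(** These are Riemann-Stieltjes sums for the integral of [exp (k * s)] against [b], and the limit is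
    written by parts since [b] is merely continuous. On one interval [[q', q]] the error is exactly
    the integral of [k * exp (k * s) * (b q - b s)], which the modulus of continuity of [b]
    controls. *)
Lemma cvg_sum_increments (k : R) b (t : R) : 0 <= t -> t <= T ->
  {within `[0, T], continuous b} ->
  \sum_(i < n.+1) expR (k * knot n i) *
    (b (Num.min (knot n i.+1) t) - b (Num.min (knot n i) t)) @[n --> \oo] -->
  expR (k * t) * b t - b 0 - \int[mu]_(s in `[0, t]) (k * expR (k * s) * b s).
Proof.
move=> t0 tT cb.
pose G s := k * expR (k * s) * b s.
have ck : continuous (fun s => k * expR (k * s)).
  by move=> x; apply: cvgM; [exact: cvg_cst|exact: continuous_expRM].
have cG : {within `[0, T], continuous G}.
  move=> x; apply: cvgM; last exact: cb.
  exact: (@continuous_subspaceT _ _ `[0, T] _ ck).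
have iG := continuous_integrable cG.
pose Phi x := expR (k * x) * b x - \int[mu]_(s in `[0, x]) G s.
pose p n i := Num.min (knot n i) t.
have p0 n : p n 0%N = 0 by rewrite /p knot0; apply/min_idPl.
have pn n : p n n.+1 = t by rewrite /p knot_last; apply/min_idPr.
have pS n i : p n i <= p n i.+1.
  by rewrite /p le_min !ge_min lexx orbT knot_leS.
have pge n i : 0 <= p n i by rewrite /p le_min knot_ge0.
have ple n i : p n i <= T by rewrite /p ge_min tT orbT.
have pm n i : p n i.+1 - p n i <= T / n.+1%:R.
  rewrite -(knotS n i) /p; have h := knot_leS n i.
  by case: (leP (knot n i.+1) t) => ?; case: (leP (knot n i) t) => ?; lra.
apply/cvgrPdist_le => e e0.
pose K := `|k| * expR (`|k| * T).
have K0 : 0 <= K by rewrite mulr_ge0// expR_ge0.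
(* The total error is at most [K * T] times this quantity, hence at most [e]; the summand 1 covers
   [k = 0]. *)
have e1 : 0 < e / (K * T + 1) by rewrite divr_gt0// ltr_wpDl// mulr_ge0// ltW.
have [delta d0 Hd] := uniform_continuity_itv e1 cb.
have /cvgrPdist_lt/(_ _ d0) := mesh_cvg.
apply: filterS => n; rewrite sub0r normrN => Hn.
have mesh : T / n.+1%:R < delta by exact: le_lt_trans (ler_norm _) Hn.
have PhiE : expR (k * t) * b t - b 0 - \int[mu]_(s in `[0, t]) G s =
    Phi (p n n.+1) - Phi (p n 0%N).
  rewrite pn p0 /Phi set_itv1 Rintegral_set1 mulr0 expR0 mul1r subr0.
  by rewrite addrAC.
rewrite -/(G _) PhiE.
have -> : \sum_(i < n.+1) expR (k * knot n i) *
    (b (Num.min (knot n i.+1) t) - b (Num.min (knot n i) t)) =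
    \sum_(i < n.+1) expR (k * p n i) * (b (p n i.+1) - b (p n i)).
  (* For a knot beyond [t] both cut points equal [t] and the increment vanishes, so the point at
     which the exponential is evaluated is immaterial. *)
  apply: eq_bigr => i _; rewrite /p; case: (leP (knot n i) t) => // h.
  by rewrite (min_idPr _) ?subrr ?mulr0// (le_trans (ltW h))// knot_leS.
pose V : R -> R := idfun.
apply: le_trans (@telescope_le n.+1 (p n) Phi V
  (fun i => expR (k * p n i) * (b (p n i.+1) - b (p n i)))
  (K * (e / (K * T + 1))) _) _; last first.
  rewrite /V/= pn p0 subr0.
  have -> : K * (e / (K * T + 1)) * t = (K * t) / (K * T + 1) * e.
    by field; rewrite gt_eqF// ltr_wpDl// mulr_ge0// ltW.
  rewrite ler_piMl ?(ltW e0)// ler_pdivrMr ?mul1r; last first.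
    by rewrite ltr_wpDl// mulr_ge0// ltW.
  by rewrite ler_wpDr// ler_wpM2l.
move=> i _; rewrite /V/=; set q := p n i.+1; set q' := p n i.
have q'q : q' <= q by exact: pS.
have iGq : mu.-integrable `[q', q] (EFin \o G).
  exact: (integrable_subitv (pge n i) (ple n i.+1) iG).
have ikq : mu.-integrable `[q', q] (EFin \o (fun s => k * expR (k * s) * b q)).
  apply/continuous_integrable/continuous_subspaceT => x.
  by apply: cvgM; [exact: ck|exact: cvg_cst].
have ikq0 : mu.-integrable `[q', q] (EFin \o (fun s => k * expR (k * s))).
  exact/continuous_integrable/continuous_subspaceT.
have -> : Phi q - Phi q' - expR (k * q') * (b q - b q') =
    \int[mu]_(s in `[q', q]) (k * expR (k * s) * b q - G s).
  rewrite RintegralB// RintegralZr//.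
  rewrite (Rintegral_derive q'q (is_derive_expRM k) ck).
  rewrite -(Rintegral_split (pge n i) q'q); last first.
    exact: (integrable_subitv (lexx 0) (ple n i.+1) iG).
  by rewrite /Phi; ring.
apply: Rintegral_le_bound => //.
  by have := integrableB _ ikq iGq; apply.
move=> s; rewrite in_itv/= => /andP[qs sq].
have s0 : 0 <= s by exact: le_trans (pge n i) qs.
have sT : s <= T by exact: le_trans sq (ple n i.+1).
rewrite /G -mulrBr normrM; apply: ler_pM => //; first exact: expRM_bound.
apply/ltW/Hd.
- by rewrite in_itv/= pge ple.
- by rewrite in_itv/= s0.
- rewrite ger0_norm ?subr_ge0//; apply: le_lt_trans mesh.
  by apply: le_trans (pm n i); rewrite lerB.
Qed.

(** Freezing [exp (k * s)] at the left end of an interval costs at most the Lipschitz constant [K]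
    times the mesh times the integral of [|h|] over that interval. *)
Lemma cvg_sum_integrals (k : R) h : mu.-integrable `[0, T] (EFin \o h) ->
  \sum_(i < n.+1) expR (k * knot n i) *
    (\int[mu]_(s in `[0, knot n i.+1]) h s - \int[mu]_(s in `[0, knot n i]) h s)
    @[n --> \oo] -->
  \int[mu]_(s in `[0, T]) (expR (k * s) * h s).
Proof.
move=> ih.
pose G s := expR (k * s) * h s.
have iG : mu.-integrable `[0, T] (EFin \o G) by exact: integrable_expRM_mul.
pose K := `|k| * expR (`|k| * T).
pose V x := \int[mu]_(s in `[0, x]) `|h s|.
have cv : K * (T / n.+1%:R) * V T @[n --> \oo] --> (0 : R).
  rewrite -[X in _ --> X](mul0r (V T)); apply: cvgM; last exact: cvg_cst.
  rewrite -[X in _ --> X](mulr0 K); apply: cvgM; first exact: cvg_cst.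
  exact: mesh_cvg.
apply/subr_cvg0/norm_cvg0P.
apply: (squeeze_cvgr _ (cvg_cst 0) cv); apply: nearW => n.
rewrite normr_ge0/= distrC.
pose Phi x := \int[mu]_(s in `[0, x]) G s.
have PhiE : \int[mu]_(s in `[0, T]) (expR (k * s) * h s) =
    Phi (knot n n.+1) - Phi (knot n 0%N).
  by rewrite knot_last knot0 /Phi set_itv1 Rintegral_set1 subr0.
rewrite PhiE.
apply: le_trans (@telescope_le n.+1 (knot n) Phi V
  (fun i => expR (k * knot n i) * (\int[mu]_(s in `[0, knot n i.+1]) h s -
    \int[mu]_(s in `[0, knot n i]) h s)) (K * (T / n.+1%:R)) _) _; last first.
  by rewrite knot_last knot0 [V 0]/V set_itv1 Rintegral_set1 subr0.
move=> i iN; set q := knot n i.+1; set q' := knot n i.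
have q0 : 0 <= q' by exact: knot_ge0.
have q'q : q' <= q by exact: knot_leS.
have qT : q <= T by exact: knot_le_last.
have sub (g : R -> R) : mu.-integrable `[0, T] (EFin \o g) ->
    mu.-integrable `[q', q] (EFin \o g).
  by move=> ig; exact: integrable_subitv ig.
have sub0 (g : R -> R) : mu.-integrable `[0, T] (EFin \o g) ->
    mu.-integrable `[0, q] (EFin \o g).
  by move=> ig; exact: integrable_subitv ig.
have inh : mu.-integrable `[0, T] (EFin \o (fun s => `|h s|)).
  exact: integrable_norm.
rewrite /Phi /V !Rintegral_split//; try exact: sub0.
rewrite -RintegralZl//; last exact: sub.
have isc : mu.-integrable `[q', q] (EFin \o (fun s => expR (k * q') * h s)).
  by apply: integrable_scale => //; exact: sub.
rewrite -RintegralB//; last exact: sub.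
rewrite -RintegralZl//; last exact: sub.
have iD : mu.-integrable `[q', q] (EFin \o (fun s => G s - expR (k * q') * h s)).
  by have := integrableB _ (sub _ iG) isc; apply.
apply: le_trans (le_normr_Rintegral _ iD) _ => //.
apply: le_Rintegral => //.
- exact: integrable_norm.
- by apply: integrable_scale => //; exact: sub.
move=> s; rewrite /= in_itv/= => /andP[qs sq].
rewrite /G -mulrBl normrM ler_wpM2r//.
apply: le_trans (expRM_lipschitz k q0 qs (le_trans sq qT)) _.
rewrite ler_wpM2l// ?mulr_ge0 ?expR_ge0//.
by rewrite -(knotS n i) lerB.
Qed.

End PathwiseSums.

(** * The budget identity and uniqueness of the terminal fund *)

Section FundProcess.
Context {R : realType} {d : measure_display} {Omega : measurableType d}.
Variables (P : probability Omega R) (T : R).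
Hypothesis T0 : 0 < T.
Variables (F : R -> set (set Omega)) (B : R -> Omega -> R).
Hypothesis hF : complete_filtration P T F.
Hypothesis hB : brownian_motion P T F B.
Variables (r v sigma x2 : R).
Hypothesis sigma0 : 0 < sigma.
Local Notation mu := (@lebesgue_measure R).
Variables (I : R -> Omega -> R) (C : R -> R).
Hypothesis hadm : admissible P T F I C.

Let theta := v / sigma.
Let J (s : R) w := sigma * I s w.

Lemma sum_by_parts (n : nat) (f a : nat -> R) :
  \sum_(i < n) f i * (a i.+1 - a i) =
  f n * a n - f 0%N * a 0%N - \sum_(i < n) (f i.+1 - f i) * a i.+1.
Proof.
elim: n => [|n ih]; first by rewrite !big_ord0 subrr subr0.
by rewrite !big_ord_recr/= ih; ring.
Qed.

(** The triangle inequality of L^2 in squared form: [E (Y i + Y j) ^ 2] and [E (Y i - Y j) ^ 2]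
    being nonnegative, every mixed moment lies between [- K] and [K]. *)
Lemma mean_wsum_sqr_le (n : nat) (c : 'I_n -> R) (Y : 'I_n -> Omega -> R) (K : R) :
  (forall i, L2 P (Y i)) -> (forall i, mean P (fun w => Y i w ^+ 2) <= K) ->
  mean P (fun w => (\sum_i c i * Y i w) ^+ 2) <= (\sum_i `|c i|) ^+ 2 * K.
Proof.
move=> Y2 YK.
have YY i j : mean P (fun w => Y i w * Y j w) <= K /\ - K <= mean P (fun w => Y i w * Y j w).
  have h1 : 0 <= mean P (fun w => (Y i w - Y j w) ^+ 2).
    by apply: mean_ge0 => w; exact: sqr_ge0.
  have h2 : 0 <= mean P (fun w => (Y i w - - Y j w) ^+ 2).
    by apply: mean_ge0 => w; exact: sqr_ge0.
  rewrite mean_sqrB// in h1; rewrite (mean_sqrB (Y2 i) (L2N (Y2 j))) in h2.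
  have e1 : mean P (fun w => (- Y j w) ^+ 2) = mean P (fun w => Y j w ^+ 2).
    by apply: eq_mean => w; rewrite sqrrN.
  have e2 : mean P (fun w => Y i w * - Y j w) = - mean P (fun w => Y i w * Y j w).
    rewrite -mulN1r -meanZ; last exact: L2M.
    by apply: eq_mean => w; ring.
  rewrite e1 e2 in h2; have := YK i; have := YK j.
  move: h1 h2; move: (mean _ _) (mean _ _) (mean _ _) => y1 y2 y3 ? ? ? ?.
  by split; lra.
have -> : (fun w => (\sum_i c i * Y i w) ^+ 2) =
    (fun w => \sum_i \sum_j c i * c j * (Y i w * Y j w)).
  apply/funext => w; rewrite expr2 mulr_suml; apply: eq_bigr => i _.
  by rewrite mulr_sumr; apply: eq_bigr => j _; ring.
have iL i j : L1 P (fun w => c i * c j * (Y i w * Y j w)) by exact/L1Z/L2M.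
rewrite mean_sum; last by move=> i; apply: L1_sum.
rewrite expr2 mulr_suml mulr_suml; apply: ler_sum => i _.
rewrite mean_sum// mulr_sumr mulr_suml; apply: ler_sum => j _.
rewrite meanZ; last exact: L2M.
apply: le_trans (ler_norm _) _; rewrite !normrM ler_wpM2l ?mulr_ge0//.
by rewrite ler_norml; have [-> ->] := YY i j.
Qed.

Lemma energyZ (c : R) (Phi : R -> Omega -> R) : jointly_measurable T Phi ->
  (energy P T Phi < +oo)%E -> (energy P T (fun s w => (c * Phi s w)%R) < +oo)%E.
Proof.
move=> mPhi Phi2.
have -> : energy P T (fun s w => c * Phi s w) = ((c ^+ 2)%:E * energy P T Phi)%E.
  rewrite /energy -ge0_integralZl//.
  - apply: eq_integral => w _; rewrite -ge0_integralZl//.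
    + by apply: eq_integral => s _; rewrite exprMn EFinM.
    + exact: (path_measurable_sqr w mPhi).
    + by move=> s _; rewrite lee_fin sqr_ge0.
    + by rewrite lee_fin sqr_ge0.
  - exact: (measurable_path_energy (lexx T) mPhi).
  - by move=> w _; apply: integral_ge0 => s _; rewrite lee_fin sqr_ge0.
  - by rewrite lee_fin sqr_ge0.
by apply: lte_mul_pinfty => //; rewrite lee_fin sqr_ge0.
Qed.

Lemma investment_measurable : jointly_measurable T I.
Proof. by have [[]] := hadm. Qed.

Lemma investment_energy : (energy P T I < +oo)%E.
Proof. by have [[]] := hadm. Qed.

Lemma consumption_integrable : mu.-integrable `[0, T] (EFin \o C).
Proof. by have [] := hadm. Qed.

Let mJ : jointly_measurable T J.
Proof. exact: jointly_measurableZ investment_measurable. Qed.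

Let J2 : (energy P T J < +oo)%E.
Proof. exact: energyZ investment_measurable investment_energy. Qed.

(* With [theta = v / sigma] and [J = sigma * I], the term [theta * J] is the excess
   return [v * I]. Along a solution [X], the differential of [cumulative M] is
   [dX - r * X dt], and the sums below converge to the integral of
   [exp (- r * t) * (dX - r * X dt) = d (exp (- r * t) * X)]. *)
Definition cumulative (M : R -> Omega -> R) (t : R) w : R :=
  x2 + theta * \int[mu]_(s in `[0, t]) J s w - \int[mu]_(s in `[0, t]) C s + M t w.

Definition discounted_sum (M : R -> Omega -> R) (n : nat) w : R :=
  \sum_(i < n.+1) expR (- r * knot T n i) *
    (cumulative M (knot T n i.+1) w - cumulative M (knot T n i) w).

Section WithIto.
Variable M : R -> Omega -> R.
Hypothesis hM : is_ito_integral P T F B J M.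

Lemma cumulative_L2 (t : R) : 0 <= t -> t <= T -> L2 P (cumulative M t).
Proof.
move=> t0 tT; have [H [_ _ hL _]] := ito_approx hF hB hM.
apply: L2D; last exact: hL.
apply: L2B; last exact: L2_cst.
apply: L2D; first exact: L2_cst.
by apply: L2Z; have [] := L2_path_integral T0 t0 tT mJ J2.
Qed.

Lemma cumulative_bounded : exists K : R, forall t : R, 0 <= t -> t <= T ->
  mean P (fun w => cumulative M t w ^+ 2) <= K.
Proof.
have [K hK] := ito_bounded T0 hF hB mJ J2 hM.
have iC := consumption_integrable.
pose c := \int[mu]_(s in `[0, T]) `|C s|.
exists (2 * (2 * ((`|x2| + c) ^+ 2 + theta ^+ 2 * (T * fine (energy P T J))) + K)) => t t0 tT.
have [H [_ _ hL _]] := ito_approx hF hB hM.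
have M2 := hL t t0 tT.
have [I2 IK] := L2_path_integral T0 t0 tT mJ J2.
pose k := x2 - \int[mu]_(s in `[0, t]) C s.
have -> : cumulative M t = (fun w => (k + theta * \int[mu]_(s in `[0, t]) J s w) + M t w).
  by apply/funext => w; rewrite /cumulative /k; ring.
have h1 := mean_sqrD_le (L2D (L2_cst P k) (L2Z theta I2)) M2.
have h2 := mean_sqrD_le (L2_cst P k) (L2Z theta I2).
rewrite mean_cst in h2.
have h3 : mean P (fun w => (theta * \int[mu]_(s in `[0, t]) J s w) ^+ 2) =
    theta ^+ 2 * mean P (fun w => (\int[mu]_(s in `[0, t]) J s w) ^+ 2).
  by rewrite -meanZ; [apply: eq_mean => w; rewrite exprMn|exact: I2.2].
have h4 : theta ^+ 2 * mean P (fun w => (\int[mu]_(s in `[0, t]) J s w) ^+ 2) <=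
    theta ^+ 2 * (T * fine (energy P T J)) by rewrite ler_wpM2l ?sqr_ge0.
have h5 : k ^+ 2 <= (`|x2| + c) ^+ 2.
  rewrite -[k ^+ 2]real_normK ?num_real// ler_sqr ?nnegrE ?addr_ge0//; last first.
    exact: Rintegral_ge0.
  apply: le_trans (ler_normB _ _) _; rewrite lerD2l.
  have sub : `[0, t] `<=` (`[0, T] : set R).
    by move=> s /=; rewrite !in_itv/= => /andP[-> h]; exact: le_trans h tT.
  have iCt := integrable_subitv (lexx 0) tT iC.
  apply: le_trans (le_normr_Rintegral _ iCt) _ => //.
  rewrite /c /Rintegral fine_le//.
  - by apply: integrable_fin_num => //; exact: (integrable_norm iCt).
  - by apply: integrable_fin_num => //; exact: (integrable_norm iC).
  - apply: ge0_subset_integral => //.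
    by have /integrableP[+ _] := integrable_norm iC.
have := hK t t0 tT.
by rewrite h3 in h2; lra.
Qed.

Lemma discounted_sum_L2 n : L2 P (discounted_sum M n).
Proof.
apply: L2_sum => i; apply: L2Z; apply: L2B; apply: cumulative_L2;
  try exact: knot_ge0; apply: knot_le_last => //; exact: ltnW.
Qed.

(* Summation by parts: [exp (- r * t)] has bounded variation and [cumulative M] is
   bounded in L^2; the L^2 norms of the increments are not summable uniformly in
   [n]. *)
Lemma discounted_sum_bounded : exists K : R, forall n,
  mean P (fun w => discounted_sum M n w ^+ 2) <= K.
Proof.
have [K hK] := cumulative_bounded.
have K0 : 0 <= K.
  apply: le_trans (hK 0 (lexx 0) (ltW T0)); apply: mean_ge0 => w; exact: sqr_ge0.
(* A Lipschitz constant of [exp (- r * t)] on [[0, T]]; [E * T] then bounds its total variation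
   along the knots, whatever [n] is. *)
pose E := `|r| * expR (`|r| * T).
have E0 : 0 <= E by rewrite mulr_ge0 ?expR_ge0.
exists (2 * (2 * (expR (- r * T) ^+ 2 * K + K) + (E * T) ^+ 2 * K)) => n.
pose f i := expR (- r * knot T n i).
pose a w i := cumulative M (knot T n i) w.
have A2 i : (i <= n.+1)%N -> L2 P (a ^~ i).
  by move=> iN; apply: cumulative_L2; [exact: knot_ge0|exact: knot_le_last].
have AK i : (i <= n.+1)%N -> mean P (fun w => a w i ^+ 2) <= K.
  by move=> iN; apply: hK; [exact: knot_ge0|exact: knot_le_last].
have -> : discounted_sum M n = (fun w => (f n.+1 * a w n.+1 + - f 0%N * a w 0%N) +
    \sum_(i < n.+1) (- (f i.+1 - f i)) * a w i.+1).
  apply/funext => w; rewrite /discounted_sum (sum_by_parts n.+1 f (a w)).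
  by rewrite mulNr -sumrN; congr (_ + _); apply: eq_bigr => i _; rewrite mulNr.
have L1' := L2Z (f n.+1) (A2 n.+1 (leqnn _)).
have L2' := L2Z (- f 0%N) (A2 0%N isT).
have A2' (i : 'I_n.+1) : L2 P (a ^~ i.+1) by exact: A2.
have L3 : L2 P (fun w => \sum_(i < n.+1) (- (f i.+1 - f i)) * a w i.+1).
  by apply: L2_sum => i; apply: L2Z; exact: A2'.
apply: le_trans (mean_sqrD_le (L2D L1' L2') L3) _.
rewrite ler_pM2l//; apply: lerD.
  apply: le_trans (mean_sqrD_le L1' L2') _; rewrite ler_pM2l//; apply: lerD.
    under [X in mean P X <= _]eq_fun do rewrite exprMn.
    rewrite meanZ; last exact: (A2 n.+1 (leqnn _)).2.
    by rewrite /f knot_last// ler_wpM2l ?sqr_ge0//; exact: AK.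
  under [X in mean P X <= _]eq_fun do rewrite exprMn.
  rewrite meanZ; last exact: (A2 0%N isT).2.
  by rewrite /f knot0 mulr0 expR0 sqrrN expr1n mul1r; exact: AK.
apply: le_trans (mean_wsum_sqr_le (K := K) _ A2' _) _.
  by move=> i; exact: AK.
rewrite ler_wpM2r// ler_sqr ?nnegrE ?sumr_ge0 ?mulr_ge0 ?(ltW T0)//.
apply: (@le_trans _ _ (\sum_(i < n.+1) E * (T / n.+1%:R))).
  apply: ler_sum => i _; rewrite normrN -(knotS T n i) /E -(normrN r).
  by apply: expRM_lipschitz; [exact: knot_ge0|exact: knot_leS|exact: knot_le_last].
rewrite sumr_const card_ord -mulrnAr -mulr_natr.
by rewrite divfK// pnatr_eq0.
Qed.

(** The drift [theta * J] cancels against the drift [- theta * J] that the weight gives to the Ito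
    integral, so only the initial fund and the deterministic consumption remain. *)
Lemma mean_weight_cumulative (t : R) : 0 <= t -> t <= T ->
  mean P (fun w => weight T B theta w * cumulative M t w) =
  x2 - \int[mu]_(s in `[0, t]) C s.
Proof.
move=> t0 tT; have W2 := weight_L2 T0 hF hB theta.
have [H [_ _ hL _]] := ito_approx hF hB hM.
have M2 := hL t t0 tT.
have [I2 _] := L2_path_integral T0 t0 tT mJ J2.
set k := x2 - _.
transitivity (mean P (fun w => k * weight T B theta w +
  theta * (weight T B theta w * \int[mu]_(s in `[0, t]) J s w) +
  weight T B theta w * M t w)).
  by apply: eq_mean => w; rewrite /cumulative /k; ring.
rewrite meanD; [|by apply: L1D; [exact/L1Z/L2_L1|exact/L1Z/L2M]|exact: L2M].
rewrite meanD; [|exact/L1Z/L2_L1|exact/L1Z/L2M].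
rewrite (meanZ _ (L2_L1 W2)) (meanZ _ (L2M W2 I2)).
rewrite (mean_weight T0 hF hB) (mean_weight_ito T0 hF hB mJ J2 theta hM t0 tT).
by ring.
Qed.

Lemma cvg_mean_weight_discounted_sum :
  mean P (fun w => weight T B theta w * discounted_sum M n w) @[n --> \oo] -->
  - \int[mu]_(s in `[0, T]) (expR (- r * s) * C s).
Proof.
have W2 := weight_L2 T0 hF hB theta.
have -> : (fun n => mean P (fun w => weight T B theta w * discounted_sum M n w)) =
  (fun n => - \sum_(i < n.+1) expR (- r * knot T n i) *
    (\int[mu]_(s in `[0, knot T n i.+1]) C s - \int[mu]_(s in `[0, knot T n i]) C s)).
  apply/funext => n.
  have C2 (i : nat) : (i <= n.+1)%N -> L2 P (cumulative M (knot T n i)).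
    by move=> iN; apply: cumulative_L2; [exact: knot_ge0|exact: knot_le_last].
  transitivity (mean P (fun w => \sum_(i < n.+1) expR (- r * knot T n i) *
     (weight T B theta w * cumulative M (knot T n i.+1) w -
      weight T B theta w * cumulative M (knot T n i) w))).
    apply: eq_mean => w; rewrite /discounted_sum mulr_sumr; apply: eq_bigr => i _.
    by ring.
  have LL (i : 'I_n.+1) : L1 P (fun w => weight T B theta w * cumulative M (knot T n i.+1) w -
      weight T B theta w * cumulative M (knot T n i) w).
    by apply: L1B; apply: L2M => //; apply: C2 => //; exact: ltnW.
  rewrite mean_sum => [|i]; last exact: L1Z.
  rewrite -sumrN; apply: eq_bigr => i _; rewrite meanZ// meanB.
  - rewrite !mean_weight_cumulative; try exact: knot_ge0; try exact: knot_le_last.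
      by ring.
    by apply: knot_le_last => //; exact: ltnW.
  - by apply: L2M => //; exact: C2.
  - by apply: L2M => //; apply: C2; exact: ltnW.
apply: cvgN; apply: cvg_sum_integrals => //.
exact: consumption_integrable.
Qed.

(** At time 0 all cut intervals collapse, so the approximating integrals vanish identically and the
    convergent sequence of mean squares is constant. This recovers the initial condition
    [X 0 = x2]. *)
Lemma ito_at0 : {ae P, forall w, M 0 w = 0}.
Proof.
have [H [hH _ hL hm]] := ito_approx hF hB hM.
have T0' := ltW T0.
apply: mean_sqr_eq0; first exact: hL.
have := hm 0 (lexx 0) T0'.
have -> : (fun n => mean P (fun w => (sp_integral B (H n) 0 w - M 0 w) ^+ 2)) =
    (fun=> mean P (fun w => M 0 w ^+ 2)).
  apply/funext => n; apply: eq_mean => w.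
  rewrite (_ : sp_integral B (H n) 0 w = 0) ?sub0r ?sqrrN//.
  apply: big1 => i _; have [hk _ _ _] := hH n.
  have := hk i (ltnW (ltn_ord i)); have := hk i.+1 (ltn_ord i).
  rewrite !in_itv/= => /andP[h1 _] /andP[h2 _].
  by rewrite (min_idPr h1) (min_idPr h2) increment_id mulr0.
by move=> h; apply: (cvg_unique _ (cvg_cst _) h); exact: Rhausdorff.
Qed.

Lemma cvg_discounted_sum (X : R -> Omega -> R) : continuous_paths P T X ->
  (forall t : R, t \in `[0, T] -> {ae P, forall w, X t w =
     x2 + \int[mu]_(s in `[0, t]) (r * X s w + v * I s w - C s) + M t w}) ->
  {ae P, forall w, discounted_sum M n w @[n --> \oo] --> expR (- r * T) * X T w - x2}.
Proof.
move=> cX hX.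
have hk n i : {ae P, forall w, (i <= n.+1)%N -> X (knot T n i) w =
     x2 + \int[mu]_(s in `[0, knot T n i]) (r * X s w + v * I s w - C s) + M (knot T n i) w}.
  have [iN|iN] := leqP i n.+1; last by apply: aeW => w.
  have kI : knot T n i \in `[0, T] by rewrite in_itv/= knot_ge0 ?knot_le_last.
  by apply: filterS (hX _ kI) => w.
(* The exceptional null set of the fund equation depends on the time; the knots are countably many,
   so one null set serves them all. *)
have hk' : {ae P, forall w, forall n i, (i <= n.+1)%N -> X (knot T n i) w =
     x2 + \int[mu]_(s in `[0, knot T n i]) (r * X s w + v * I s w - C s) + M (knot T n i) w}.
  by apply/ae_foralln => n; apply/ae_foralln => i.
have I0 : (0 : R) \in `[0, T] by rewrite in_itv/= lexx ltW.
have iI := path_integrable_ae investment_measurable investment_energy.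
near=> w.
have cXw : {within `[0, T], continuous (X ^~ w)} by near: w.
have iIw : mu.-integrable `[0, T] (EFin \o (I ^~ w)) by near: w.
have hkw : forall n i, (i <= n.+1)%N -> X (knot T n i) w =
     x2 + \int[mu]_(s in `[0, knot T n i]) (r * X s w + v * I s w - C s) + M (knot T n i) w.
  by near: w.
have X0 : X 0 w = x2.
  have M0 : M 0 w = 0 by near: w; exact: ito_at0.
  have -> : X 0 w = x2 + \int[mu]_(s in `[0, 0]) (r * X s w + v * I s w - C s) + M 0 w.
    by near: w; exact: hX.
  by rewrite M0 set_itv1 Rintegral_set1 !addr0.
have iX := continuous_integrable cXw.
have iC := consumption_integrable.
have EA n (i : nat) : (i <= n.+1)%N -> cumulative M (knot T n i) w =
    X (knot T n i) w - r * \int[mu]_(s in `[0, knot T n i]) X s w.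
  move=> iN; rewrite (hkw n i iN) /cumulative.
  have k0 := knot_ge0 T0 n i; have kT := knot_le_last T0 iN.
  have iX' := integrable_subitv (lexx 0) kT iX.
  have iI' := integrable_subitv (lexx 0) kT iIw.
  have iC' := integrable_subitv (lexx 0) kT iC.
  have irX : mu.-integrable `[0, knot T n i] (EFin \o (fun s => r * X s w)).
    exact: integrable_scale.
  have ivI : mu.-integrable `[0, knot T n i] (EFin \o (fun s => v * I s w)).
    exact: integrable_scale.
  have iXI : mu.-integrable `[0, knot T n i] (EFin \o (fun s => r * X s w + v * I s w)).
    by have := integrableD _ irX ivI; apply.
  rewrite RintegralB// RintegralD// !RintegralZl//.
  by rewrite /theta; field; rewrite gt_eqF.
have -> : (fun n => discounted_sum M n w) = (fun n =>
    \sum_(i < n.+1) expR (- r * knot T n i) *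
      (X (Num.min (knot T n i.+1) T) w - X (Num.min (knot T n i) T) w)
    - r * (\sum_(i < n.+1) expR (- r * knot T n i) *
    (\int[mu]_(s in `[0, knot T n i.+1]) X s w - \int[mu]_(s in `[0, knot T n i]) X s w))).
  apply/funext => n; rewrite mulr_sumr -sumrB; apply: eq_bigr => i _.
  have i1 := ltn_ord i.
  rewrite EA// EA; last exact: ltnW.
  rewrite (min_idPl (knot_le_last T0 i1)) (min_idPl (knot_le_last T0 (ltnW i1))).
  by ring.
have c1 := cvg_sum_increments (k := - r) T0 (ltW T0) (lexx T) cXw.
have c2 := cvg_sum_integrals T0 (k := - r) iX.
have c := cvgB c1 (cvgM (cvg_cst r) c2).
(* The integral left by summation by parts of [X] cancels against the limit of the sums that carry
   [r * X]. *)
suff E : expR (- r * T) * X T w - X 0 w -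
    \int[mu]_(s in `[0, T]) (- r * expR (- r * s) * X s w) -
    r * \int[mu]_(s in `[0, T]) (expR (- r * s) * X s w) =
    expR (- r * T) * X T w - x2 by rewrite -E; exact: c.
have -> : \int[mu]_(s in `[0, T]) (- r * expR (- r * s) * X s w) =
    - r * \int[mu]_(s in `[0, T]) (expR (- r * s) * X s w).
  rewrite -RintegralZl//.
    by apply: eq_Rintegral => s _; rewrite mulrA.
  have ce : {within `[0, T], continuous (fun s => expR (- r * s) : R)}.
    by apply: continuous_subspaceT => x; exact: continuous_expRM.
  apply: continuous_integrable => x; apply: cvgM; last exact: cXw.
  exact: ce.
by rewrite X0; ring.
Unshelve. all: by end_near. Qed.

End WithIto.

(** The discounted sums converge almost surely and are bounded in L^2. Fatou gives the first claim;
    convergence of the pairings with the weight, computed in two ways, gives the second. *)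
Lemma discounted_fund_weight (X : R -> Omega -> R) :
  fund_process P T F B r v sigma x2 I C X ->
  L2 P (fun w => expR (- r * T) * X T w - x2) /\
  mean P (fun w => weight T B theta w * (expR (- r * T) * X T w - x2)) =
  - \int[mu]_(s in `[0, T]) (expR (- r * s) * C s).
Proof.
move=> [aX cX [M hM hX]].
have W2 := weight_L2 T0 hF hB theta.
have mX : measurable_fun setT (fun w => expR (- r * T) * X T w - x2).
  apply: measurable_funB => //; apply: measurable_funM => //.
  apply: (filtration_measurable hF (ltW T0) (lexx T)).
  by apply: aX; rewrite in_itv/= lexx ltW.
have [K hK] := discounted_sum_bounded hM.
have c := cvg_discounted_sum hM cX hX.
split; first by have [] := fatou_sqr (discounted_sum_L2 hM) mX hK c.
have c1 := cvg_meanM_ae (discounted_sum_L2 hM) mX W2 hK c.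
by apply: (cvg_unique _ c1 (cvg_mean_weight_discounted_sum hM)); exact: Rhausdorff.
Qed.

(** No Gronwall argument is involved: both terminal funds are read off from limits of discounted
    sums, and these agree because the two versions of the Ito integral agree at all knots. *)
Lemma fund_process_unique (X X' : R -> Omega -> R) :
  fund_process P T F B r v sigma x2 I C X ->
  fund_process P T F B r v sigma x2 I C X' ->
  {ae P, forall w, X T w = X' T w}.
Proof.
move=> [aX cX [M hM hX]] [aX' cX' [M' hM' hX']].
have c := cvg_discounted_sum hM cX hX.
have c' := cvg_discounted_sum hM' cX' hX'.
have MM : {ae P, forall w, forall n i, (i <= n.+1)%N -> M (knot T n i) w = M' (knot T n i) w}.
  apply/ae_foralln => n; apply/ae_foralln => i.
  have [iN|iN] := leqP i n.+1; last by apply: aeW => w.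
  have h := ito_unique hF hB mJ hM hM' (knot_ge0 T0 n i) (knot_le_last T0 iN).
  by apply: filterS h => w.
apply: filterS3 c c' MM => w cw cw' MMw.
have E : (fun n => discounted_sum M n w) = (fun n => discounted_sum M' n w).
  apply/funext => n; apply: eq_bigr => i _; rewrite /cumulative.
  by rewrite !MMw//; exact: ltnW.
rewrite E in cw.
have e : expR (- r * T) * X T w - x2 = expR (- r * T) * X' T w - x2.
  by apply: (cvg_unique _ cw cw'); exact: Rhausdorff.
move: e => /(congr1 (fun y => y + x2)); rewrite !subrK.
by move=> /(mulfI (lt0r_neq0 (expR_gt0 _))).
Qed.

End FundProcess.

(** * The stochastic integral of a deterministic exponential *)

Section Candidate.
Context {R : realType} {d : measure_display} {Omega : measurableType d}.
Variables (P : probability Omega R) (T : R).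
Hypothesis T0 : 0 < T.
Variables (F : R -> set (set Omega)) (B : R -> Omega -> R).
Hypothesis hF : complete_filtration P T F.
Hypothesis hB : brownian_motion P T F B.
Local Notation mu := (@lebesgue_measure R).

(** The upper limit is [F t]-measurable and equals [eta] off a null set. Completeness puts every
    subset of that null set in [F t], whatever [eta] does there. *)
Lemma measurable_wrt_ae_limit (t : R) (xi : nat -> Omega -> R) (eta : Omega -> R) :
  0 <= t -> t <= T -> (forall n, measurable_wrt (F t) (xi n)) ->
  {ae P, forall w, xi n w @[n --> \oo] --> eta w} -> measurable_wrt (F t) eta.
Proof.
move=> t0 tT mxi hlim.
have sF := filtration_sigma hF t0 tT.
have neg N : P.-negligible N -> F t N.
  by case: hF => _ _ h1 h2 nN; apply: (h1 0 t) => //; exact: h2.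
pose z w : R := fine (limn_esup (fun n => (xi n w)%:E)).
have mz : measurable_wrt (F t) z.
  apply/(measurable_wrtP _ sF); apply: measurableT_comp => //.
  apply: measurable_fun_limn_esup => n; apply/measurable_EFinP.
  exact/(measurable_wrtP _ sF).
have zE : {ae P, forall w, z w = eta w}.
  apply: filterS hlim => w h; rewrite /z.
  have hE : (xi n w)%:E @[n --> \oo] --> (eta w)%:E.
    by apply: cvg_EFin => //; exact: nearW.
  by have [_ ->] := cvg_limn_einf_sup hE.
have nD : P.-negligible [set w | z w <> eta w] by exact: zE.
have [_ FC FU] := sF.
have FUn A A' : F t A -> F t A' -> F t (A `|` A').
  move=> FA FA'; rewrite -bigcup2E; apply: FU => -[|[|n]] //=.
  by case: sF.
have FI A A' : F t A -> F t A' -> F t (A `&` A').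
  move=> FA FA'; rewrite -[A `&` A']setCK setCI -!setTD.
  by apply: (FC); apply: FUn; exact: FC.
move=> U mU.
have -> : eta @^-1` U = (z @^-1` U `&` ~` [set w | z w <> eta w]) `|`
    (eta @^-1` U `&` [set w | z w <> eta w]).
  apply/seteqP; split => w /=.
    move=> Uw; have [e|ne] := pselect (z w = eta w); last by right.
    by left; split; [rewrite e|move=> /(_ e)].
  by move=> [[+ /contrapT <-]|[]].
apply: FUn; last first.
  by apply: neg; apply: negligibleS nD => w [].
apply: FI; first exact: mz.
by rewrite -setTD; apply: FC; exact: neg.
Qed.

Variables (r c : R).
Let J (s : R) (_ : Omega) : R := c * expR (r * s).
Let H (n : nat) : @simple_process R _ Omega :=
  SimpleProcess n.+1 (knot T n) (fun i _ => c * expR (r * knot T n i)).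

Let H_admissible n : sp_admissible T F (H n).
Proof.
split => /=.
- by move=> i iN; rewrite in_itv/= knot_ge0// knot_le_last.
- by move=> i _; exact: knot_leS.
- move=> i iN; apply: measurable_wrt_cst; apply: (filtration_sigma hF).
    exact: knot_ge0.
  by apply: knot_le_last => //; exact: ltnW.
- exists (`|c| * expR (`|r| * T)) => i w iN; rewrite normrM ler_wpM2l//.
  rewrite ger0_norm ?expR_ge0// ler_expR (le_trans (ler_norm _))//.
  rewrite normrM ler_wpM2l// ger0_norm ?knot_ge0//.
  by apply: knot_le_last => //; exact: ltnW.
Qed.

Let K := `|c| * (`|r| * expR (`|r| * T)).
Let K0 : 0 <= K. Proof. by rewrite /K !mulr_ge0 ?expR_ge0. Qed.

Lemma sum_indic_itv (p : nat -> R) (n : nat) (s : R) :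
  (forall i, p i <= p i.+1) ->
  \sum_(i < n) (\1_`]p i, p i.+1] s : R) = \1_`]p 0%N, p n] s.
Proof.
move=> pS.
have p0 i : p 0%N <= p i by elim: i => // i /le_trans; apply.
elim: n => [|n ih].
  by rewrite big_ord0 indicE memNset//= in_itv/= => /andP[/lt_le_trans h /h]; rewrite ltxx.
rewrite big_ord_recr/= ih !indicE -natrD; congr (_%:R).
have E (a b : R) : (s \in (`]a, b]%classic : set R)) = (a < s <= b).
  by apply/idP/idP => [/set_mem|h]; [|apply: mem_set]; rewrite /= in_itv.
rewrite !E; have := p0 n; have := pS n.
case: (ltP (p 0%N) s); case: (leP s (p n)); case: (leP s (p n.+1)) => //= *;
  exfalso; lra.
Qed.

Lemma step_approx n (s : R) w : 0 < s -> s <= T ->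
  `|sp_fun (H n) s w - J s w| <= K * (T / n.+1%:R).
Proof.
move=> s0 sT.
(* The intervals partition []0, T]], so [J s] can be multiplied by this sum of indicators and
   compared with the step function interval by interval. *)
have S1 : \sum_(i < n.+1) (\1_`]knot T n i, knot T n i.+1] s : R) = 1.
  rewrite sum_indic_itv; last by move=> i; exact: knot_leS.
  by rewrite knot0 knot_last// indicE mem_set//= in_itv/= s0.
have -> : sp_fun (H n) s w - J s w = \sum_(i < n.+1)
    c * (expR (r * knot T n i) - expR (r * s)) * \1_`]knot T n i, knot T n i.+1] s.
  rewrite -[J s w]mulr1 -S1 mulr_sumr -sumrB; apply: eq_bigr => i _ /=.
  by rewrite /J; ring.
apply: le_trans (ler_norm_sum _ _ _) _.
have -> : K * (T / n.+1%:R) = K * (T / n.+1%:R) *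
    \sum_(i < n.+1) (\1_`]knot T n i, knot T n i.+1] s : R) by rewrite S1 mulr1.
rewrite mulr_sumr; apply: ler_sum => i _.
rewrite !normrM [X in _ * X]ger0_norm; last by rewrite indicE ler0n.
rewrite indicE; case: (boolP (s \in _)); last by rewrite !mulr0.
move=> /set_mem; rewrite /= in_itv/= => /andP[ks sk].
rewrite !mulr1 /K -mulrA ler_wpM2l// distrC.
apply: le_trans (expRM_lipschitz r (knot_ge0 T0 n i) (ltW ks) sT) _.
rewrite ler_wpM2l// ?mulr_ge0 ?expR_ge0//.
by rewrite -(knotS T n i) lerB.
Qed.

Lemma deterministic_jointly_measurable (f : R -> R) : measurable_fun setT f ->
  jointly_measurable T (fun s (_ : Omega) => f s).
Proof.
move=> mf; apply: measurable_funTS.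
exact: (measurableT_comp mf measurable_fst).
Qed.

Let mJ : jointly_measurable T J.
Proof.
apply: (@deterministic_jointly_measurable (fun s => c * expR (r * s))).
by apply: measurable_funM => //; exact: measurable_expRM.
Qed.

Let a n := (K * (T / n.+1%:R)) ^+ 2 * T.

Lemma step_energy n :
  (energy P T (fun s w => (sp_fun (H n) s w - J s w)%R) <= (a n)%:E)%E.
Proof.
have mS := sp_fun_jointly_measurable hF (H_admissible n).
have mD := jointly_measurableB mS mJ.
apply: (@le_trans _ _ (\int[P]_w (a n)%:E)%E); last first.
  by rewrite integral_cst// [X in (_ * X)%E](@probability_setT _ _ _ P) mule1.
apply: ge0_le_integral => //.
- by move=> w _; apply: integral_ge0 => s _; rewrite lee_fin sqr_ge0.
- exact: (measurable_path_energy (lexx T) mD).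
move=> w _.
(* [sp_fun] vanishes at time 0, so the approximation fails there. *)
rewrite -integral_itv_obnd_cbnd; last first.
  apply: measurable_funS (path_measurable_sqr w mD) => //.
  by move=> s /=; rewrite !in_itv/= => /andP[/ltW -> ->].
have -> : (a n)%:E = (\int[mu]_(s in `]0%R, T]) (((K * (T / n.+1%:R)) ^+ 2)%:E))%E.
  by rewrite integral_cst//= lebesgue_measure_itv/= lte_fin T0 -EFinB subr0 -EFinM.
apply: ge0_le_integral => //.
- by move=> s _; rewrite lee_fin sqr_ge0.
- apply: measurable_funS (path_measurable_sqr w mD) => //.
  by move=> s /=; rewrite !in_itv/= => /andP[/ltW -> ->].
move=> s; rewrite /= in_itv/= => /andP[s0 sT]; rewrite lee_fin.
rewrite -[leLHS]real_normK ?num_real// ler_sqr ?nnegrE//.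
  exact: step_approx.
by rewrite mulr_ge0// divr_ge0// ltW.
Qed.

Let a_cvg : a n @[n --> \oo] --> (0 : R).
Proof.
rewrite -[X in _ --> X](mul0r T); apply: cvgM; last exact: cvg_cst.
rewrite -[X in _ --> X](mulr0 (0 : R)) /a.
have h : K * (T / n.+1%:R) @[n --> \oo] --> (0 : R).
  by rewrite -[X in _ --> X](mulr0 K); apply: cvgM; [exact: cvg_cst|exact: mesh_cvg].
exact: (cvgM h h).
Qed.

Let a_le n m : (n <= m)%N -> a m <= a n.
Proof.
move=> nm; rewrite ler_wpM2r ?(ltW T0)// ler_sqr ?nnegrE ?mulr_ge0 ?divr_ge0 ?(ltW T0)//.
by rewrite ler_wpM2l// ler_wpM2l ?(ltW T0)// lef_pV2 ?posrE// ler_nat.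
Qed.

(* The right-hand side is the integral of [exp (r * s)] integrated by parts, an
   almost sure limit of Riemann sums. Completeness of the filtration makes [M]
   adapted, and Fatou's lemma upgrades the limit to L^2. *)
Lemma ito_integral_expR (M : R -> Omega -> R) :
  (forall t : R, 0 <= t -> t <= T -> {ae P, forall w,
     M t w = c * (expR (r * t) * B t w -
       \int[mu]_(s in `[0, t]) (r * expR (r * s) * B s w))}) ->
  is_ito_integral P T F B J M.
Proof.
move=> hM.
have [B0 cB aB _ _] := hB.
have hlim (t : R) : 0 <= t -> t <= T ->
    {ae P, forall w, sp_integral B (H n) t w @[n --> \oo] --> M t w}.
  move=> t0 tT; apply: filterS3 B0 cB (hM t t0 tT) => w B0w cBw ->.
  have h := cvg_sum_increments (k := r) T0 t0 tT cBw.
  rewrite B0w subr0 in h.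
  have -> : (fun n => sp_integral B (H n) t w) = (fun n => c *
      \sum_(i < n.+1) expR (r * knot T n i) *
      (B (Num.min (knot T n i.+1) t) w - B (Num.min (knot T n i) t) w)).
    apply/funext => n; rewrite mulr_sumr; apply: eq_bigr => i _ /=.
    by rewrite /increment mulrA.
  exact: (cvgM (cvg_cst c) h).
have mS n (t : R) : 0 <= t -> t <= T -> measurable_wrt (F t) (sp_integral B (H n) t).
  move=> t0 tT; have sF := filtration_sigma hF t0 tT.
  apply: (measurable_wrt_sum sF) => i.
  apply: (measurable_wrtM sF); first exact: measurable_wrt_cst.
  apply: (measurable_wrt_increment hF hB) => //.
  - by rewrite le_min t0 knot_ge0.
  - by rewrite /= le_min !ge_min lexx orbT knot_leS.
  - by rewrite ge_min lexx orbT.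
have mM (t : R) : 0 <= t -> t <= T -> measurable_wrt (F t) (M t).
  move=> t0 tT; apply: (measurable_wrt_ae_limit t0 tT (xi := fun n => sp_integral B (H n) t)).
    by move=> n; exact: mS.
  exact: hlim.
split; first by move=> t; rewrite in_itv/= => /andP[t0 tT]; exact: mM.
exists H; split => //.
  have aE : (a n)%:E @[n --> \oo] --> 0%E by apply: cvg_EFin => //; exact: nearW.
  apply: (squeeze_cvge _ (cvg_cst 0%E) aE); apply: nearW => n.
  by rewrite (energy_ge0 P T) step_energy.
move=> t; rewrite in_itv/= => /andP[t0 tT].
have S2 n : L2 P (sp_integral B (H n) t) by exact: (sp_integral_L2 hF hB).
have mMt : measurable_fun setT (M t) by exact: (filtration_measurable hF t0 tT (mM t t0 tT)).
(* Passing through [J] costs a factor 2 for each step function, and [a] is nonincreasing, so the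
   bound does not depend on [m]. *)
have dist n m : mean P (fun w => (sp_integral B (H n) t w - sp_integral B (H (n + m)%N) t w) ^+ 2)
    <= 4 * a n.
  rewrite -lee_fin.
  apply: le_trans (sp_integral_dist hF hB (H_admissible n) (H_admissible (n + m)%N) t0 tT) _.
  have -> : energy P T (fun s w => sp_fun (H n) s w - sp_fun (H (n + m)%N) s w) =
      energy P T (fun s w => sp_fun (H n) s w - J s w - (sp_fun (H (n + m)%N) s w - J s w)).
    by apply: eq_integral => w _; apply: eq_integral => s _; rewrite opprB addrA subrK.
  have m1 := sp_fun_jointly_measurable hF (H_admissible n).
  have m2 := sp_fun_jointly_measurable hF (H_admissible (n + m)%N).
  apply: le_trans (energyB_le P (jointly_measurableB m1 mJ) (jointly_measurableB m2 mJ)) _.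
  have -> : 4 * a n = 2 * a n + 2 * a n by ring.
  rewrite [leRHS]EFinD EFinM; apply: leeD; apply: lee_pmul => //.
  - exact: energy_ge0.
  - exact: step_energy.
  - exact: energy_ge0.
  - by apply: le_trans (step_energy (n + m)%N) _; rewrite lee_fin a_le// leq_addr.
(* With [n] fixed and [m] going to infinity, Fatou turns the Cauchy estimate into an estimate of the
   distance to the limit. *)
have fat n : L2 P (fun w => sp_integral B (H n) t w - M t w) /\
    mean P (fun w => (sp_integral B (H n) t w - M t w) ^+ 2) <= 4 * a n.
  apply: (@fatou_sqr _ _ _ P
    (fun m w => sp_integral B (H n) t w - sp_integral B (H (n + m)%N) t w)) => //.
  - by move=> m; exact: L2B.
  - by apply: measurable_funB => //; case: (S2 n).
  - apply: filterS (hlim t t0 tT) => w h.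
    apply: cvgB; first exact: cvg_cst.
    rewrite -(cvg_shiftn n) in h.
    rewrite (_ : (fun m => _) = (fun m => sp_integral B (H (m + n)%N) t w))//.
    by apply/funext => m; rewrite addnC.
have aE : (4 * a n)%:E @[n --> \oo] --> 0%E.
  apply: cvg_EFin; first exact: nearW.
  rewrite -[X in _ --> X](mulr0 4) /=.
  by apply: cvgM; [exact: cvg_cst|exact: a_cvg].
apply: (squeeze_cvge _ (cvg_cst 0%E) aE); apply: nearW => n.
have [L h] := fat n.
by rewrite (L1_EFin L.2) !lee_fin h andbT mean_ge0// => w; exact: sqr_ge0.
Qed.

End Candidate.

(** * The explicit fund for affine consumption and exponential investment *)

Section AffineConsumption.
Context {R : realType} {d : measure_display} {Omega : measurableType d}.
Variables (P : probability Omega R) (T : R).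
Hypothesis T0 : 0 < T.
Variables (F : R -> set (set Omega)) (B : R -> Omega -> R).
Hypothesis hF : complete_filtration P T F.
Hypothesis hB : brownian_motion P T F B.
Local Notation mu := (@lebesgue_measure R).
Variables (r v sigma x2 kappa m e : R).
Hypothesis r0 : r != 0.

Let C (t : R) : R := m * t + e.
Let I (t : R) (_ : Omega) : R := kappa * expR (r * t).

(** The solution of [q' = r * q + v * kappa * exp (r * t) - (m * t + e)] with [q 0 = x2]. The last
    parenthesis is a particular solution for the affine consumption; the factor [t] beside
    [exp (r * t)] appears because the forcing grows at the rate of the homogeneous solution. *)
Definition affine_mean (t : R) : R :=
  expR (r * t) * (x2 - (m / r ^+ 2 + e / r) + v * kappa * t) +
  (m / r * t + m / r ^+ 2 + e / r).

Definition affine_fund (t : R) (w : Omega) : R :=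
  affine_mean t + sigma * kappa * expR (r * t) * B t w.

Lemma affine_mean_derive (t : R) :
  is_derive t 1 affine_mean (r * affine_mean t + v * (kappa * expR (r * t)) - C t).
Proof.
rewrite /affine_mean /C; apply: is_derive_eq; rewrite /GRing.scale/=.
by field.
Qed.

Lemma continuous_affine_mean : continuous affine_mean.
Proof.
move=> t; apply/differentiable_continuous/derivable1_diffP.
by case: (affine_mean_derive t).
Qed.

Let continuous_rate : continuous
  (fun s => r * affine_mean s + v * (kappa * expR (r * s)) - C s).
Proof.
move=> s; apply: cvgB; last first.
  by apply: cvgD; [apply: cvgM; [exact: cvg_cst|exact: cvg_id]|exact: cvg_cst].
apply: cvgD; apply: cvgM; try exact: cvg_cst; first exact: continuous_affine_mean.
by apply: cvgM; [exact: cvg_cst|exact: continuous_expRM].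
Qed.

Lemma affine_mean0 : affine_mean 0 = x2.
Proof. by rewrite /affine_mean !mulr0 expR0; ring. Qed.

Lemma affine_fund_process : fund_process P T F B r v sigma x2 I C affine_fund.
Proof.
have [B0 cB aB _ _] := hB.
split.
- move=> t tI; have /andP[t0 tT] : 0 <= t <= T by move: tI; rewrite in_itv.
  have sF := filtration_sigma hF t0 tT.
  apply: (measurable_wrtD sF); first exact: measurable_wrt_cst.
  by apply: (measurable_wrtM sF); [exact: measurable_wrt_cst|exact: aB].
- apply: filterS cB => w cBw x.
  apply: cvgD; last (apply: cvgM; last exact: cBw).
    exact: (@continuous_subspaceT _ _ `[0, T] _ continuous_affine_mean).
  have ce : continuous (fun s => sigma * kappa * expR (r * s)).
    by move=> s; apply: cvgM; [exact: cvg_cst|exact: continuous_expRM].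
  exact: (@continuous_subspaceT _ _ `[0, T] _ ce).
(* Taking [M] as the residual makes the fund equation an identity. What remains is that the residual
   is the Ito integral: once the equation for the mean is subtracted, it is the integrated-by-parts
   form. *)
pose M t w := affine_fund t w - x2 -
  \int[mu]_(s in `[0, t]) (r * affine_fund s w + v * I s w - C s).
exists M; last first.
  by move=> t _; apply: aeW => w; rewrite /M; ring.
rewrite (_ : (fun t w => sigma * I t w) = (fun t _ => sigma * kappa * expR (r * t))); last first.
  by apply/funext => t; apply/funext => w; rewrite /I mulrA.
apply: (ito_integral_expR T0 hF hB) => t t0 tT.
apply: filterS cB => w cBw.
have iq : mu.-integrable `[0, t] (EFin \o
    (fun s => r * affine_mean s + v * (kappa * expR (r * s)) - C s)).
  exact/continuous_integrable/continuous_subspaceT/continuous_rate.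
have cG : {within `[0, T], continuous (fun s => r * expR (r * s) * B s w)}.
  move=> x; apply: cvgM; last exact: cBw.
  have ce : continuous (fun s => r * expR (r * s)).
    by move=> s; apply: cvgM; [exact: cvg_cst|exact: continuous_expRM].
  exact: (@continuous_subspaceT _ _ `[0, T] _ ce).
have iG := integrable_subitv (lexx 0) tT (continuous_integrable cG).
rewrite /M.
have -> : \int[mu]_(s in `[0, t]) (r * affine_fund s w + v * I s w - C s) =
    \int[mu]_(s in `[0, t]) ((r * affine_mean s + v * (kappa * expR (r * s)) - C s) +
      sigma * kappa * (r * expR (r * s) * B s w)).
  by apply: eq_Rintegral => s _; rewrite /affine_fund /I; ring.
rewrite RintegralD//; last exact: integrable_scale.
rewrite RintegralZl//.
rewrite (Rintegral_derive t0 affine_mean_derive continuous_rate).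
by rewrite affine_mean0 /affine_fund; ring.
Qed.

Lemma affine_admissible : (forall t : R, t \in `[0, T] -> 0 < C t) ->
  admissible P T F I C.
Proof.
move=> C0.
have cI : continuous (fun s => kappa * expR (r * s)).
  by move=> s; apply: cvgM; [exact: cvg_cst|exact: continuous_expRM].
split => //.
- split.
  + move=> t tI; have /andP[t0 tT] : 0 <= t <= T by move: tI; rewrite in_itv.
    exact: (measurable_wrt_cst (filtration_sigma hF t0 tT)).
  + apply: (@deterministic_jointly_measurable _ _ _ _ (fun s => kappa * expR (r * s))).
    by apply: measurable_funM => //; exact: measurable_expRM.
  + have iI : mu.-integrable `[0, T] (EFin \o (fun s => (kappa * expR (r * s)) ^+ 2)).
      apply/continuous_integrable/continuous_subspaceT => s.
      exact: (cvgM (cI s) (cI s)).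
    rewrite -[X in (X < _)%E]/(\int[P]_w (cst
      (\int[mu]_(t in `[0%R, T]) ((kappa * expR (r * t)) ^+ 2)%:E) w))%E.
    rewrite integral_cst// [X in (_ * X)%E](@probability_setT _ _ _ P) mule1.
    by apply: (integrable_lty _ iI); exact: measurable_itv.
- apply/continuous_integrable/continuous_subspaceT => s.
  by apply: cvgD; [apply: cvgM; [exact: cvg_cst|exact: cvg_id]|exact: cvg_cst].
Qed.

End AffineConsumption.

(** * Verification of optimality by concavity *)

Section Verification.
Context {R : realType} {d : measure_display} {Omega : measurableType d}.
Variables (P : probability Omega R) (T : R).
Variables (F : R -> set (set Omega)) (B : R -> Omega -> R).
Variables (r v sigma x2 alpha2 beta2 gamma2 rho : R).
Hypotheses (T0 : 0 < T) (r0 : r != 0) (sigma0 : 0 < sigma).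
Hypotheses (alpha0 : 0 < alpha2) (beta0 : 0 < beta2) (gamma0 : 0 < gamma2).
Hypothesis hF : complete_filtration P T F.
Hypothesis hB : brownian_motion P T F B.
Local Notation mu := (@lebesgue_measure R).
Local Notation obj := (objective P T r alpha2 beta2 gamma2 rho).

Let theta := v / sigma.
(** Chosen so that [alpha2 * sigma * kappa * exp (r * T) = theta]: then [B T] has the same
    coefficient in [- alpha2 * Xbar T] as in the logarithm of the weight. *)
Let kappa := v / (alpha2 * sigma ^+ 2) * expR (- r * T).
Let m := (1 - rho) / beta2 * r.
Let e := k2 T r v sigma x2 alpha2 beta2 gamma2 rho.
Let Ibar (t : R) (_ : Omega) : R := kappa * expR (r * t).
Let Cbar (t : R) : R := m * t + e.
Let q := affine_mean r v x2 kappa m e.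
Let Xbar := affine_fund (Omega := Omega) B r v sigma x2 kappa m e.
(* The Lagrange multiplier: the marginal utility at [Xbar T] is [y] times the
   Girsanov density. *)
Let y := expR (- (alpha2 * q T) + theta ^+ 2 * T / 2).

Let alpha_neq0 : alpha2 != 0. Proof. by rewrite gt_eqF. Qed.
Let beta_neq0 : beta2 != 0. Proof. by rewrite gt_eqF. Qed.
Let sigma_neq0 : sigma != 0. Proof. by rewrite gt_eqF. Qed.

Lemma optimal_investmentE :
  (fun t (_ : Omega) => optimal_investment T r v sigma alpha2 t) = Ibar.
Proof.
apply/funext => t; apply/funext => w; rewrite /Ibar /kappa /optimal_investment.
by rewrite -[RHS]mulrA -expRD; congr (_ * expR _); ring.
Qed.

Lemma optimal_consumptionE :
  optimal_consumption T r v sigma x2 alpha2 beta2 gamma2 rho = Cbar.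
Proof. by apply/funext => t; rewrite /Cbar /m /optimal_consumption mulrA. Qed.

(** [exp (r * T) - 1] has the sign of [r]. The quantity is the integral of [exp (r * s)] over
    [[0, T]], and its positivity makes the factor inverted in [k2] nonzero for negative rates
    too. *)
Lemma annuity_gt0 : 0 < (expR (r * T) - 1) / r.
Proof.
have [r_lt0|r_gt0|r_eq0] := ltrgtP r 0; last by move: r0; rewrite r_eq0 eqxx.
- by rewrite nmulr_rgt0 ?invr_lt0// subr_lt0 expR_lt1 nmulr_rlt0.
- by rewrite divr_gt0// subr_gt0 expR_gt1 mulr_gt0.
Qed.

(** The equation is linear in [e], since [q T] depends on [e] with slope [- (exp (r * T) - 1) / r].
    The definition of [k2] is its solution, and serves here to eliminate [ln gamma2], which leaves a
    rational identity. *)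
Lemma k2_equation :
  ln gamma2 - beta2 * e = - (alpha2 * q T) + theta ^+ 2 * T / 2 + r * T.
Proof.
have E0 := expR_gt0 (r * T).
have kE : kappa * expR (r * T) = v / (alpha2 * sigma ^+ 2).
  by rewrite /kappa -[LHS]mulrA -expRD mulNr addNr expR0 mulr1.
have A0 := annuity_gt0.
set E := expR (r * T) in E0 A0 kE *.
have D0 : beta2 / alpha2 + (E - 1) / r != 0.
  by rewrite gt_eqF// addr_gt0//; exact: divr_gt0.
have De : (beta2 / alpha2 + (E - 1) / r) * e = - (r * T) / alpha2 + x2 * E +
    ln gamma2 / alpha2 + v ^+ 2 * T / (2 * alpha2 * sigma ^+ 2) +
    (rho - 1) * (E - r * T - 1) / (beta2 * r).
  by rewrite /e /k2 mulVKf.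
have qE : q T = x2 * E - (m / r ^+ 2 + e / r) * E +
    v * (v / (alpha2 * sigma ^+ 2)) * T + (m / r * T + m / r ^+ 2 + e / r).
  by rewrite /q /affine_mean -kE -/E; ring.
have -> : ln gamma2 = alpha2 * ((beta2 / alpha2 + (E - 1) / r) * e +
    r * T / alpha2 - x2 * E - v ^+ 2 * T / (2 * alpha2 * sigma ^+ 2) -
    (rho - 1) * (E - r * T - 1) / (beta2 * r)).
  by rewrite De; field; rewrite ?r0 ?alpha_neq0 ?beta_neq0 ?sigma_neq0.
by rewrite qE /m /theta; field; rewrite ?r0 ?alpha_neq0 ?beta_neq0 ?sigma_neq0.
Qed.

(** Exponents are compared: the slope [m] is chosen so that
    [- rho * r * s - beta2 * m * s = - r * s], and the constants match by [k2_equation]. *)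
Lemma first_order_condition (s : R) :
  gamma2 * expR (- rho * r * s - beta2 * Cbar s) =
  y * expR (r * T) * expR (- r * s).
Proof.
rewrite -{1}(lnK gamma0) /y -!expRD; congr expR.
have -> : - (alpha2 * q T) + theta ^+ 2 * T / 2 + r * T = ln gamma2 - beta2 * e.
  by rewrite k2_equation.
by rewrite /Cbar /m; field; rewrite ?r0 ?alpha_neq0 ?beta_neq0 ?sigma_neq0.
Qed.

(** The term [theta ^ 2 * T / 2] in [y] undoes the normalisation of the weight. The identity is only
    almost sure because the weight uses [B T - B 0], while the fund uses [B T]. *)
Lemma marginal_utility : {ae P, forall w,
  expR (- alpha2 * Xbar T w) = y * weight T B theta w}.
Proof.
have [B0 _ _ _ _] := hB; apply: filterS B0 => w B0w.
have kE : kappa * expR (r * T) = v / (alpha2 * sigma ^+ 2).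
  by rewrite /kappa -[LHS]mulrA -expRD mulNr addNr expR0 mulr1.
rewrite /weight /exp_increment /increment B0w /y -!expRD; congr expR.
rewrite /Xbar /affine_fund -/q -[sigma * kappa * _]mulrA kE /theta.
by field; rewrite ?r0 ?alpha_neq0 ?beta_neq0 ?sigma_neq0.
Qed.

Lemma Xbar_fund : fund_process P T F B r v sigma x2 Ibar Cbar Xbar.
Proof. exact: affine_fund_process. Qed.

Lemma measurable_fund (I : R -> Omega -> R) (C : R -> R) X :
  fund_process P T F B r v sigma x2 I C X -> measurable_fun setT (X T).
Proof.
move=> [aX _ _]; apply: (filtration_measurable hF (ltW T0) (lexx T)).
by apply: aX; rewrite in_itv/= lexx ltW.
Qed.

Lemma measurable_expN (a : R) (X : Omega -> R) : measurable_fun setT X ->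
  measurable_fun setT (fun w => expR (a * X w)).
Proof. by move=> mX; exact: (measurableT_comp (measurable_expRM a)). Qed.

(** Positive consumption makes [exp (- beta2 * C s)] at most 1, so the utility is dominated by a
    continuous function of time. *)
Lemma integrable_utility (C : R -> R) : mu.-integrable `[0, T] (EFin \o C) ->
  (forall t : R, t \in `[0, T] -> 0 < C t) ->
  mu.-integrable `[0, T] (EFin \o (fun s => consumption_utility r beta2 rho s (C s))).
Proof.
move=> iC C0.
have mC : measurable_fun `[0, T] C by have /integrableP[/measurable_EFinP] := iC.
apply: integrable_scale => //.
have ie : mu.-integrable `[0, T] (EFin \o (fun s => expR ((- rho * r) * s))).
  apply/continuous_integrable/continuous_subspaceT => s; exact: continuous_expRM.
apply: le_integrable ie => //.
  apply/measurable_EFinP; apply: measurableT_comp => //.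
  apply: measurable_funB; apply: measurable_funM => //.
move=> s /= sT; rewrite lee_fin !ger0_norm ?expR_ge0// ler_expR gerBl.
by rewrite mulr_ge0 ?(ltW beta0)// ltW// C0.
Qed.

(** A genuine restriction on the parameters: a sufficiently negative [x2] makes [k2], the value at
    time 0, negative, and the candidate is then not admissible. *)
Hypothesis Cbar0 : forall t : R, t \in `[0, T] -> 0 < Cbar t.

Lemma Ibar_admissible : admissible P T F Ibar Cbar.
Proof. exact: affine_admissible. Qed.

(** Optimality speaks of every fund process of the candidate pair; uniqueness at time [T] lets the
    explicit one stand for all of them. *)
Lemma objective_unique X : fund_process P T F B r v sigma x2 Ibar Cbar X ->
  obj Cbar X = obj Cbar Xbar.
Proof.
move=> hX; rewrite /objective; congr (_ + _)%E; rewrite unlock.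
have XX := fund_process_unique T0 hF hB sigma0 Ibar_admissible hX Xbar_fund.
have mU (X' : R -> Omega -> R) : measurable_fun setT (X' T) ->
    measurable_fun setT (fun w => (fund_utility alpha2 (X' T w))%:E).
  move=> mX; apply/measurable_EFinP; apply: measurable_funM => //.
  exact: measurable_expN.
apply: ae_eq_integral => //.
- by apply: mU; exact: measurable_fund hX.
- by apply: mU; exact: measurable_fund Xbar_fund.
- by apply: filterS XX => w -> _.
Qed.

(** The tangent line at [xb] lies above the graph, by [1 + u <= exp u] with
    [u = - alpha2 * (x - xb)]. *)
Lemma utility_le (x xb : R) : fund_utility alpha2 x <=
  fund_utility alpha2 xb + expR (- alpha2 * xb) * (x - xb).
Proof.
rewrite /fund_utility.
have -> : expR (- alpha2 * x) = expR (- alpha2 * xb) * expR (- alpha2 * (x - xb)).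
  by rewrite -expRD; congr expR; ring.
have h := expR_ge1Dx (- alpha2 * (x - xb)).
have a0 := expR_gt0 (- alpha2 * xb).
rewrite -subr_ge0.
have -> : - alpha2^-1 * expR (- alpha2 * xb) + expR (- alpha2 * xb) * (x - xb) -
   - alpha2^-1 * (expR (- alpha2 * xb) * expR (- alpha2 * (x - xb))) =
   alpha2^-1 * expR (- alpha2 * xb) * (expR (- alpha2 * (x - xb)) - (1 + - alpha2 * (x - xb))).
  by field; rewrite gt_eqF.
by rewrite mulr_ge0 ?subr_ge0// mulr_ge0 ?(ltW a0)// invr_ge0 ltW.
Qed.

Lemma consumption_utility_le (s c cb : R) : consumption_utility r beta2 rho s c <=
  consumption_utility r beta2 rho s cb + expR (- rho * r * s - beta2 * cb) * (c - cb).
Proof.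
rewrite /consumption_utility.
have -> : expR (- rho * r * s - beta2 * c) =
    expR (- rho * r * s - beta2 * cb) * expR (- beta2 * (c - cb)).
  by rewrite -expRD; congr expR; ring.
have h := expR_ge1Dx (- beta2 * (c - cb)).
have a0 := expR_gt0 (- rho * r * s - beta2 * cb).
rewrite -subr_ge0.
set E := expR (- rho * r * s - beta2 * cb).
have -> : - beta2^-1 * E + E * (c - cb) - - beta2^-1 * (E * expR (- beta2 * (c - cb))) =
   beta2^-1 * E * (expR (- beta2 * (c - cb)) - (1 + - beta2 * (c - cb))).
  by field; rewrite gt_eqF.
by rewrite mulr_ge0 ?subr_ge0// mulr_ge0 ?(ltW a0)// invr_ge0 ltW.
Qed.

Lemma Xbar_utility_L1 : L1 P (fun w => fund_utility alpha2 (Xbar T w)).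
Proof.
have W2 := weight_L2 T0 hF hB theta.
apply: L1Z; apply: (ae_eq_L1 _ _ (L1Z y (L2_L1 W2))).
  by apply: measurable_expN; exact: measurable_fund Xbar_fund.
by apply: filterS marginal_utility => w ->.
Qed.

Lemma objective_le I C X : admissible P T F I C ->
  fund_process P T F B r v sigma x2 I C X -> (obj C X <= obj Cbar Xbar)%E.
Proof.
move=> hadm hX.
have [_ iC C0] := hadm.
have [_ iCb _] := Ibar_admissible.
have [Y2 Ym] := discounted_fund_weight T0 hF hB sigma0 hadm hX.
have [Z2 Zm] := discounted_fund_weight T0 hF hB sigma0 Ibar_admissible Xbar_fund.
have W2 := weight_L2 T0 hF hB theta.
have mX := measurable_fund hX.
have mXb := measurable_fund Xbar_fund.
pose lam := y * expR (r * T).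
pose D := \int[mu]_(s in `[0, T]) (expR (- r * s) * C s) -
  \int[mu]_(s in `[0, T]) (expR (- r * s) * Cbar s).
pose G w := expR (- alpha2 * Xbar T w) * (X T w - Xbar T w).
have mG : measurable_fun setT G.
  by apply: measurable_funM; [exact: measurable_expN|exact: measurable_funB].
(* The tangent term [G] is almost surely [lam] times a difference of two budget expressions with
   known means, in which [x2] cancels; the factor [exp (r * T)] of [lam] undoes the discounting. *)
pose G' w := lam * (weight T B theta w * (expR (- r * T) * X T w - x2) -
  weight T B theta w * (expR (- r * T) * Xbar T w - x2)).
have iG' : L1 P G' by apply: L1Z; apply: L1B; exact: L2M.
have GG' : {ae P, forall w, G' w = G w}.
  apply: filterS marginal_utility => w h; rewrite /G /G' h /lam.
  have -> : weight T B theta w * (expR (- r * T) * X T w - x2) -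
      weight T B theta w * (expR (- r * T) * Xbar T w - x2) =
    expR (- r * T) * (weight T B theta w * (X T w - Xbar T w)) by ring.
  by rewrite mulrA -[y * _ * _]mulrA -expRD mulNr subrr expR0 mulr1 mulrA.
have iG : L1 P G by exact: ae_eq_L1 GG' iG'.
have meanG : mean P G = - (lam * D).
  rewrite -(ae_eq_mean (L1_measurable iG') mG GG') /G' meanZ; last by apply: L1B; exact: L2M.
  by rewrite meanB; [rewrite Ym Zm /D; ring|exact: L2M|exact: L2M].
pose U := mean P (fun w => fund_utility alpha2 (Xbar T w)).
have fundE : (\int[P]_w (fund_utility alpha2 (X T w))%:E <= (U - lam * D)%:E)%E.
  have iU := Xbar_utility_L1.
  (* A nonintegrable fund utility has expectation [-oo]. *)
  have [iX|niX] := pselect (L1 P (fun w => fund_utility alpha2 (X T w))).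
    rewrite L1_EFin// lee_fin /U -meanG -meanD//.
    apply: mean_le => //; first exact: L1D.
    by move=> w; exact: utility_le.
  have mUX : measurable_fun setT (fun w => alpha2^-1 * expR (- alpha2 * X T w)).
    by apply: measurable_funM => //; exact: measurable_expN.
  have E0 w : 0 <= alpha2^-1 * expR (- alpha2 * X T w).
    by rewrite mulr_ge0 ?expR_ge0// invr_ge0 ltW.
  have -> : (\int[P]_w (fund_utility alpha2 (X T w))%:E)%E =
      (- \int[P]_w (alpha2^-1 * expR (- alpha2 * X T w))%:E)%E.
    rewrite -integral_ge0N//.
      by apply: eq_integral => w _; rewrite /fund_utility mulNr EFinN.
    by move=> w _; rewrite lee_fin.
  have [fin|] := ltP (\int[P]_w (alpha2^-1 * expR (- alpha2 * X T w))%:E)%E +oo%E.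
    exfalso; apply: niX; rewrite /fund_utility.
    under eq_fun do rewrite mulNr.
    apply: L1N; apply/integrableP; split; first exact/measurable_EFinP.
    by under eq_integral do rewrite /= ger0_norm//.
  by rewrite leye_eq => /eqP ->; rewrite leNye.
have iuC := integrable_utility iC C0.
have iuCb := integrable_utility iCb Cbar0.
have consE : gamma2 * \int[mu]_(s in `[0, T]) consumption_utility r beta2 rho s (C s) <=
    gamma2 * \int[mu]_(s in `[0, T]) consumption_utility r beta2 rho s (Cbar s) + lam * D.
  have iE := integrable_expRM_mul (- r) iC.
  have iEb := integrable_expRM_mul (- r) iCb.
  have iD : mu.-integrable `[0, T] (EFin \o
      (fun s => expR (- r * s) * C s - expR (- r * s) * Cbar s)).
    by have := integrableB _ iE iEb; apply.
  rewrite -RintegralZl// -RintegralZl//.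
  have -> : lam * D = \int[mu]_(s in `[0, T])
      (lam * (expR (- r * s) * C s - expR (- r * s) * Cbar s)).
    by rewrite RintegralZl// RintegralB.
  have ig : mu.-integrable `[0, T] (EFin \o
      (fun s => gamma2 * consumption_utility r beta2 rho s (C s))).
    exact: integrable_scale.
  have igb : mu.-integrable `[0, T] (EFin \o
      (fun s => gamma2 * consumption_utility r beta2 rho s (Cbar s))).
    exact: integrable_scale.
  have il : mu.-integrable `[0, T] (EFin \o
      (fun s => lam * (expR (- r * s) * C s - expR (- r * s) * Cbar s))).
    exact: integrable_scale.
  rewrite -RintegralD//; apply: le_Rintegral => //.
    by have := integrableD _ igb il; apply.
  move=> s _.
  have -> : lam * (expR (- r * s) * C s - expR (- r * s) * Cbar s) =
      gamma2 * (expR (- rho * r * s - beta2 * Cbar s) * (C s - Cbar s)).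
    by rewrite -mulrBr [LHS]mulrA /lam -first_order_condition -mulrA.
  by rewrite -mulrDr ler_pM2l//; exact: consumption_utility_le.
rewrite /objective unlock (L1_EFin Xbar_utility_L1) -/U.
apply: (@le_trans _ _ ((U - lam * D)%:E + (gamma2 * \int[mu]_(s in `[0%R, T])
  consumption_utility r beta2 rho s (C s))%:E)%E); first exact: leeD2r.
by rewrite -!EFinD lee_fin; lra.
Qed.

Lemma optimal_pair : optimal P T F B r v sigma x2 alpha2 beta2 gamma2 rho Ibar Cbar.
Proof.
split; first exact: Ibar_admissible.
  by exists Xbar; exact: Xbar_fund.
move=> X hX; rewrite objective_unique//; apply/eqP; rewrite eq_le; apply/andP; split.
  apply: ereal_sup_ubound; exists Ibar, Cbar, Xbar.
  by split; [exact: Ibar_admissible|exact: Xbar_fund|].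
apply: ub_ereal_sup => j [I [C [X' [hadm hX' ->]]]].
exact: objective_le hadm hX'.
Qed.

End Verification.

Unset Implicit Arguments.

Theorem theorem1 (R : realType) (d : measure_display) (Omega : measurableType d)
    (P : probability Omega R) (T : R)
    (F : R -> set (set Omega)) (B : R -> Omega -> R)
    (r v sigma x2 alpha2 beta2 gamma2 rho : R)
    (hT : 0 < T) (hr : r != 0) (hsigma : 0 < sigma)
    (halpha2 : 0 < alpha2) (hbeta2 : 0 < beta2)
    (hgamma2 : 0 < gamma2) (hrho : 0 < rho)
    (hF : complete_filtration P T F)
    (hB : brownian_motion P T F B)
    (hC : forall t : R, t \in `[0, T] ->
      0 < optimal_consumption T r v sigma x2 alpha2 beta2 gamma2 rho t) :
  optimal P T F B r v sigma x2 alpha2 beta2 gamma2 rho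
    (fun t _ => optimal_investment T r v sigma alpha2 t)
    (optimal_consumption T r v sigma x2 alpha2 beta2 gamma2 rho).
Proof.
rewrite optimal_consumptionE in hC *.
by rewrite optimal_investmentE; exact: optimal_pair.
Qed.
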